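(* Let $X$ be a simple point process on $S$, let $p:S\to(0,1)$ be measurable, let $Z$ be an independent thinning of $X$ with retention probability function $p(u)$, $u\in S$, let $Y=X\setminus Z$, let $\breve X\subseteq S\times\{0,1\}$ be the associated marked point process representation, and let $n\geq 1$. (1) For any non-negative or integrable $h:S^n\times\mathcal X\to\mathbb R$, $$\mathbb E\Big[\sum^{\neq}_{x_1,\ldots,x_n\in Z} h(x_1,\ldots,x_n,Y)\prod_{i=1}^n(1-p(x_i))\Big]=\mathbb E\Big[\sum^{\neq}_{x_1,\ldots,x_n\in Y} h(x_1,\ldots,x_n,Y\setminus\{x_1,\ldots,x_n\})\prod_{i=1}^n p(x_i)\Big].$$ (2) Provided that they exist, the $n$th-order Papangelou conditional intensity $\lambda_Z^{(n)}$ and the $n$th-order product density $\rho_Z^{(n)}$ of $Z$ satisfy, for almost every $(u_1,\ldots,u_n)\in S^n$, $$\lambda_Z^{(n)}(u_1,\ldots,u_n;Z)\stackrel{a.s.}{=}p(u_1)\cdots p(u_n)\,\mathbb E[\lambda_X^{(n)}(u_1,\ldots,u_n;X)\mid Z],$$ $$\rho_Z^{(n)}(u_1,\ldots,u_n)=p(u_1)\cdots p(u_n)\,\rho_X^{(n)}(u_1,\ldots,u_n),$$ where $\lambda_X^{(n)}$ and $\rho_X^{(n)}$ are the $n$th-order Papangelou conditional intensity and product density of $X$. (3) When the $n$th-order Papangelou conditional intensities $\breve\lambda^{(n)}$ of $\breve X$ and $\lambda_Y^{(n)}$ of $Y$ exist, they satisfy $$\mathbb E[\breve\lambda^{(n)}((u_1,1),\ldots,(u_n,1);\breve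 X)\mid Y]=\frac{\prod_{i=1}^n p(u_i)}{\prod_{i=1}^n(1-p(u_i))}\,\lambda_Y^{(n)}(u_1,\ldots,u_n;Y)$$ for almost all $u_1,\ldots,u_n\in S$. In particular, for a $p$-thinning with retention probability $p\in(0,1)$, one sets $p(\cdot)\equiv p$ in all the expressions above.
   Context: $S$ is a complete separable metric space with its Borel sets and a locally finite, $\sigma$-finite Borel reference measure $|\cdot|$ (integration written $\int \mathrm du$; ''almost every'' in $S^n$ refers to $|\cdot|^n$). $\mathcal X$ is the set of locally finite point configurations $\mathbf x\subseteq S$, with the $\sigma$-algebra generated by the counts $\mathbf x\mapsto\#(\mathbf x\cap A)$, $A\subseteq S$ Borel. A (simple) point process is a random element of $\mathcal X$. $\sum^{\neq}_{x_1,\ldots,x_n\in X}$ denotes summation over $n$-tuples of pairwise distinct points of $X$. ''Integrable'' $h$ means that the expectations involved are finite with $|h|$ in place of $h$; all functions are measurable. Independent thinning: given $X=\{x_i\}_{i=1}^N$, attach marks $m_i\in\{0,1\}$ which, conditionally on $X$, are independent with $\mathbb P(m_i=1\mid X)=p(x_i)$; then $\breve X=\{(x_i,m_i)\}_{i=1}^N\subseteq S\times\{0,1\}$, $Z=\{x:(x,1)\in\breve X\}$ and $Y=X\setminus Z=\{x:(x,0)\in\breve X\}$. If $p(\cdot)\equiv p$ is constant, $Z$ is called a $p$-thinning. The mark space $\{0,1\}$ carries the counting measure and $S\times\{0,1\}$ the product reference measure. The $n$th-order product density $\rho_X^{(n)}$ is the function with $\mathbb E[\sum^{\neq}_{x_1,\ldots,x_n\in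 X}h(x_1,\ldots,x_n)]=\int_{S^n}h(u_1,\ldots,u_n)\rho_X^{(n)}(u_1,\ldots,u_n)\,\mathrm du_1\cdots\mathrm du_n$ for all non-negative measurable $h$. The $n$th-order Papangelou conditional intensity $\lambda_X^{(n)}:S^n\times\mathcal X\to[0,\infty)$ is the function with $\mathbb E[\sum^{\neq}_{x_1,\ldots,x_n\in X}h(x_1,\ldots,x_n,X\setminus\{x_1,\ldots,x_n\})]=\int_{S^n}\mathbb E[h(u_1,\ldots,u_n,X)\lambda_X^{(n)}(u_1,\ldots,u_n;X)]\,\mathrm du_1\cdots\mathrm du_n$ for all non-negative measurable $h$ (the Georgii–Nguyen–Zessin formula). The same definitions apply to $Y$, $Z$, and to $\breve X$ as a point process on $S\times\{0,1\}$. *)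

(* Defs.v *)
From HB Require Import structures.
From mathcomp Require Import all_boot all_order all_algebra.
From mathcomp Require Import all_classical all_reals all_analysis.
From mathcomp Require Import measurable_realfun.

Set Implicit Arguments.
Unset Strict Implicit.
Unset Printing Implicit Defensive.

Import Order.TTheory GRing.Theory Num.Theory.

Local Open Scope classical_set_scope.
Local Open Scope ring_scope.
Local Open Scope ereal_scope.

#[short(type="measurablePseudoMetricType")]
HB.structure Definition MeasurablePseudoMetric d (R : numDomainType) :=
  {T of Measurable d T & PseudoMetric R T}.

#[short(type="measurableCompleteMetricType")]
HB.structure Definition MeasurableCompleteMetric d (R : numDomainType) :=
  {T of Measurable d T & Metric R T & Complete T}.

HB.instance Definition _ (R : numDomainType) := Measurable.on bool.
HB.instance Definition _ d1 d2 (R : numDomainType)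
  (E1 : measurablePseudoMetricType d1 R) (E2 : measurablePseudoMetricType d2 R) :=
  Measurable.on (E1 * E2)%type.

Definition separable (T : topologicalType) : Prop :=
  exists D : set T, countable D /\ dense D.

Section sigma_finite_product.
Context d1 d2 (T1 : measurableType d1) (T2 : measurableType d2) (R : realType).
Variables (mu : {sigma_finite_measure set T1 -> \bar R})
  (nu : {sigma_finite_measure set T2 -> \bar R}).

(* An alias: for [mu \x nu] itself the sigma-finite instance is not inferred,
   the one for products of subprobabilities taking precedence. *)
Definition mprod : set (T1 * T2) -> \bar R := mu \x nu.

Let mprod0 : mprod set0 = 0. Proof. exact: measure0. Qed.

Let mprod_ge0 A : 0 <= mprod A. Proof. exact: measure_ge0. Qed.

Let mprod_sigma_additive : semi_sigma_additive mprod.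
Proof. exact: measure_semi_sigma_additive. Qed.

HB.instance Definition _ := isMeasure.Build _ _ _ mprod
  mprod0 mprod_ge0 mprod_sigma_additive.

Let mprod_sigma_finite : sigma_finite setT mprod.
Proof.
have /sigma_finiteP[F [TF ndF Foo]] := sigma_finiteT mu.
have /sigma_finiteP[G [TG ndG Goo]] := sigma_finiteT nu.
exists (fun n => F n `*` G n).
  rewrite -setXTT TF TG predeqE => -[x y]; split.
    move=> [/= [n _ Fnx] [k _ Gky]]; exists (maxn n k) => //; split.
    - by move: x Fnx; exact/subsetPset/ndF/leq_maxl.
    - by move: y Gky; exact/subsetPset/ndG/leq_maxr.
  by move=> [n _ []/= ? ?]; split; exists n.
move=> k; have [? ?] := Foo k; have [? ?] := Goo k.
split; first exact: measurableX.
by rewrite /mprod product_measure1E// lte_mul_pinfty// ge0_fin_numE.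
Qed.

HB.instance Definition _ := Measure_isSigmaFinite.Build _ _ _ mprod
  mprod_sigma_finite.

End sigma_finite_product.

Section power_step.
Context d (T : measurableType d) (R : realType) (n : nat).
Variables (mu : {sigma_finite_measure set T -> \bar R})
  (nu : {sigma_finite_measure set (n.-tuple T) -> \bar R}).

Definition tcons (z : T * n.-tuple T) : n.+1.-tuple T :=
  [the n.+1.-tuple T of z.1 :: z.2].

Let measurable_tcons : measurable_fun [set: T * n.-tuple T] tcons.
Proof. exact: measurable_cons. Qed.

Definition power_step : set (n.+1.-tuple T) -> \bar R :=
  pushforward (mprod mu nu) tcons.

Let mpre A : measurable A -> measurable (tcons @^-1` A).
Proof. by move=> mA; rewrite -[X in measurable X]setTI; exact: measurable_tcons. Qed.

Let power_step0 : power_step set0 = 0.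
Proof. by rewrite /power_step /pushforward preimage_set0 measure0. Qed.

Let power_step_ge0 A : 0 <= power_step A.
Proof. exact: measure_ge0. Qed.

Let power_step_sigma_additive : semi_sigma_additive power_step.
Proof.
move=> F mF tF mUF; rewrite /power_step /pushforward preimage_bigcup.
apply: measure_semi_sigma_additive.
- by move=> k; exact: mpre.
- apply/trivIsetP => /= i j _ _ ij; rewrite -preimage_setI.
  by move/trivIsetP : tF => /(_ _ _ _ _ ij) ->//; rewrite preimage_set0.
- by rewrite -preimage_bigcup; exact: mpre.
Qed.

HB.instance Definition _ := isMeasure.Build _ _ _ power_step
  power_step0 power_step_ge0 power_step_sigma_additive.

Let power_step_sigma_finite : sigma_finite setT power_step.
Proof.
have [F FT Foo] := sigma_finiteT (mprod mu nu).
pose unc (t : n.+1.-tuple T) : T * n.-tuple T := (thead t, [tuple of behead t]).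
have uncK z : unc (tcons z) = z.
  by case: z => x t; rewrite /unc; congr pair; apply/val_inj.
have consK t : tcons (unc t) = t.
  by apply/val_inj => /=; case: t => -[|? ?].
have munc : measurable_fun setT unc.
  by apply/measurable_fun_pairP; split; [exact: measurable_tnth|
     exact: measurable_behead].
exists (fun k => unc @^-1` F k).
  by rewrite -preimage_bigcup -FT preimage_setT.
move=> k; have [mF Fk] := Foo k; split; first by rewrite -[X in measurable X]setTI; exact: munc.
rewrite /power_step /pushforward/=.
suff -> : tcons @^-1` (unc @^-1` F k) = F k by [].
by apply/seteqP; split => z /=; rewrite uncK.
Qed.

HB.instance Definition _ := Measure_isSigmaFinite.Build _ _ _ power_step
  power_step_sigma_finite.

End power_step.

Fixpoint mpower d (T : measurableType d) (R : realType)
    (mu : {sigma_finite_measure set T -> \bar R}) (n : nat) :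
    {sigma_finite_measure set (n.-tuple T) -> \bar R} :=
  match n with
  | 0%N => \d_([tuple] : 0.-tuple T)
  | m.+1 => power_step mu (mpower mu m)
  end.

(* An alias: the library only infers that [counting] is sigma-finite on [nat]. *)
Definition mark_counting (R : realType) : set bool -> \bar R := @counting bool R.

Section mark_counting.
Variable R : realType.

Let mark_counting0 : mark_counting R set0 = 0. Proof. exact: measure0. Qed.

Let mark_counting_ge0 A : 0 <= mark_counting R A.
Proof. exact: measure_ge0. Qed.

Let mark_counting_sigma_additive : semi_sigma_additive (mark_counting R).
Proof. exact: measure_semi_sigma_additive. Qed.

HB.instance Definition _ := isMeasure.Build _ _ _ (mark_counting R)
  mark_counting0 mark_counting_ge0 mark_counting_sigma_additive.

Let mark_counting_sigma_finite : sigma_finite setT (mark_counting R).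
Proof.
exists (fun=> setT); first by rewrite bigcup_const.
move=> _; split; first exact: measurableT.
rewrite /mark_counting /counting asboolT; first exact: ltry.
exact: (@finite_finset bool).
Qed.

HB.instance Definition _ := Measure_isSigmaFinite.Build _ _ _ (mark_counting R)
  mark_counting_sigma_finite.

End mark_counting.

Section configurations.
Context d (R : realType) (E : measurablePseudoMetricType d R).

(* The balls of [E * bool] are [ball x r `*` [set b]]: the library's
   pseudometric on [bool] has singleton balls of every radius.  A bounded subset
   of [E * bool] is covered by two of them, so quantifying over balls still
   gives finiteness on every bounded set. *)
Definition locally_finite_set (c : set E) : Prop :=
  forall (x : E) (r : R), finite_set (c `&` ball x r).

Record config := Config {
  points :> set E ;
  points_locally_finite : locally_finite_set points }.

Lemma locally_finite_set0 : locally_finite_set set0.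
Proof. by move=> x r; rewrite set0I. Qed.

HB.instance Definition _ := gen_eqMixin config.
HB.instance Definition _ := gen_choiceMixin config.
HB.instance Definition _ := isPointed.Build config (Config locally_finite_set0).

Definition count (A : set E) (c : config) : \bar R := counting (c `&` A).

Definition count_preimages : set (set config) :=
  \bigcup_(A in measurable) preimage_set_system setT (count A)
    measurable.

HB.instance Definition _ := @isMeasurable.Build (sigma_display count_preimages)
  config <<s count_preimages >>
  (@sigma_algebra0 _ setT _) (@sigma_algebraC _ _) (@sigma_algebra_bigcup _ setT _).

Lemma locally_finite_setD (c : config) (B : set E) :
  locally_finite_set (c `\` B).
Proof.
move=> x r; apply: sub_finite_set (points_locally_finite c x r).
by move=> y [[]].
Qed.

Definition remove n (c : config) (t : n.-tuple E) : config :=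
  Config (@locally_finite_setD c [set` t]).

Definition distinct_tuples n (c : set E) : set (n.-tuple E) :=
  [set t | uniq t /\ forall x, x \in t -> c x].

(* For [f >= 0] the second term vanishes and this is the unordered sum
   [\esum_(t in distinct_tuples c) f t]. *)
Definition sum_distinct n (c : set E) (f : n.-tuple E -> \bar R) : \bar R :=
  esum (distinct_tuples c) f^\+ - esum (distinct_tuples c) f^\-.

End configurations.

Section conditional_expectation.
Context d d' (T : measurableType d) (T' : measurableType d') (R : realType).
Variables (P : probability T R) (Y : T -> T').

Definition is_condexp (f g : T -> \bar R) : Prop :=
  measurable_fun [set: g_sigma_algebra_preimageType Y] g /\
  forall B : set T', measurable B ->
    \int[P]_(w in Y @^-1` B) g w = \int[P]_(w in Y @^-1` B) f w.

(* Meant for [f >= 0], integrable or not; the values may be infinite.  The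
   versions agree [P]-almost surely, one of them is chosen. *)
Definition condexp (f : T -> \bar R) : T -> \bar R :=
  xget (cst 0) [set g | is_condexp f g].

End conditional_expectation.

Section intensities.
Context dE (d : measure_display) (R : realType) (E : measurablePseudoMetricType dE R).
Context (T : measurableType d).
Variables (mu : {sigma_finite_measure set E -> \bar R}) (P : probability T R).
Variables (X : T -> config E) (n : nat).

Definition is_product_density (rho : n.-tuple E -> R) : Prop :=
  [/\ measurable_fun setT rho, forall u, (0 <= rho u)%R &
    forall h : n.-tuple E -> R,
      measurable_fun setT h -> (forall u, (0 <= h u)%R) ->
      \int[P]_w sum_distinct (X w) (fun x : n.-tuple E => (h x)%:E) =
      \int[mpower mu n]_u (h u * rho u)%:E].

Definition is_papangelou (lam : n.-tuple E * config E -> R) : Prop :=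
  [/\ measurable_fun setT lam, forall v, (0 <= lam v)%R &
    forall h : n.-tuple E * config E -> R,
      measurable_fun setT h -> (forall v, (0 <= h v)%R) ->
      \int[P]_w sum_distinct (X w)
        (fun x : n.-tuple E => (h (x, remove (X w) x))%:E) =
      \int[mpower mu n]_u \int[P]_w (h (u, X w) * lam (u, X w))%:E].

End intensities.

Section marking.
Context dS (d : measure_display) (R : realType) (S : measurablePseudoMetricType dS R).
Context (T : measurableType d).
Variables (P : probability T R) (p : S -> R).
Variables (X : T -> config S) (Xb : T -> config (S * bool)%type).

(* [X = {x_ i : i < N}] is an enumeration by functions of [X] alone (the values
   of [x_ i] and [m i] for [i >= N] are irrelevant), [Xb = {(x_ i, m i) : i < N}]
   and, on [N >= k], the marks [m 0, ..., m (k - 1)] are conditionally on [X]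
   independent Bernoulli with parameters [p (x_ 0), ..., p (x_ (k - 1))]. *)
Definition independent_marking : Prop :=
  let N w : \bar R := counting (points (X w)) in
  let ix w := [set i : nat | i%:R%:E < N w] in
  exists (x_ : nat -> T -> S) (m : nat -> T -> bool),
  [/\ forall i, measurable_fun [set: g_sigma_algebra_preimageType X] (x_ i),
      forall i, measurable_fun setT (m i),
      forall w, set_inj (ix w) (x_ ^~ w) /\ points (X w) = x_ ^~ w @` ix w,
      forall w, points (Xb w) = (fun i => (x_ i w, m i w)) @` ix w &
      forall k (e : k.-tuple bool),
        is_condexp P X
          (fun w => if (k%:R%:E <= N w) && [forall i : 'I_k, m i w == tnth e i]
                    then 1 else 0)
          (fun w => if k%:R%:E <= N w
                    then (\prod_(i < k) (if tnth e i then p (x_ i w)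
                                         else 1 - p (x_ i w)))%:E
                    else 0)].

End marking.

(* Main.v *)
(* Given [X], the marks at the points of a tuple are independent of the marks at
   the other points; writing the sums over [Z] and over [Y] as sums over index
   tuples in the enumeration of [X], both sides of (1) become the sum of
   [h (x, {y : m y = 0, y not in x}) * \prod p (x_i) (1 - p (x_i))].

   The space being separable, the configuration sigma-algebra is generated by the
   countable pi-system of the void events [c `&` D = set0], for [D] a finite union
   of base balls.  On these events the law of the thinning of a configuration [c]
   is the product of [1 - p y] over the points [y] of [c] in [D], so thinning is a
   measurable kernel on configurations.  Hence for [C] measurable, the sum over
   distinct tuples [x] of [Z] of [\1_C (x, Z \ x) / \prod p (x_i)] has the
   expectation of a sum over tuples of [X], of a function of [x] and [X \ x] to
   which the Georgii-Nguyen-Zessin formula for [X] applies; comparison with the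
   formula for [Z] gives (2), where countability of the pi-system lets "for almost
   every [u]" be exchanged with "for every event of [Z]".  For (3), compare (1),
   the formula for [Y], and the formula for the marked process restricted to
   tuples of marks [true]. *)
Require Import Defs.
From HB Require Import structures.
From mathcomp Require Import all_boot all_order all_algebra.
From mathcomp Require Import all_classical all_reals all_analysis.
From mathcomp Require Import measurable_realfun.
(* Imported again so that [count] is the one of [Defs], not [seq.count]. *)
Import Defs.

Set Implicit Arguments.
Unset Strict Implicit.
Unset Printing Implicit Defensive.

Import Order.TTheory GRing.Theory Num.Theory.
Import numFieldNormedType.Exports.

Local Open Scope classical_set_scope.
Local Open Scope ring_scope.
Local Open Scope ereal_scope.

(** Every thinning quantity here is an infinite product along the enumeration of [X], with one
    factor per index depending on the mark there. The hypothesis on the marks concerns the first [k]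
    of them, and only where [X] has at least [k] points. Hence identities are proved for partial
    products whose factors stop depending on the mark past the last point, and then passed to the
    limit. The delicate object is the thinning kernel. Conditioning on [X] alone would give one
    function per tuple of indices, each up to a null set, while the Georgii-Nguyen-Zessin formula
    for [X] takes a single function of the points and the reduced configuration. The void
    probability is such a function, free of the enumeration, and Dynkin induction carries this
    uniformity to all measurable sets. Intensities need not be integrable, so no argument may
    subtract infinite integrals: almost everywhere equality is decided between rational levels, and
    Dynkin arguments are run where one of the two densities is bounded. *)

Section ge0_measurable_induction.
Context d (T : measurableType d) (R : realType).
Import HBNNSimple.

(** Approximation by simple functions, packaged as an induction principle. It is applied over the
    sigma-algebra generated by a random element, and over the product of such a space with the
    configurations. *)
Lemma ge0_measurable_ind (Q : (T -> \bar R) -> Prop) :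
  (forall A, measurable A -> Q (EFin \o \1_A)) ->
  (forall (k : R) f, (0 <= k)%R -> measurable_fun setT f ->
    (forall x, 0 <= f x) -> Q f -> Q (fun x => k%:E * f x)) ->
  (forall f g, measurable_fun setT f -> measurable_fun setT g ->
    (forall x, 0 <= f x) -> (forall x, 0 <= g x) -> Q f -> Q g -> Q (f \+ g)) ->
  (forall F : (T -> \bar R)^nat, (forall n, measurable_fun setT (F n)) ->
    (forall n x, 0 <= F n x) -> (forall x, nondecreasing_seq (F^~ x)) ->
    (forall n, Q (F n)) -> Q (fun x => limn (F^~ x))) ->
  forall f, measurable_fun setT f -> (forall x, 0 <= f x) -> Q f.
Proof.
move=> Q1 QZ QD Qlim f mf f0.
have Qsfun (g : {nnsfun T >-> R}) : Q (EFin \o g).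
  (* A simple function is rebuilt by induction on the list of its values, so that closure under
     binary sums is enough; the empty list is the indicator of [set0]. *)
  pose S (s : seq R) x := (\sum_(y <- s) (y * \1_(g @^-1` [set y]) x)%R)%:E.
  have QS s : (forall y, y \in s -> (0 <= y)%R) ->
      [/\ Q (S s), measurable_fun setT (S s) & forall x, 0 <= S s x].
    elim: s => [_|y s IH ys].
      have SE : S [::] = EFin \o \1_set0.
        by apply/funext => x; rewrite /S big_nil /= indicE in_set0.
      split; first by rewrite SE; exact: Q1.
        by rewrite SE; exact/measurable_EFinP/measurable_indic.
      by move=> x; rewrite /S big_nil.
    have [z zs|QSs mSs Ss0] := IH _; first by apply: ys; rewrite in_cons zs orbT.
    have y0 : (0 <= y)%R by apply: ys; rewrite mem_head.
    have mgy : measurable (g @^-1` [set y]) by exact: measurable_funPTI.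
    have m1 : measurable_fun setT (EFin \o \1_(g @^-1` [set y]) : T -> \bar R).
      exact/measurable_EFinP/measurable_indic.
    have m2 : measurable_fun setT
        (fun x => y%:E * (EFin \o \1_(g @^-1` [set y])) x).
      exact: measurable_funeM.
    have p1 x : 0 <= (EFin \o \1_(g @^-1` [set y])) x :> \bar R by rewrite lee_fin.
    have p2 x : 0 <= y%:E * (EFin \o \1_(g @^-1` [set y])) x.
      by rewrite mule_ge0// lee_fin.
    have SE : S (y :: s) =
        (fun x => y%:E * (EFin \o \1_(g @^-1` [set y])) x) \+ S s.
      by apply/funext => x; rewrite /S big_cons EFinD EFinM.
    rewrite SE; split; first by apply: QD => //; apply: QZ => //; exact: Q1.
      exact: emeasurable_funD.
    by move=> x; rewrite adde_ge0.
  have -> : EFin \o g = S (finmap.enum_fset (fset_set (range g))).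
    apply/funext => x; rewrite /S /= fimfunE fsbig_finite//.
  have [|//] := QS (finmap.enum_fset (fset_set (range g))).
  move=> y; rewrite in_fset_set// inE => -[x _ <-]; exact: fun_ge0.
pose f_ := nnsfun_approx measurableT mf.
have -> : f = fun x => limn ((fun n => EFin \o f_ n)^~ x).
  apply/funext => x; apply/esym/cvg_lim => //.
  exact: (@cvg_nnsfun_approx _ _ _ _ measurableT _ mf).
apply: Qlim => //.
- by move=> n; exact/measurable_EFinP.
- by move=> n x; rewrite lee_fin.
- by move=> x m n mn; rewrite lee_fin; exact/lefP/nd_nnsfun_approx.
Qed.

End ge0_measurable_induction.

(** * Almost everywhere equality and conditional expectations *)

Section ae_uniqueness.
Context d (T : measurableType d) (R : realType) (mu : {measure set T -> \bar R}).

(** If [v > u] on a non-null set, then for some rationals [q1 < q2] and some [k] the set [C] of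
    points of [F k] with [u <= q1] and [q2 <= v] is not null. But the integrals over [C] give
    [q2 * mu C <= q1 * mu C] with [mu C] finite. The tests run over a family [G] so that it can be a
    sub-sigma-algebra, as conditional expectations require. *)
Lemma ae_eq_of_setintegral (G : set (set T)) (F : nat -> set T)
    (f g : T -> \bar R) :
  (forall A, G A -> measurable A) -> setI_closed G ->
  (forall k, G (F k)) -> \bigcup_k F k = setT -> (forall k, mu (F k) < +oo) ->
  measurable_fun setT f -> measurable_fun setT g ->
  (forall x, 0 <= f x) -> (forall x, 0 <= g x) ->
  (forall r, G [set x | f x <= r%:E]) -> (forall r, G [set x | r%:E <= f x]) ->
  (forall r, G [set x | g x <= r%:E]) -> (forall r, G [set x | r%:E <= g x]) ->
  (forall A, G A -> \int[mu]_(x in A) f x = \int[mu]_(x in A) g x) ->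
  {ae mu, forall x, f x = g x}.
Proof.
move=> Gm GI GF FT Foo.
have le_ae (u v : T -> \bar R) : measurable_fun setT u -> measurable_fun setT v ->
    (forall x, 0 <= u x) -> (forall x, 0 <= v x) ->
    (forall r, G [set x | u x <= r%:E]) -> (forall r, G [set x | r%:E <= v x]) ->
    (forall A, G A -> \int[mu]_(x in A) u x = \int[mu]_(x in A) v x) ->
    {ae mu, forall x, v x <= u x}.
  move=> mu_ mv u0 v0 Gu Gv uv.
  (* The bad set is covered by countably many [B i]. Requiring [0 <= q1] keeps the constants
     comparable with the integrals of nonnegative functions. *)
  pose B (i : nat * (rat * rat)) := if ((0 <= ratr i.2.1 :> R) && (ratr i.2.1 < ratr i.2.2 :> R))%R then
    F i.1 `&` ([set x | u x <= (ratr i.2.1)%:E] `&`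
               [set x | (ratr i.2.2)%:E <= v x]) else set0.
  have B0 i : {ae mu, forall x, ~ B i x}.
    case: i => k [q1 q2]; rewrite /B /=; case: ifPn => [/andP[q10 q12]|_].
    2: by apply: aeW => x [].
    set C := _ `&` _; have GC : G C by by apply: (GI) => //; apply: (GI).
    have mC := Gm _ GC.
    suff C0 : mu C = 0 by exists C; split => // x /= /contrapT.
    have Coo : mu C < +oo.
      apply: le_lt_trans (Foo k); apply: le_measure; rewrite ?inE//; first exact/Gm.
      exact: subIsetl.
    have h1 : \int[mu]_(x in C) u x <= (ratr q1)%:E * mu C.
      rewrite -integral_cst//; apply: ge0_le_integral => //.
      + exact: measurable_funTS.
      + by move=> x [_ []].
    have h2 : (ratr q2)%:E * mu C <= \int[mu]_(x in C) v x.
      rewrite -integral_cst//; apply: ge0_le_integral => //.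
      + by move=> x _; rewrite /= lee_fin (le_trans q10)// ltW.
      + exact: measurable_funTS.
      + by move=> x [_ []].
    have Cfin : mu C \is a fin_num by rewrite ge0_fin_numE.
    rewrite -uv// in h2; have := le_trans h2 h1.
    rewrite -(fineK Cfin) -!EFinM lee_fin -subr_ge0 -mulrBl => H.
    apply/eqP; rewrite eqe eq_le fine_ge0// andbT.
    by move: H; rewrite nmulr_rge0// subr_lt0.
  have : {ae mu, forall x, forall n,
      ~ (if unpickle n is Some i then B i x else False)}.
    apply: ae_foralln => n; case: (unpickle n) => [i|]; first exact: B0.
    by apply: aeW => x [].
  apply: filterS => x nB; rewrite leNgt; apply/negP => uvx.
  (* Lying below [v x], the value [u x] is finite; [v x] can be infinite, and then any real above
     [u x] serves, here [r + 1]. *)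
  have [r [y [ur ry yv]]] : exists r y : R, [/\ u x = r%:E, (r < y)%R & y%:E <= v x].
    move: (u0 x) uvx; case: (u x) => [r _||//]; last by move=> _; rewrite ltNge leey.
      case: (v x) => // [s|]; rewrite ?lte_fin => rs.
        by exists r, s.
      by exists r, (r + 1)%R; rewrite ltrDl ltr01 leey.
  have [q2 /[!in_itv]/= /andP[rq2 q2y]] := rat_in_itvoo ry.
  have [q1 /[!in_itv]/= /andP[rq1 q1q2]] := rat_in_itvoo rq2.
  have [k _ Fkx] : (\bigcup_k F k) x by rewrite FT.
  have := nB (pickle (k, (q1, q2))); rewrite pickleK /B /= ifT; last first.
    rewrite q1q2 andbT ltW//; apply: le_lt_trans rq1.
    by rewrite -lee_fin -ur.
  apply; split => //; split => /=; first by rewrite ur lee_fin ltW.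
  by apply: le_trans yv; rewrite lee_fin ltW.
move=> mf mg f0 g0 Gf1 Gf2 Gg1 Gg2 fg.
have := le_ae _ _ mf mg f0 g0 Gf1 Gg2 fg.
have := le_ae _ _ mg mf g0 f0 Gg1 Gf2 (fun A GA => esym (fg A GA)).
by apply: filterS2 => x gf fg'; apply/eqP; rewrite eq_le gf fg'.
Qed.

End ae_uniqueness.

Lemma sigma_finite_ae_eq d (T : measurableType d) (R : realType)
    (mu : {sigma_finite_measure set T -> \bar R}) (f g : T -> \bar R) :
  measurable_fun setT f -> measurable_fun setT g ->
  (forall x, 0 <= f x) -> (forall x, 0 <= g x) ->
  (forall A, measurable A -> \int[mu]_(x in A) f x = \int[mu]_(x in A) g x) ->
  {ae mu, forall x, f x = g x}.
Proof.
move=> mf mg f0 g0 fg; have [F FT Foo] := sigma_finiteT mu.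
have mle (h : T -> \bar R) r : measurable_fun setT h ->
    measurable [set x | h x <= r%:E] /\ measurable [set x | r%:E <= h x].
  by move=> mh; split; rewrite -[X in measurable X]setTI; exact: measurable_lee.
apply: (@ae_eq_of_setintegral _ _ _ mu measurable F) => //.
- exact: measurableI.
- by move=> k; have [] := Foo k.
- by move=> k; have [] := Foo k.
- by move=> r; have [] := mle _ r mf.
- by move=> r; have [] := mle _ r mf.
- by move=> r; have [] := mle _ r mg.
- by move=> r; have [] := mle _ r mg.
Qed.

Section condexp_theory.
Context d d' (T : measurableType d) (T' : measurableType d') (R : realType).
Variables (P : probability T R) (Y : T -> T') (mY : measurable_fun setT Y).

Lemma measurable_preimage (A : set T) :
  measurable (A : set (g_sigma_algebra_preimageType Y)) -> measurable A.
Proof. by move=> [B mB <-]; exact: mY. Qed.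

Lemma measurable_fun_preimage d1 (T1 : measurableType d1) (f : T -> T1) :
  measurable_fun [set: g_sigma_algebra_preimageType Y] f -> measurable_fun setT f.
Proof. by move=> mf _ B mB; apply: measurable_preimage; exact: mf. Qed.

Lemma measurable_preimage_comp d1 (T1 : measurableType d1) (f : T' -> T1) :
  measurable_fun setT f ->
  measurable_fun [set: g_sigma_algebra_preimageType Y] (f \o Y).
Proof.
move=> mf _ B mB; exists (f @^-1` B) => //.
by rewrite -[X in measurable X]setTI; exact: mf.
Qed.

(** The definition tests only against indicators of events of [Y]; the extension to all nonnegative
    [Y]-measurable [G] is by simple functions and monotone convergence, without integrability of
    [f]. *)
Lemma is_condexp_mul (f g : T -> \bar R) : is_condexp P Y f g ->
  measurable_fun setT f -> (forall w, 0 <= f w) -> (forall w, 0 <= g w) ->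
  forall G : T -> \bar R, measurable_fun [set: g_sigma_algebra_preimageType Y] G ->
    (forall w, 0 <= G w) -> \int[P]_w (G w * f w) = \int[P]_w (G w * g w).
Proof.
move=> [mg fg] mf f0 g0; have {}mg := measurable_fun_preimage mg.
apply: (@ge0_measurable_ind _ (g_sigma_algebra_preimageType Y)).
- move=> A [B mB <-]; rewrite setTI.
  have E (h : T -> \bar R) : (fun w => (EFin \o \1_(Y @^-1` B)) w * h w) =
      h \_ (Y @^-1` B).
    by rewrite epatch_indic; apply/funext => w; rewrite /= muleC.
  by rewrite !E -!integral_mkcond fg.
- move=> k h k0 mh h0 IH; have {}mh := measurable_fun_preimage mh.
  under eq_integral do rewrite -muleA.
  under [in RHS]eq_integral do rewrite -muleA.
  by rewrite !ge0_integralZl ?IH//;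
    first [exact: emeasurable_funM | by move=> w _; rewrite mule_ge0].
- move=> h k mh mk h0 k0 IHh IHk.
  have {}mh := measurable_fun_preimage mh.
  have {}mk := measurable_fun_preimage mk.
  under eq_integral do rewrite ge0_muleDl//.
  under [in RHS]eq_integral do rewrite ge0_muleDl//.
  by rewrite !ge0_integralD ?IHh ?IHk//;
    first [exact: emeasurable_funM | by move=> w _; rewrite mule_ge0].
- move=> F mF F0 ndF IH.
  have {}mF n := measurable_fun_preimage (mF n).
  have E (h : T -> \bar R) : measurable_fun setT h -> (forall w, 0 <= h w) ->
      \int[P]_w (limn (F^~ w) * h w) = limn (fun n => \int[P]_w (F n w * h w)).
    move=> mh h0; rewrite -monotone_convergence//.
    + apply: eq_integral => w _; apply/esym/cvg_lim => //.
      have cF : F^~ w @ \oo --> limn (F^~ w) by exact: ereal_nondecreasing_is_cvgn.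
      (* Products [0 * +oo] are set apart: either [h w] vanishes, or the limit does, and then by
         monotonicity every [F n w] does. *)
      have [->|h0'] := eqVneq (h w) 0.
        by rewrite mule0; under eq_fun do rewrite mule0; exact: cvg_cst.
      have [L0|L0] := eqVneq (limn (F^~ w)) 0.
        have F00 n : F n w = 0.
          apply/eqP; rewrite eq_le F0 andbT -L0.
          rewrite (cvg_lim _ (ereal_nondecreasing_cvgn (ndF w)))//.
          by apply: ereal_sup_ubound; exists n.
        by rewrite L0 mul0e; under eq_fun do rewrite F00 mul0e; exact: cvg_cst.
      apply: cvgeM => //; last exact: cvg_cst.
      by rewrite mule_defE (negbTE L0) (negbTE h0').
    + by move=> n; exact: emeasurable_funM.
    + by move=> n w _; rewrite mule_ge0.
    + by move=> w _ m n mn; rewrite lee_wpmul2r//; exact: ndF.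
  rewrite !E//; congr (limn _); apply/funext => n; exact: IH.
Qed.

(** The set [N] where [g] is negative is an event of [Y], so the integral of [|g|] over it is minus
    that of [f], hence at most 0. *)
Lemma is_condexp_ge0 (f g : T -> \bar R) : is_condexp P Y f g ->
  (forall w, 0 <= f w) -> {ae P, forall w, 0 <= g w}.
Proof.
move=> [mg fg] f0; have mg' := measurable_fun_preimage mg.
pose N := [set w | g w < 0].
have GN : measurable (N : set (g_sigma_algebra_preimageType Y)).
  by rewrite /N -[X in measurable X]setTI; exact: measurable_lte.
have mN := measurable_preimage GN.
have gN : \int[P]_(w in N) - g w = - \int[P]_(w in N) g w.
  apply: integralN; apply: fin_num_adde_defr.
  rewrite integral0_eq// => w /= Nw.
  by rewrite funeposE; apply/max_idPr/ltW.
have absN : \int[P]_(w in N) `|g w| = 0.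
  apply/eqP; rewrite eq_le integral_ge0// andbT.
  rewrite (@eq_integral _ _ _ _ _ (fun w => - g w)).
    rewrite gN leeNl oppe0; case: GN => B mB; rewrite setTI => <-.
    by rewrite fg//; exact: integral_ge0.
  by move=> w /[!inE] Nw; rewrite lte0_abs.
have := (ae_eq_integral_abs P mN (measurable_funTS mg')).1 absN.
apply: filterS => w gw; rewrite leNgt; apply/negP => Nw.
by have := gw Nw; rewrite /= => g0; rewrite g0 ltxx in Nw.
Qed.

Lemma is_condexp_ae (f g h : T -> \bar R) : is_condexp P Y f g ->
  measurable_fun [set: g_sigma_algebra_preimageType Y] h ->
  {ae P, forall w, h w = g w} -> is_condexp P Y f h.
Proof.
move=> [mg fg] mh hg; split => // B mB; rewrite -fg//.
have mYB : measurable (Y @^-1` B) by rewrite -[X in measurable X]setTI; exact: mY.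
apply: ae_eq_integral => //; [exact/measurable_funTS/measurable_fun_preimage..|].
by apply: filterS hg => w.
Qed.

Lemma is_condexp_mull (f g G : T -> \bar R) : is_condexp P Y f g ->
  measurable_fun setT f -> (forall w, 0 <= f w) -> (forall w, 0 <= g w) ->
  measurable_fun [set: g_sigma_algebra_preimageType Y] G -> (forall w, 0 <= G w) ->
  is_condexp P Y (fun w => G w * f w) (fun w => G w * g w).
Proof.
move=> fg mf f0 g0 mG G0; split; first exact: emeasurable_funM mG fg.1.
move=> B mB; rewrite [LHS]integral_mkcond [RHS]integral_mkcond.
have E (h : T -> \bar R) : (fun w => G w * h w) \_ (Y @^-1` B) =
    (fun w => (G w * (\1_(Y @^-1` B) w)%:E) * h w).
  by rewrite epatch_indic; apply/funext => w /=; rewrite muleAC.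
rewrite !E; apply/esym; apply: is_condexp_mul => //; last first.
  by move=> w; rewrite mule_ge0// lee_fin.
apply: emeasurable_funM => //; apply/measurable_EFinP; apply: measurable_indic.
by exists B; rewrite // setTI.
Qed.

(** [condexp] is a chosen version; the existence of [g] guarantees that the choice is made among
    genuine versions. The chosen one may be negative on a null set, so its positive part is what is
    compared with [g], the test sets being the events of [Y]. *)
Lemma condexp_ae_eq (f g : T -> \bar R) : is_condexp P Y f g ->
  (forall w, 0 <= g w) -> {ae P, forall w, condexp P Y f w = g w}.
Proof.
move=> [mg fg] g0; set h := condexp P Y f.
have [mh fh] : is_condexp P Y f h.
  by apply: (@xgetI _ (cst 0) [set u | is_condexp P Y f u] g); split.
have hg B : measurable B ->
    \int[P]_(w in Y @^-1` B) h w = \int[P]_(w in Y @^-1` B) g w.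
  by move=> mB; rewrite fg// fh.
have mg' := measurable_fun_preimage mg.
have mh' := measurable_fun_preimage mh.
have h_ge0 : {ae P, forall w, 0 <= h w}.
  by apply: (@is_condexp_ge0 g) => //; split => // B mB; exact: hg.
have mle (u : T -> \bar R) r :
    measurable_fun [set: g_sigma_algebra_preimageType Y] u ->
    measurable ([set w | u w <= r%:E] : set (g_sigma_algebra_preimageType Y)) /\
    measurable ([set w | r%:E <= u w] : set (g_sigma_algebra_preimageType Y)).
  by move=> mu; split; rewrite -[X in measurable X]setTI; exact: measurable_lee.
pose hp := h^\+.
have mhp : measurable_fun [set: g_sigma_algebra_preimageType Y] hp.
  exact: measurable_funepos.
have mhp' := measurable_fun_preimage mhp.
have hph : {ae P, forall w, hp w = h w}.
  by apply: filterS h_ge0 => w hw; rewrite /hp funeposE; apply/max_idPl.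
suff : {ae P, forall w, hp w = g w}.
  by apply: filterS2 hph => w -> .
apply: (@ae_eq_of_setintegral _ _ _ P
  (measurable : set (set (g_sigma_algebra_preimageType Y))) (fun=> setT)) => //.
- exact: measurable_preimage.
- by move=> A B mA mB; exact: (@measurableI _ (g_sigma_algebra_preimageType Y)).
- by rewrite bigcup_const.
- by move=> k; rewrite /= probability_setT ltry.
- by move=> w; exact: funepos_ge0.
- by move=> r; have [] := mle _ r mhp.
- by move=> r; have [] := mle _ r mhp.
- by move=> r; have [] := mle _ r mg.
- by move=> r; have [] := mle _ r mg.
- move=> A GA; have mA := measurable_preimage GA.
  transitivity (\int[P]_(w in A) h w).
    apply: ae_eq_integral => //; [exact: measurable_funTS..|].
    by apply: filterS hph => w.
  by case: GA => B mB; rewrite setTI => <-; exact: hg.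
Qed.

End condexp_theory.

(** * Counting measure, and sums over tuples of distinct points *)

Section counting_lemmas.
Context (R : realType).

Lemma counting_finite (E : choiceType) (A : set E) :
  finite_set A -> counting A = (size (finmap.enum_fset (fset_set A)))%:R%:E :> \bar R.
Proof. by move=> fA; rewrite /counting asboolT. Qed.

Lemma counting_infinite (E : choiceType) (A : set E) :
  infinite_set A -> counting A = +oo :> \bar R.
Proof. by move=> fA; rewrite /counting asboolF. Qed.

Lemma counting_image (E F : choiceType) (f : E -> F) (A : set E) :
  set_inj A f -> counting (f @` A) = counting A :> \bar R.
Proof.
move=> injf; have fA : (f @` A #= A)%card by apply: inj_card_eq.
have [finA|infA] := pselect (finite_set A).
  have finfA : finite_set (f @` A) by exact: finite_image.
  rewrite !counting_finite//; congr (_%:R%:E).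
  apply/card_eq_fsetP; rewrite fset_setK//; apply: card_eq_trans fA _.
  have /finite_setP[m Am] := finA.
  have -> : size (finmap.enum_fset (fset_set A)) = m.
    by apply/card_eq_fsetP; rewrite fset_setK.
  exact: Am.
rewrite !counting_infinite//.
by move=> /finite_setP[m fAm]; apply: infA; apply/finite_setP; exists m;
  apply: card_eq_trans fAm; rewrite card_eq_sym.
Qed.

Lemma counting_setU1 (E : choiceType) (x : E) (A : set E) :
  ~ A x -> counting (x |` A) = 1 + counting A :> \bar R.
Proof.
move=> Ax; have [finA|infA] := pselect (finite_set A).
  have finxA : finite_set (x |` A) by rewrite finite_setU.
  rewrite !counting_finite//.
  rewrite fset_setU// fset_set1 finmap.cardfsU1 in_fset_set// memNset//=.
  by rewrite natrD EFinD.
rewrite !counting_infinite ?addey//.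
by apply: contra_not infA => /sub_finite_set; apply; exact: subsetUr.
Qed.

Lemma le_counting (E : choiceType) (A B : set E) : A `<=` B ->
  counting A <= counting B :> \bar R.
Proof.
move=> AB; have [finB|infB] := pselect (finite_set B).
  have finA := sub_finite_set AB finB.
  rewrite !counting_finite// lee_fin ler_nat.
  by apply/finmap.fsubset_leq_card; rewrite -fset_set_sub.
by rewrite (counting_infinite infB) leey.
Qed.

Lemma counting_ge0 (E : choiceType) (A : set E) : 0 <= counting A :> \bar R.
Proof. by rewrite /counting; case: ifPn. Qed.

Lemma counting_eq0 (E : choiceType) (A : set E) :
  (counting A == 0 :> \bar R) = (A == set0).
Proof.
apply/eqP/eqP => [|->]; last by rewrite counting_finite// fset_set0.
have [finA|infA] := pselect (finite_set A); last by rewrite counting_infinite.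
rewrite counting_finite// => -[] /eqP; rewrite pnatr_eq0 finmap.cardfs_eq0.
by move=> /eqP/fset_set_set0 ->.
Qed.

(** Along an enumeration a count becomes a series of indicators, from which measurability of
    enumerated configurations and integrals against their counting measures are read off. *)
Lemma counting_image_series (E : choiceType) (x : nat -> E) (J : set nat)
    (A : set E) : set_inj J x ->
  counting ((x @` J) `&` A) = \sum_(i <oo) (\1_(J `&` x @^-1` A) i)%:E :> \bar R.
Proof.
move=> injx; have -> : (x @` J) `&` A = x @` (J `&` x @^-1` A).
  apply/seteqP; split=> [_ [[i Ji <-] Axi]|_ [i [Ji Axi] <-]]; first by exists i.
  by split => //; exists i.
rewrite counting_image; first by rewrite counting_dirac.
by move=> i j /[!inE] -[Ji _] [Jj _]; apply: injx; rewrite inE.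
Qed.

End counting_lemmas.

Definition index_tuples n (J : set nat) : set (n.-tuple nat) :=
  [set t | uniq t /\ forall i, i \in t -> J i].

(** Injectivity of the enumeration makes tuples of distinct points and tuples of distinct indices
    correspond. Indices live in a countable type that does not vary with the outcome, which makes
    sum and expectation exchangeable. *)
Lemma esum_distinct_tuples dE (R : realType) (E : measurablePseudoMetricType dE R)
    n (x : nat -> E) (J : set nat) (f : n.-tuple E -> \bar R) : set_inj J x ->
  esum (distinct_tuples (x @` J)) f =
  esum (index_tuples J) (fun t : n.-tuple nat => f (map_tuple x t)).
Proof.
move=> injx; rewrite (reindex_esum (index_tuples J) _ (map_tuple x))//; split.
- move=> t [ut tJ]; split => [|y].
    by rewrite /= map_inj_in_uniq// => i j /tJ Ji /tJ Jj; apply: injx; rewrite inE.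
  by move=> /mapP[i /tJ Ji ->]; exists i.
- move=> s t; rewrite !inE => -[_ sJ] [_ tJ] /(congr1 (tnth (T:=E) (n:=n))) st.
  apply: eq_from_tnth => i; have := congr1 (@^~ i) st; rewrite !tnth_map.
  by apply: injx; rewrite inE; [apply: sJ|apply: tJ]; exact: mem_tnth.
- move=> t [ut tJ].
  have /choice[j jP] (i : 'I_n) : exists j, J j /\ x j = tnth t i.
    by have [j Jj <-] := tJ _ (mem_tnth i t); exists j.
  have xj : map_tuple x [tuple j i | i < n] = t.
    by apply: eq_from_tnth => i; rewrite !tnth_map tnth_ord_tuple (jP i).2.
  exists [tuple j i | i < n] => //; split.
    by have := ut; rewrite -{1}xj => /map_uniq.
  by move=> i /mapP[k _ ->]; exact: (jP k).1.
Qed.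

Lemma esum_countType (R : realType) (I : countType) (a : I -> \bar R) :
  (forall i, 0 <= a i) ->
  \esum_(i in setT) a i =
  \sum_(k <oo) (if @pickle_inv I k is Some i then a i else 0).
Proof.
move=> a0; pose b k := if @pickle_inv I k is Some i then a i else 0.
have b0 k : 0 <= b k by rewrite /b; case: pickle_inv.
rewrite nneseries_esumT// -/b.
transitivity (\esum_(k in range (pickle : I -> nat)) b k).
  rewrite esum_image; last by move=> ? ? _ _; exact: (pcan_inj pickleK).
  by apply: eq_esum => i _; rewrite /b pickleK_inv.
rewrite esum_mkcond; apply: eq_esum => k _; case: ifPn => // nk.
rewrite /b; case E : (pickle_inv k) => [i|//].
move: nk => /negP; rewrite inE => nk.
by exfalso; apply: nk; exists i => //; have := @pickle_invK I k; rewrite E.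
Qed.

Section esum_integral.
Context d (T : measurableType d) (R : realType) (mu : {measure set T -> \bar R}).
Context (I : countType) (f : I -> T -> \bar R).
Hypotheses (mf : forall i, measurable_fun setT (f i)) (f0 : forall i x, 0 <= f i x).

Let g k x := if @pickle_inv I k is Some i then f i x else 0.

Let mg k : measurable_fun setT (g k).
Proof. by rewrite /g; case: pickle_inv => [i|]; [exact: mf|exact: measurable_cst]. Qed.

Let g0 k x : 0 <= g k x. Proof. by rewrite /g; case: pickle_inv. Qed.

Lemma measurable_esum : measurable_fun setT (fun x => \esum_(i in setT) f i x).
Proof.
under eq_fun do rewrite esum_countType//.
exact: (@ge0_emeasurable_sum _ T R setT g xpredT (fun k x _ _ => g0 k x)
  (fun k _ => mg k)).
Qed.

Lemma integral_esum :
  \int[mu]_x (\esum_(i in setT) f i x) = \esum_(i in setT) \int[mu]_x f i x.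
Proof.
rewrite (eq_integral (fun x => \sum_(k <oo) g k x)); last first.
  by move=> x _; rewrite (@esum_countType _ _ (f ^~ x)).
rewrite integral_nneseries//= (@esum_countType _ _ (fun i => \int[mu]_x f i x)).
  by apply: eq_eseriesr => k _; rewrite /g; case: pickle_inv => //; rewrite integral0.
by move=> i; exact: integral_ge0.
Qed.

End esum_integral.

Lemma measurable_count dE (R : realType) (E : measurablePseudoMetricType dE R)
  (A : set E) : measurable A -> measurable_fun setT (count A : config E -> \bar R).
Proof.
move=> mA _ B mB; apply: sub_sigma_algebra.
by exists A => //; exists B.
Qed.

Lemma measurable_fun_config dE (R : realType) (E : measurablePseudoMetricType dE R)
    d (T : measurableType d) (f : T -> config E) :
  (forall A, measurable A -> measurable_fun setT (fun w => count A (f w))) ->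
  measurable_fun setT f.
Proof.
move=> mf; apply: (@measurability _ _ T (config E) setT f (@count_preimages _ _ E)) => //.
move=> _ [_ [A mA [B mB <-]] <-]; rewrite !setTI.
by have := mf A mA measurableT B mB; rewrite setTI.
Qed.

(** * A countable base, and void events as generators of the configuration sigma-algebra *)

Section countable_base.
Context (R : realType) (dS : measure_display) (S : measurableCompleteMetricType dS R).
Hypothesis S_separable : separable S.

Lemma open_ball (x : S) (r : R) : open (ball x r).
Proof.
rewrite openE => y; rewrite ballEmdist /= => xy.
apply/nbhs_ballP; exists (r - mdist x y)%R => /=; first by rewrite subr_gt0.
move=> z; rewrite !ballEmdist /= => yz.
by apply: le_lt_trans (metric_triangle x y z) _; rewrite -ltrBrDl.
Qed.

Lemma open_countable_base : exists B : nat -> set S,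
  (forall i, open (B i)) /\
  forall (U : set S) x, open U -> U x -> exists i, B i x /\ B i `<=` U.
Proof.
have [D [/countable_injP[f injf] denseD]] := S_separable.
(* The code [(n, k)] stands for the ball of radius [1 / (k + 1)] about the point of [D] numbered
   [n]. The union has at most one term, as [f] is injective on [D], and is empty when no point has
   that number. *)
pose B (i : nat) : set S := if @pickle_inv (nat * nat)%type i is Some (n, k) then
  \bigcup_(a in [set a | D a /\ f a = n]) ball a (k.+1%:R^-1 : R) else set0.
exists B; split.
- move=> i; rewrite /B; case: pickle_inv => [[n k]|]; last exact: open0.
  by apply: bigcup_open => a _; exact: open_ball.
- move=> U x oU Ux.
  have /nbhs_ballP[e /= e0 xeU] : nbhs x U by exact: open_nbhs_nbhs.
  (* Half of [e], because a point of the base ball is reached from [x] through the centre: two steps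
     of length below [1 / (k + 1)]. *)
  have [k ke] : exists k, (k.+1%:R^-1 < e / 2 :> R)%R.
    have e20 : (0 < e / 2)%R by rewrite divr_gt0.
    exists (Num.truncn (e / 2)^-1)%R.
    by rewrite -[ltRHS]invrK ltf_pV2 ?posrE ?invr_gt0// truncnS_gt.
  have [a [xka Da]] : (ball x (k.+1%:R^-1 : R) `&` D) !=set0.
    by apply: denseD; [exists x; exact: ballxx|exact: open_ball].
  exists (pickle (f a, k)); rewrite /B pickleK_inv; split.
    by exists a => //; exact: ball_sym.
  move=> y [b [Db fb] bky]; apply: xeU.
  have {}bky : ball a (k.+1%:R^-1 : R) y.
    by have -> : a = b by apply: injf; rewrite ?inE ?fb.
  have := ball_triangle xka bky; apply: le_ball.
  by rewrite [leRHS](splitr e) lerD// ltW.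
Qed.

End countable_base.

Section void_events.
Context (R : realType) (dS : measure_display) (S : measurableCompleteMetricType dS R).
Hypothesis S_Borel : (measurable : set (set S)) = <<s [set A : set S | open A] >>.

Lemma measurable_open (U : set S) : open U -> measurable U.
Proof. by move=> oU; rewrite S_Borel; exact: sub_sigma_algebra. Qed.

Lemma measurable_closed (U : set S) : closed U -> measurable U.
Proof.
by move=> cU; rewrite -[U]setCK; apply: measurableC; apply: measurable_open;
  exact: closed_openC.
Qed.

Lemma measurable_singleton (x : S) : measurable [set x].
Proof.
apply: measurable_closed; apply: accessible_closed_set1.
by apply: hausdorff_accessible; exact: metric_hausdorff.
Qed.

Lemma bigcup_ball (x : S) : \bigcup_k ball x (k%:R : R) = setT.
Proof.
apply/seteqP; split=> // y _; exists (Num.truncn (mdist x y : R)).+1 => //.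
by rewrite ballEmdist /= truncnS_gt.
Qed.

Lemma measurable_config (c : config S) : measurable (points c).
Proof.
have -> : points c = \bigcup_k (points c `&` ball point (k%:R : R)).
  by rewrite -setI_bigcupr bigcup_ball setIT.
apply: bigcup_measurable => k _; apply: countable_measurable.
  exact: measurable_singleton.
exact/finite_set_countable/points_locally_finite.
Qed.

(** Seeing [A |-> count A c] as a measure gives continuity from below and subtraction for counts,
    and integrals over a configuration. *)
Definition count_measure (c : config S) : {measure set S -> \bar R} :=
  mrestr (@counting S R) (measurable_config c).

Lemma count_measureE (c : config S) (A : set S) : count_measure c A = count A c.
Proof. by rewrite /count_measure /= /mrestr setIC. Qed.

(** Only finitely many other points lie in the unit ball about [x], and a finite set is closed; this
    gives a ball about [x] avoiding them. *)
Lemma config_isolated (c : config S) x : points c x ->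
  exists2 r : R, (0 < r)%R & points c `&` ball x r `<=` [set x].
Proof.
move=> cx; pose F := (points c `&` ball x (1 : R)) `\ x.
have finF : finite_set F.
  apply: finite_setD; exact: points_locally_finite.
have cF : closed F.
  apply: (accessible_finite_set_closed.1 _) => //.
  by apply: hausdorff_accessible; exact: metric_hausdorff.
have /nbhs_ballP[e /= e0 xeF] : nbhs x (~` F).
  apply: open_nbhs_nbhs; split; first exact: closed_openC.
  by move=> [_]; exact.
exists (Num.min e 1)%R; first by rewrite lt_min e0 ltr01.
move=> y [cy xy] /=; apply: contrapT => yx.
have : (~` F) y by apply: xeF; apply: le_ball xy; rewrite ge_min lexx.
apply; split => //; split => //; apply: le_ball xy.
by rewrite ge_min lexx orbT.
Qed.

Definition void (D : set S) : set (config S) := [set c | points c `&` D = set0].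

Lemma voidU (D D' : set S) : void (D `|` D') = void D `&` void D'.
Proof.
apply/seteqP; split => c; rewrite /void /= setIUr.
  by rewrite setU_eq0.
by move=> [-> ->]; rewrite setU0.
Qed.

Lemma void0 : void set0 = setT.
Proof. by apply/seteqP; split => c //= _; rewrite /void /= setI0. Qed.

Lemma measurable_void D : measurable D -> measurable (void D).
Proof.
move=> mD; have -> : void D = (count D : config S -> \bar R) @^-1` [set 0].
  apply/seteqP; split => c; rewrite /void /count /=.
    by move=> /eqP; rewrite -(counting_eq0 R) => /eqP.
  by move=> /eqP; rewrite counting_eq0 => /eqP.
by rewrite -[X in measurable X]setTI; exact: measurable_count.
Qed.

Variable B : nat -> set S.
Hypothesis Bopen : forall i, open (B i).
Hypothesis Bbase : forall (U : set S) x, open U -> U x -> exists i, B i x /\ B i `<=` U.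

Definition base_union (s : seq nat) : set S := \bigcup_(i in [set` s]) B i.

Lemma base_union_cat s t : base_union (s ++ t) = base_union s `|` base_union t.
Proof.
rewrite /base_union -bigcup_setU; congr (bigcup _ _).
by apply/seteqP; split => i /=; rewrite mem_cat => /orP.
Qed.

Lemma measurable_base_union s : measurable (base_union s).
Proof. by apply: measurable_open; apply: bigcup_open => i _; exact: Bopen. Qed.

Let G : set (set (config S)) := [set void (base_union s) | s in setT].

(** A configuration meets [U] exactly when it meets one of the base sets included in [U], and these
    are countably many. *)
Let void_open U : open U -> <<s G >> (~` void U).
Proof.
move=> oU.
have -> : ~` void U = \bigcup_(i in [set i | B i `<=` U]) ~` void (base_union [:: i]).
  apply/seteqP; split => c /=.
    move=> /eqP/set0P[x [cx Ux]]; have [i [Bx BU]] := Bbase oU Ux.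
    exists i => //= /eqP; apply/negP/set0P; exists x; split => //.
    by exists i => //=; rewrite mem_head.
  move=> [i /= BU /eqP/set0P[x [cx [j /=]]]]; rewrite inE => /eqP -> Bx.
  by apply/eqP/set0P; exists x; split => //; exact: BU.
apply: (@bigcup_measurable _ (g_sigma_algebraType G)) => i _.
apply: (@measurableC _ (g_sigma_algebraType G)).
by apply: sub_sigma_algebra; exists [:: i].
Qed.

(* A configuration has at least [k + 1] points in [U] iff it meets some [B i]
   included in [U] and has at least [k] points in [U] outside the closure of
   [B i]: take for [B i] a small neighbourhood of one of the points. *)
Let count_ge k U : open U -> <<s G >> [set c | k%:R%:E <= count U c].
Proof.
elim: k U => [|k IH] U oU.
  have -> : [set c | 0%:R%:E <= count U c] = setT.
    by apply/seteqP; split => c //= _; exact: counting_ge0.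
  exact: (@measurableT _ (g_sigma_algebraType G)).
have -> : [set c : config S | k.+1%:R%:E <= count U c] =
    \bigcup_(i in [set i | B i `<=` U]) (~` void (B i) `&`
      [set c | k%:R%:E <= count (U `&` ~` closure (B i)) c]).
  apply/seteqP; split => c /=; last first.
    move=> [i /= BU [/eqP/set0P[x [cx Bx]] cU]].
    apply: (@le_trans _ _ (counting (x |` (points c `&` (U `&` ~` closure (B i)))))).
      rewrite counting_setU1; last by move=> [_ [_]]; apply; exact: subset_closure.
      by rewrite -natr1 addrC EFinD leeD2l.
    by apply: le_counting => y [->|[cy [Uy _]]]; split => //; exact: BU.
  move=> cU.
  have [x [cx Ux]] : (points c `&` U) !=set0.
    apply/set0P/negP; rewrite -(counting_eq0 R) => /eqP c0.
    by move: cU; rewrite /count c0 lee_fin lern0.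
  have [r r0 cxr] := config_isolated cx.
  have [i [Bx BxU]] : exists i, B i x /\ B i `<=` U `&` ball x (r / 2).
    apply: Bbase; first by apply: openI => //; exact: open_ball.
    by split => //; apply: ballxx; rewrite divr_gt0.
  exists i => /=; first by move=> y /BxU[].
  split; first by apply/eqP/set0P; exists x.
  have clB : closure (B i) `<=` ball x r.
    move=> y By.
    have r20 : (0 < r / 2)%R by rewrite divr_gt0.
    have [z [Bz yz]] := By _ (nbhsx_ballx y _ r20).
    rewrite [r]splitr; apply: (ball_triangle (y := z)); first by have [] := BxU _ Bz.
    exact: ball_sym.
  have cUE : points c `&` U = x |` (points c `&` (U `&` ~` closure (B i))).
    apply/seteqP; split => y.
      move=> [cy Uy]; have [->|/eqP yx] := eqVneq y x; [by left|right].
      by split => //; split => // /clB xy; apply: yx; exact: cxr.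
    by move=> [->|[cy []]].
  move: cU; rewrite /count cUE counting_setU1; last first.
    by move=> [_ [_]]; apply; exact: subset_closure.
  by rewrite -natr1 addrC EFinD leeD2lE.
apply: (@bigcup_measurable _ (g_sigma_algebraType G)) => i _.
apply: (@measurableI _ (g_sigma_algebraType G)); first exact: void_open.
by apply: IH; apply: openI => //; apply: closed_openC; exact: closed_closure.
Qed.

Let measurable_count_open U : open U ->
  measurable_fun setT (count U : g_sigma_algebraType G -> \bar R).
Proof.
move=> oU.
have mge (y : R) :
    measurable ([set c | y%:E <= count U c] : set (g_sigma_algebraType G)).
  have -> : [set c : config S | y%:E <= count U c] =
      \bigcup_(k in [set k | y%:E <= k%:R%:E]) [set c | k%:R%:E <= count U c].
    apply/seteqP; split => c /=; last by move=> [k /= yk]; exact: le_trans.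
    rewrite /count; have [fin|inf] := pselect (finite_set (points c `&` U)).
      by rewrite counting_finite// => yk; eexists; [exact: yk|rewrite /= counting_finite].
    move=> _; exists (Num.truncn y).+1; first by rewrite /= lee_fin ltW// truncnS_gt.
    by rewrite /= (counting_infinite _ inf) leey.
  by apply: (@bigcup_measurable _ (g_sigma_algebraType G)) => k _; exact: count_ge.
apply: (measurability (@ErealGenCInfty.G R)).
  exact: ErealGenCInfty.measurableE.
move=> _ [_ [y ->] <-]; rewrite setTI.
rewrite [X in measurable X](_ : _ = [set c | y%:E <= count U c]); first exact: mge.
by apply/seteqP; split => c /=; rewrite in_itv/= andbT.
Qed.

(** The sets [A] with this property form a lambda-system containing the open sets. Closure under
    differences subtracts counts, which is legitimate because inside a ball they are finite; hence
    the localization. *)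
Let measurable_count_ball k (A : set S) : measurable A ->
  measurable_fun setT
    (fun c : g_sigma_algebraType G => count (A `&` ball point (k%:R : R)) c).
Proof.
set O := ball _ _.
have mO : measurable O by apply: measurable_open; exact: open_ball.
pose H := [set A : set S | measurable A /\ measurable_fun setT
  (fun c : g_sigma_algebraType G => count (A `&` O) c)].
move=> mA; suff : measurable `<=` H by move=> /(_ _ mA)[].
move: mA => _.
have fO (c : config S) A0 : count (A0 `&` O) c \is a fin_num.
  rewrite /count counting_finite//.
  apply: sub_finite_set (@points_locally_finite _ _ _ c point (k%:R : R)).
  by move=> y [cy []].
rewrite S_Borel; apply: lambda_system_subset => //; first exact: openI.
- split => //.
  + split; first exact: measurableT.
    by rewrite setTI; apply: measurable_count_open; exact: open_ball.
  + move=> A1 B' BA [mA HA] [mB HB]; split; first exact: measurableD.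
    have -> : (fun c : g_sigma_algebraType G => count ((A1 `\` B') `&` O) c) =
        (fun c => count (A1 `&` O) c - count (B' `&` O) c).
      apply/funext => c; rewrite -!count_measureE.
      have -> : (A1 `\` B') `&` O = (A1 `&` O) `\` (B' `&` O).
        apply/seteqP; split => y; first by move=> [[Ay By] Oy]; split => // -[].
        by move=> [[Ay Oy] nB]; split => //; split => // By; apply: nB.
      rewrite measureD ?count_measureE; [|exact: measurableI..|].
        congr (_ - _); rewrite -!count_measureE; congr (count_measure c _).
        apply/seteqP; split => y; first by move=> [_].
        by move=> [By Oy]; split => //; split => //; exact: BA.
      by rewrite -[ltLHS]/(count_measure c (A1 `&` O)) count_measureE ltey_eq fO.
    exact: emeasurable_funB.
  + move=> F ndF HF; split; first by apply: bigcup_measurable => i _; exact: (HF i).1.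
    apply: (emeasurable_fun_cvg (fun i (c : g_sigma_algebraType G) => count (F i `&` O) c)).
      by move=> i; exact: (HF i).2.
    move=> c _; under eq_fun do rewrite -count_measureE.
    rewrite -count_measureE setI_bigcupl; apply: nondecreasing_cvg_mu.
    * by move=> i; apply: measurableI => //; exact: (HF i).1.
    * by apply: bigcup_measurable => i _; apply: measurableI => //; exact: (HF i).1.
    * by move=> i j ij; apply/subsetPset; apply: setSI; exact/subsetPset/ndF.
- move=> U oU; split; first exact: measurable_open.
  by apply: measurable_count_open; apply: openI => //; exact: open_ball.
Qed.

(** The count in [A] is the increasing limit of the counts in the bounded sets [A] intersected with
    balls, which removes the localization. *)
Lemma measurable_configE : (measurable : set (set (config S))) = <<s G >>.
Proof.
apply/seteqP; split; last first.
  apply: smallest_sub; first exact: sigma_algebra_measurable.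
  by move=> _ [s _ <-]; apply: measurable_void; exact: measurable_base_union.
apply: smallest_sub; first exact: smallest_sigma_algebra.
move=> _ [A mA [C mC <-]].
suff /(_ measurableT _ mC) : measurable_fun setT (count A : g_sigma_algebraType G -> \bar R) by [].
apply: (emeasurable_fun_cvg (fun k (c : g_sigma_algebraType G) =>
  count (A `&` ball point (k%:R : R)) c)).
  by move=> k; exact: measurable_count_ball.
have mO k : measurable (A `&` ball (point : S) (k%:R : R)).
  by apply: measurableI => //; apply: measurable_open; exact: open_ball.
move=> c _; under eq_fun do rewrite -count_measureE.
rewrite -[X in count X]setIT -(bigcup_ball point) setI_bigcupr -count_measureE.
apply: nondecreasing_cvg_mu => //; first exact: bigcup_measurable.
move=> i j ij; apply/subsetPset; apply: setIS; apply: le_ball.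
by rewrite ler_nat.
Qed.

Lemma setI_closed_void : setI_closed G.
Proof.
by move=> _ _ [s _ <-] [t _ <-]; exists (s ++ t); rewrite // base_union_cat voidU.
Qed.

End void_events.

(** * Generators of product sigma-algebras, and Dynkin arguments for integrals *)

Lemma measurable_all d (T : measurableType d) (I : Type) (f : I -> T -> bool)
    (s : seq I) : (forall i, measurable_fun setT (f i)) ->
  measurable_fun setT (fun w => all (f ^~ w) s).
Proof.
move=> mf; elim: s => [|i s IH] /=; first exact: measurable_cst.
exact: measurable_and.
Qed.

(** For fixed [A], the sets [B] such that the rectangle over [A] and [B] is generated form a
    sigma-algebra. For complements the full strip over [A] must itself be generated, whence the
    hypothesis [G setT]. *)
Lemma measurable_setX_generated d1 d2 (T1 : measurableType d1) (T2 : measurableType d2)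
    (G : set (set T2)) : measurable = <<s G >> -> G setT ->
  (measurable : set (set (T1 * T2))) = <<s [set A `*` B | A in measurable & B in G] >>.
Proof.
move=> GE GT; apply/seteqP; split; last first.
  apply: smallest_sub; first exact: sigma_algebra_measurable.
  move=> _ [A mA [B GB <-]]; apply: measurableX => //.
  by rewrite GE; exact: sub_sigma_algebra.
rewrite measurable_prod_measurableType; apply: smallest_sub.
  exact: smallest_sigma_algebra.
move=> _ [A mA [B mB <-]]; set M := <<s _ >>.
have MT C : measurable C -> M (C `*` setT).
  by move=> mC; apply: sub_sigma_algebra; exists C => //; exists setT.
have [M0 MC MU] : sigma_algebra setT M by exact: smallest_sigma_algebra.
suff : measurable `<=` [set B | M (A `*` B)] by apply.
rewrite GE; apply: smallest_sub; last first.
  by move=> C GC; apply: sub_sigma_algebra; exists A => //; exists C.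
split => /=.
- by rewrite setX0.
- move=> C MAC; have -> : A `*` (setT `\` C) = (A `*` setT) `\` (A `*` C).
    apply/seteqP; split => -[x y] /=; first by move=> [Ax [_ nC]]; split => // -[].
    by move=> [[Ax _] nAC]; split => //; split => // Cy; apply: nAC.
  have -> : (A `*` setT) `\` (A `*` C) = setT `\` ((setT `\` (A `*` setT)) `|` (A `*` C)).
    apply/seteqP; split => -[x y] /=.
      by move=> [Ax nAC]; split => // -[[_ /(_ Ax)]|].
    move=> [_ /not_orP[nA nAC]]; split => //; apply: contrapT => nAx; apply: nA.
    by split.
  apply: (MC); rewrite -bigcup2E; apply: (MU) => -[|[|k]] //=.
  by apply: (MC); exact: MT.
- by move=> F MF; rewrite setX_bigcupr; exact: MU.
Qed.

Section dynkin_integral.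
Context d d' (T : measurableType d) (T' : measurableType d') (R : realType).
Variables (mu : {measure set T -> \bar R}) (Phi : T -> T').
Hypothesis mPhi : measurable_fun setT Phi.

Lemma measurable_indic_comp (C : set T') : measurable C ->
  measurable_fun setT (fun w => (\1_C (Phi w))%:E : \bar R).
Proof.
move=> mC; apply/measurable_EFinP.
by apply: measurableT_comp => //; exact: measurable_indic.
Qed.

(** Uniqueness of finite measures on a generating pi-system, for the images under [Phi] of the
    measures of densities [f] and [g]. Finiteness is asked of [f] only: [G setT] gives both the same
    total mass. *)
Lemma dynkin_integral (G : set (set T')) (f g : T -> R) :
  measurable = <<s G >> -> setI_closed G -> G setT ->
  measurable_fun setT f -> measurable_fun setT g ->
  (forall w, (0 <= f w)%R) -> (forall w, (0 <= g w)%R) -> \int[mu]_w (f w)%:E < +oo ->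
  (forall C, G C -> \int[mu]_w ((f w)%:E * (\1_C (Phi w))%:E) =
                    \int[mu]_w ((g w)%:E * (\1_C (Phi w))%:E)) ->
  forall C, measurable C -> \int[mu]_w ((f w)%:E * (\1_C (Phi w))%:E) =
                    \int[mu]_w ((g w)%:E * (\1_C (Phi w))%:E).
Proof.
move=> GE GI GT mf mg f0 g0 foo fg C mC; rewrite GE in mC.
pose Q C := \int[mu]_w ((f w)%:E * (\1_C (Phi w))%:E) = \int[mu]_w ((g w)%:E * (\1_C (Phi w))%:E).
have h1T (h : T -> R) : (fun w => (h w)%:E * (\1_[set: T'] (Phi w))%:E) = EFin \o h.
  by apply/funext => w; rewrite indicE in_setT mule1.
have fgT : \int[mu]_w (f w)%:E = \int[mu]_w (g w)%:E by have := fg _ GT; rewrite !h1T.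
have h0 (h : T -> R) A w : (forall w, (0 <= h w)%R) -> 0 <= (h w)%:E * (\1_A (Phi w))%:E.
  by move=> h0; rewrite mule_ge0// lee_fin.
have mh (h : T -> R) A : measurable A -> measurable_fun setT h ->
    measurable_fun setT (fun w => (h w)%:E * (\1_A (Phi w))%:E).
  by move=> mA mh; apply: emeasurable_funM; [exact/measurable_EFinP|exact: measurable_indic_comp].
apply: (@dynkin_induction _ T' G Q) => //; first exact: fg.
- move=> A mA QA; rewrite /Q.
  have E (h : T -> R) : measurable_fun setT h -> (forall w, (0 <= h w)%R) ->
      \int[mu]_w (h w)%:E < +oo ->
      \int[mu]_w ((h w)%:E * (\1_(~` A) (Phi w))%:E) =
      \int[mu]_w (h w)%:E - \int[mu]_w ((h w)%:E * (\1_A (Phi w))%:E).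
    move=> mh' h0' hoo.
    have <- : \int[mu]_w ((h w)%:E * (\1_(~` A) (Phi w))%:E) +
              \int[mu]_w ((h w)%:E * (\1_A (Phi w))%:E) = \int[mu]_w (h w)%:E.
      rewrite -ge0_integralD//; [|by move=> w _; exact: h0|by apply: mh => //; exact: measurableC|
        by move=> w _; exact: h0|exact: mh].
      apply: eq_integral => w _; rewrite !indicE in_setC.
      by case: (_ \in A); rewrite /= ?mule1 ?mule0 ?adde0 ?add0e.
    rewrite addeK// ge0_fin_numE; last by apply: integral_ge0 => w _; exact: h0.
    apply: le_lt_trans hoo; apply: ge0_le_integral => //.
    + by move=> w _; exact: h0.
    + by apply: mh.
    + exact/measurable_EFinP.
    + move=> w _; rewrite indicE; case: (_ \in A); first by rewrite mule1.
      by rewrite mule0 lee_fin.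
  by rewrite !E// -?fgT// QA.
- move=> F mF tF QF; rewrite /Q.
  have E (h : T -> R) : measurable_fun setT h -> (forall w, (0 <= h w)%R) ->
      \int[mu]_w ((h w)%:E * (\1_(\bigcup_k F k) (Phi w))%:E) =
      \sum_(k <oo) \int[mu]_w ((h w)%:E * (\1_(F k) (Phi w))%:E).
    move=> mh' h0'; rewrite -integral_nneseries//; last 2 first.
      by move=> k; exact: mh.
      by move=> k w _; exact: h0.
    apply: eq_integral => w _; rewrite nneseriesZl; last by move=> k _; rewrite lee_fin.
    by rewrite indic_bigcup.
  by rewrite !E//; apply: eq_eseriesr => k _; exact: QF.
Qed.

End dynkin_integral.

Lemma prod_bool_forall (R : comPzSemiRingType) k (B : 'I_k -> bool) :
  (\prod_(i < k) (B i)%:R)%R = [forall i, B i]%:R :> R.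
Proof.
case: forallP => [Bi|nB]; first by rewrite big1// => i _; rewrite Bi.
have /existsP[i Bi] : [exists i, ~~ B i].
  by rewrite -negb_forall; apply/negP => /forallP.
rewrite (bigD1 i)//= (negbTE Bi) mul0r//.
Qed.

Lemma prodr_le1 (R : realDomainType) k (c : 'I_k -> R) :
  (forall i, 0 <= c i <= 1)%R -> (0 <= \prod_(i < k) c i <= 1)%R.
Proof.
move=> c01; elim/big_rec : _ => [|i y _ /andP[y0 y1]]; first by rewrite ler01 lexx.
by have /andP[c0 c1] := c01 i; rewrite mulr_ge0//= mulr_ile1.
Qed.

(** * Conditional expectations, given [X], of products of mark-dependent factors *)

Section marks.
Context dS (d : measure_display) (R : realType) (S : measurablePseudoMetricType dS R).
Context (T : measurableType d) (P : probability T R).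
Variables (p : S -> R) (X : T -> config S).
Variables (x_ : nat -> T -> S) (m : nat -> T -> bool).
Hypothesis mX : measurable_fun setT X.
Hypothesis mp : measurable_fun setT p.
Hypothesis p01 : forall u, (0 < p u < 1)%R.

Notation TX := (g_sigma_algebra_preimageType X).

Definition in_range (i : nat) (w : T) : bool :=
  i%:R%:E < counting (points (X w)) :> \bar R.

Hypothesis mx : forall i, measurable_fun [set: TX] (x_ i).
Hypothesis mm : forall i, measurable_fun setT (m i).
Hypothesis marks_condexp : forall k (e : k.-tuple bool),
  is_condexp P X
    (fun w => if (k%:R%:E <= (counting (points (X w)) : \bar R)) &&
                 [forall i : 'I_k, m i w == tnth e i]
              then 1 else 0)
    (fun w => if k%:R%:E <= (counting (points (X w)) : \bar R)
              then (\prod_(i < k) (if tnth e i then p (x_ i w)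
                                   else 1 - p (x_ i w)))%:E
              else 0).

Definition has_points (k : nat) (w : T) : bool :=
  k%:R%:E <= counting (points (X w)) :> \bar R.

Lemma measurable_has_points k : measurable_fun [set: TX] (has_points k).
Proof.
apply: measurable_fun_lee; first exact: measurable_cst.
rewrite (_ : (fun w => _) = count setT \o X); last first.
  by apply/funext => w; rewrite /= /count setIT.
by apply: measurable_preimage_comp; exact: measurable_count.
Qed.

Lemma measurable_in_range i : measurable_fun [set: TX] (in_range i).
Proof.
apply: measurable_fun_lte; first exact: measurable_cst.
rewrite (_ : (fun w => _) = count setT \o X); last first.
  by apply/funext => w; rewrite /= /count setIT.
by apply: measurable_preimage_comp; exact: measurable_count.
Qed.

Lemma has_pointsS i w : has_points i.+1 w = in_range i w.
Proof.
rewrite /has_points /in_range; have [fin|inf] := pselect (finite_set (points (X w))).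
  by rewrite counting_finite// lee_fin lte_fin ler_nat ltr_nat.
by rewrite counting_infinite// leey ltry.
Qed.

(* [avg a b i] is the conditional expectation of [mix a b i] given [X]. *)
Definition mix (a b : nat -> T -> R) i w : R := if m i w then a i w else b i w.

Definition avg (a b : nat -> T -> R) i w : R :=
  (p (x_ i w) * a i w + (1 - p (x_ i w)) * b i w)%R.

Section mix_avg.
Variables a b : nat -> T -> R.
Hypotheses (ma : forall i, measurable_fun [set: TX] (a i))
  (mb : forall i, measurable_fun [set: TX] (b i)).
Hypotheses (a0 : forall i w, (0 <= a i w)%R) (b0 : forall i w, (0 <= b i w)%R).

Lemma mix_ge0 i w : (0 <= mix a b i w)%R.
Proof. by rewrite /mix; case: ifP. Qed.

Lemma avg_ge0 i w : (0 <= avg a b i w)%R.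
Proof.
have /andP[/ltW p0 /ltW p1] := p01 (x_ i w).
by rewrite addr_ge0// mulr_ge0// subr_ge0.
Qed.

Lemma measurable_px i : measurable_fun [set: TX] (fun w => p (x_ i w)).
Proof. by apply: measurableT_comp => //; exact: mx. Qed.

Lemma measurable_avg i : measurable_fun [set: TX] (avg a b i).
Proof.
apply: measurable_funD; apply: measurable_funM => //; first exact: measurable_px.
by apply: measurable_funB => //; exact: measurable_px.
Qed.

Lemma measurable_mix i : measurable_fun setT (mix a b i).
Proof.
by apply: measurable_fun_ifT => //; [exact: (measurable_fun_preimage mX)..].
Qed.

Lemma measurable_prod_avg k :
  measurable_fun [set: TX] (fun w => (\prod_(i < k) avg a b i w)%R).
Proof. by apply: measurable_prod => i _; exact: measurable_avg. Qed.

Lemma measurable_prod_mix k :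
  measurable_fun setT (fun w => (\prod_(i < k) mix a b i w)%R).
Proof. by apply: measurable_prod => i _; exact: measurable_mix. Qed.

(** Where [X] has at least [k] points, the product expands over the patterns of the first [k] marks,
    and the hypothesis gives the conditional probability of each pattern. *)
Let integral_mix_has_points k (G : T -> \bar R) :
  measurable_fun [set: TX] G -> (forall w, 0 <= G w) ->
  \int[P]_w (G w * (if has_points k w then \prod_(i < k) mix a b i w else 0)%R%:E) =
  \int[P]_w (G w * (if has_points k w then \prod_(i < k) avg a b i w else 0)%R%:E).
Proof.
move=> mG G0.
(* For a pattern [f]: [c f] is its coefficient, a function of [X]; [u f] is the indicator that the
   marks follow it; [v f] is the conditional expectation of [u f]. *)
pose c (f : {ffun 'I_k -> bool}) w : R :=
  (\prod_(i < k) (if f i then a i w else b i w))%R.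
pose u (f : {ffun 'I_k -> bool}) w : R :=
  (if has_points k w then \prod_(i < k) (m i w == f i)%:R else 0)%R.
pose v (f : {ffun 'I_k -> bool}) w : R :=
  (if has_points k w then \prod_(i < k) (if f i then p (x_ i w) else 1 - p (x_ i w))
   else 0)%R.
have c0 f w : (0 <= c f w)%R by apply: prodr_ge0 => i _; case: ifP.
have mc f : measurable_fun [set: TX] (c f).
  by apply: measurable_prod => i _; case: (f i).
have u0 f w : (0 <= u f w)%R by rewrite /u; case: ifP => // _; exact: prodr_ge0.
have v0 f w : (0 <= v f w)%R.
  rewrite /v; case: ifP => // _; apply: prodr_ge0 => i _.
  have /andP[/ltW p0 /ltW p1] := p01 (x_ i w).
  by case: ifP => // _; rewrite subr_ge0.
have mu_ f : measurable_fun setT (u f).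
  apply: measurable_fun_ifT => //.
    exact: (measurable_fun_preimage mX (measurable_has_points k)).
  apply: measurable_prod => i _.
  rewrite (_ : (fun w => _) = (fun w => if m i w then (f i)%:R else (~~ f i)%:R)).
    exact: measurable_fun_ifT.
  by apply/funext => w; case: (m i w); case: (f i).
have uvc f : is_condexp P X (EFin \o u f) (EFin \o v f).
  have [e ei] : exists e : k.-tuple bool, forall i, tnth e i = f i.
    by exists [tuple f i | i < k] => i; rewrite tnth_mktuple.
  have := marks_condexp e.
  congr (is_condexp P X _ _); apply/funext => w /=.
    have -> : [forall i : 'I_k, m i w == tnth e i] = [forall i : 'I_k, m i w == f i].
      by apply: eq_forallb => i; rewrite ei.
    rewrite -/(has_points k w) /u; case: (has_points k w) => //=.
    by rewrite prod_bool_forall; case: [forall i, _].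
  rewrite -/(has_points k w) /v; case: (has_points k w) => //=.
  by congr EFin; apply: eq_bigr => i _; rewrite ei.
have mGc f : measurable_fun [set: TX] (fun w => G w * (c f w)%:E).
  by apply: emeasurable_funM => //; exact/measurable_EFinP.
have Gc0 f w : 0 <= G w * (c f w)%:E by rewrite mule_ge0// lee_fin.
have uE w : (if has_points k w then \prod_(i < k) mix a b i w else 0)%R =
    (\sum_(f : {ffun 'I_k -> bool}) c f w * u f w)%R.
  rewrite /u; case: ifP => _; last by rewrite big1// => f _; rewrite mulr0.
  under [RHS]eq_bigr do rewrite -big_split /=.
  pose F (i : 'I_k) (j : bool) : R := ((if j then a i w else b i w) * (m i w == j)%:R)%R.
  rewrite -(bigA_distr_bigA F); apply: eq_bigr => i _.
  by rewrite big_bool /F /mix; case: (m i w); rewrite /= mulr1 mulr0 ?addr0 ?add0r.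
have vE w : (if has_points k w then \prod_(i < k) avg a b i w else 0)%R =
    (\sum_(f : {ffun 'I_k -> bool}) c f w * v f w)%R.
  rewrite /v; case: ifP => _; last by rewrite big1// => f _; rewrite mulr0.
  under [RHS]eq_bigr do rewrite -big_split /=.
  pose F (i : 'I_k) (j : bool) : R :=
    ((if j then a i w else b i w) * (if j then p (x_ i w) else 1 - p (x_ i w)))%R.
  rewrite -(bigA_distr_bigA F); apply: eq_bigr => i _.
  by rewrite big_bool /F /avg /= mulrC [X in (_ + X)%R]mulrC.
have E (h : {ffun 'I_k -> bool} -> T -> R) (H : T -> R) :
    (forall w, H w = \sum_f c f w * h f w)%R -> (forall f, measurable_fun setT (h f)) ->
    (forall f w, (0 <= h f w)%R) ->
    \int[P]_w (G w * (H w)%:E) =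
    (\sum_f \int[P]_w (G w * (c f w)%:E * (h f w)%:E))%E.
  move=> HE mh h0; rewrite -ge0_integral_sum//.
  - apply: eq_integral => w _; rewrite HE -sumEFin ge0_sume_distrr.
      by apply: eq_bigr => f _; rewrite EFinM muleA.
    by move=> f _; rewrite lee_fin mulr_ge0.
  - move=> f; apply: emeasurable_funM; last exact/measurable_EFinP.
    exact: (measurable_fun_preimage mX (mGc f)).
  - by move=> f w _; rewrite mule_ge0// lee_fin.
rewrite (E u)// (E v)//.
  apply: eq_bigr => f _.
  by apply: (is_condexp_mul mX (uvc f)) => //;
    first [exact/measurable_EFinP | move=> w; rewrite lee_fin].
by move=> f; apply/measurable_EFinP; exact: (measurable_fun_preimage mX (uvc f).1).
Qed.

Hypothesis ab : forall i w, ~~ in_range i w -> a i w = b i w.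

(** Induction on [k], splitting on whether [X] has a point of index [k]. If so, the preceding case
    applies. Otherwise nothing is known of the mark [m k], but by [ab] the factor at [k] is the same
    function of [X] in [mix] and [avg]; it is absorbed into [G], which is why [G] varies in the
    induction. *)
Lemma integral_prod_mix k (G : T -> \bar R) :
  measurable_fun [set: TX] G -> (forall w, 0 <= G w) ->
  \int[P]_w (G w * (\prod_(i < k) mix a b i w)%:E) =
  \int[P]_w (G w * (\prod_(i < k) avg a b i w)%:E).
Proof.
elim: k G => [G _ _|k IH G mG G0]; first by apply: eq_integral => w _; rewrite !big_ord0.
have split_range (c : nat -> T -> R) w : (forall i w, (0 <= c i w)%R) ->
    G w * (\prod_(i < k.+1) c i w)%:E =
    G w * (if has_points k.+1 w then
             \prod_(i < k.+1) c i w else 0)%R%:E +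
    G w * (if in_range k w then 0 else c k w)%R%:E * (\prod_(i < k) c i w)%:E.
  move=> c0; rewrite has_pointsS; case: ifP => kw; first by rewrite mule0 mul0e adde0.
  by rewrite mule0 add0e -muleA -EFinM big_ord_recr /= mulrC.
have mpre (f : T -> R) : measurable_fun [set: TX] f ->
    measurable_fun [set: TX] (fun w => (if in_range k w then 0 else f w)%R%:E : \bar R).
  by move=> mf; apply/measurable_EFinP; apply: measurable_fun_ifT => //; exact: measurable_in_range.
have mG' : measurable_fun setT G by exact: (measurable_fun_preimage mX).
have mle := measurable_has_points k.+1.
have E (c : nat -> T -> R) :
    (forall i, measurable_fun setT (c i)) -> (forall i w, (0 <= c i w)%R) ->
    \int[P]_w (G w * (\prod_(i < k.+1) c i w)%:E) =
    \int[P]_w (G w * (if has_points k.+1 w then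
             \prod_(i < k.+1) c i w else 0)%R%:E) +
    \int[P]_w (G w * (if in_range k w then 0 else c k w)%R%:E * (\prod_(i < k) c i w)%:E).
  move=> mc c0; rewrite -ge0_integralD//.
  - by apply: eq_integral => w _; exact: split_range.
  - move=> w _; rewrite mule_ge0// lee_fin; case: ifP => // _; exact: prodr_ge0.
  - apply: emeasurable_funM => //; apply/measurable_EFinP; apply: measurable_fun_ifT => //.
      exact: (measurable_fun_preimage mX mle).
    by apply: measurable_prod.
  - move=> w _; rewrite mule_ge0//; last by rewrite lee_fin prodr_ge0.
    by rewrite mule_ge0// lee_fin; case: ifP.
  - apply: emeasurable_funM; last by apply/measurable_EFinP; exact: measurable_prod.
    apply: emeasurable_funM => //; apply/measurable_EFinP; apply: measurable_fun_ifT => //.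
    exact: (measurable_fun_preimage mX (measurable_in_range k)).
rewrite !E; last 4 first.
- by move=> i; exact: (measurable_fun_preimage mX (measurable_avg _)).
- exact: avg_ge0.
- exact: measurable_mix.
- exact: mix_ge0.
rewrite integral_mix_has_points//; congr (_ + _).
have mixa w : (if in_range k w then 0 else mix a b k w)%R = (if in_range k w then 0 else a k w)%R.
  by case: ifPn => // /ab ak; rewrite /mix ak if_same.
have avga w : (if in_range k w then 0 else avg a b k w)%R = (if in_range k w then 0 else a k w)%R.
  by case: ifPn => // /ab ak; rewrite /avg ak -mulrDl addrC subrK mul1r.
under eq_integral do rewrite mixa.
under [RHS]eq_integral do rewrite avga.
apply: IH; first by apply: emeasurable_funM => //; exact: mpre.
by move=> w; rewrite mule_ge0// lee_fin; case: ifP.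
Qed.

Hypotheses (a1 : forall i w, (a i w <= 1)%R) (b1 : forall i w, (b i w <= 1)%R).

Lemma mix_le1 i w : (mix a b i w <= 1)%R.
Proof. by rewrite /mix; case: ifP. Qed.

Lemma avg_le1 i w : (avg a b i w <= 1)%R.
Proof.
have /andP[/ltW p0 /ltW p1] := p01 (x_ i w).
rewrite -(subrKC (p (x_ i w)) 1); apply: lerD; first by rewrite ler_piMr.
by rewrite ler_piMr// subr_ge0.
Qed.

Lemma prod_avg_cvg w : (\prod_(i < k) avg a b i w)%R @[k --> \oo] -->
  limn (fun k => \prod_(i < k) avg a b i w)%R.
Proof.
apply: nonincreasing_is_cvgn.
  apply/nonincreasing_seqP => k; rewrite big_ord_recr /= ler_piMr ?avg_le1//.
  by apply: prodr_ge0 => i _; exact: avg_ge0.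
by exists 0%R => _ [k _ <-]; apply: prodr_ge0 => i _; exact: avg_ge0.
Qed.

(** Configurations may be infinite. With all factors in [[0, 1]] the partial products are bounded by
    1, and dominated convergence takes the finite identity to the limit on both sides. *)
Lemma prod_mix_condexp (U : T -> R) :
  (forall w, (\prod_(i < k) mix a b i w)%R @[k --> \oo] --> U w) ->
  is_condexp P X (EFin \o U)
    (fun w => (limn (fun k => \prod_(i < k) avg a b i w)%R)%:E).
Proof.
move=> cU; set V := fun w => limn (fun k => \prod_(i < k) avg a b i w)%R.
have mV : measurable_fun [set: TX] V.
  by apply: (measurable_fun_cvg measurable_prod_avg) => w _; exact: prod_avg_cvg.
split; first exact/measurable_EFinP.
move=> B mB; have mYB : measurable (X @^-1` B) by rewrite -[X in measurable X]setTI; exact: mX.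
have dom (c : nat -> T -> R) (L : T -> R) : (forall k, measurable_fun setT (c k)) ->
    (forall k w, (0 <= c k w <= 1)%R) -> (forall w, c k w @[k --> \oo] --> L w) ->
    \int[P]_(w in X @^-1` B) (c k w)%:E @[k --> \oo] --> \int[P]_(w in X @^-1` B) (L w)%:E.
  move=> mc c01 cL.
  have mL : measurable_fun setT L.
    by apply: (measurable_fun_cvg mc) => w _; exact: cL.
  have [] := @dominated_convergence _ _ _ P _ mYB (fun k w => (c k w)%:E) (EFin \o L) (cst 1).
  - by move=> k; apply/measurable_EFinP; exact: measurable_funTS.
  - by apply/measurable_EFinP; exact: measurable_funTS.
  - by apply: aeW => w _; apply: cvg_EFin; [exact: nearW|exact: cL].
  - apply: (integrableS measurableT) => //; exact: finite_measure_integrable_cst.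
  - by apply: aeW => w k _ /=; rewrite lee_fin; have /andP[c0 c1] := c01 k w; rewrite ger0_norm.
  by move=> _ _.
have prod01 (c : nat -> T -> R) k w : (forall i w, (0 <= c i w)%R) ->
    (forall i w, (c i w <= 1)%R) -> (0 <= \prod_(i < k) c i w <= 1)%R.
  by move=> c0 c1; apply: prodr_le1 => i; rewrite c0 c1.
have E (c : T -> R) : \int[P]_w ((EFin \o \1_(X @^-1` B)) w * (c w)%:E) =
    \int[P]_(w in X @^-1` B) (c w)%:E.
  rewrite [RHS]integral_mkcond epatch_indic.
  by apply: eq_integral => w _; rewrite muleC.
have cmix : \int[P]_(w in X @^-1` B) (\prod_(i < k) mix a b i w)%:E @[k --> \oo] -->
    \int[P]_(w in X @^-1` B) (U w)%:E.
  apply: dom => //; first exact: measurable_prod_mix.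
  by move=> k w; apply: prod01; [exact: mix_ge0|exact: mix_le1].
have cavg : \int[P]_(w in X @^-1` B) (\prod_(i < k) mix a b i w)%:E @[k --> \oo] -->
    \int[P]_(w in X @^-1` B) (V w)%:E.
  rewrite (_ : (fun k => _) =
      (fun k => \int[P]_(w in X @^-1` B) (\prod_(i < k) avg a b i w)%:E)).
    apply: dom.
    - by move=> k; exact: (measurable_fun_preimage mX (measurable_prod_avg _)).
    - by move=> k w; apply: prod01; [exact: avg_ge0|exact: avg_le1].
    - exact: prod_avg_cvg.
  apply/funext => k; rewrite -!E; apply: integral_prod_mix.
    by apply/measurable_EFinP; apply: measurable_indic; exists B; rewrite // setTI.
  by move=> w; rewrite lee_fin.
by rewrite -(cvg_lim _ cmix)// -(cvg_lim _ cavg).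
Qed.

End mix_avg.
End marks.

(** * Configurations given by an enumeration, and integrals over them *)

Section enumerations.
Context dE (R : realType) (E : measurablePseudoMetricType dE R).

Lemma measurable_mem d (T : measurableType d) (f : T -> E) (D : set E) :
  measurable D -> measurable_fun setT f -> measurable_fun setT (fun w => f w \in D).
Proof.
move=> mD mf; apply: (measurable_fun_bool true); rewrite setTI.
rewrite (_ : _ @^-1` _ = f @^-1` D).
  by rewrite -[X in measurable X]setTI; exact: mf.
by apply/seteqP; split => w /=; [move/set_mem|move/mem_set].
Qed.

Lemma in_enum (F : Type) (J : nat -> bool) (f : nat -> F) (A : set F) i :
  (i \in [set i | J i] `&` f @^-1` A) = J i && (f i \in A).
Proof.
by apply/idP/andP => [/set_mem[/= Ji /mem_set]|[Ji /set_mem Ax]]; last exact/mem_set.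
Qed.

Lemma measurable_enum_config d (T : measurableType d) (c : T -> config E)
    (x : nat -> T -> E) (J : nat -> T -> bool) :
  (forall i, measurable_fun setT (x i)) -> (forall i, measurable_fun setT (J i)) ->
  (forall w, set_inj [set i | J i w] (x ^~ w)) ->
  (forall w, points (c w) = x ^~ w @` [set i | J i w]) -> measurable_fun setT c.
Proof.
move=> mx mJ inj cE; apply: measurable_fun_config => A mA.
have E0 w : count A (c w) =
    \sum_(i <oo | i \in xpredT) (if J i w then (x i w \in A)%:R else 0)%R%:E.
  rewrite /count cE counting_image_series//; apply: eq_eseriesr => i _.
  by rewrite indicE in_enum; case: (J i w).
under eq_fun do rewrite E0.
apply: ge0_emeasurable_sum => [i w _ _|i _].
  by rewrite lee_fin; case: ifP.
apply/measurable_EFinP; apply: measurable_fun_ifT => //.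
rewrite (_ : (fun w => _) = (fun w => if x i w \in A then 1 else 0)%R).
  by apply: measurable_fun_ifT => //; exact: measurable_mem.
by apply/funext => w; case: (_ \in A).
Qed.

Lemma void_indicE (x : nat -> E) (J : nat -> bool) (c : set E) (D : set E) :
  c = x @` [set i | J i] -> (c `&` D = set0) <-> forall i, ~~ (J i && (x i \in D)).
Proof.
move=> ->; split => [/seteqP[cD _] i|cD].
  by apply/negP => /andP[Ji /set_mem xD]; apply: (cD (x i)); split => //; exists i.
apply/seteqP; split => // _ [[i /= Ji <-] xD]; have := cD i.
by rewrite Ji mem_set.
Qed.

Lemma cvg_prod_bool (B : nat -> bool) :
  (\prod_(i < k) (B i)%:R : R)%R @[k --> \oo] --> (`[< forall i, B i >]%:R : R)%R.
Proof.
apply: cvg_near_cst; have [BT|/existsNP[i nB]] := pselect (forall i, B i).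
  by apply: nearW => k; rewrite asboolT// big1// => i _; rewrite BT.
exists i.+1 => // k /= ik; rewrite asboolF; last by move=> /(_ i).
rewrite prod_bool_forall; case: forallP => // /(_ (Ordinal ik)) //.
Qed.

(** The partial products are constant once [k] exceeds every entry of [I]. *)
Lemma cvg_prod_seq (I : seq nat) (q : nat -> R) : uniq I ->
  (\prod_(i < k) (if (i : nat) \in I then q i else 1))%R @[k --> \oo] -->
  (\prod_(i <- I) q i)%R.
Proof.
move=> uI; apply: cvg_near_cst; exists (\max_(i <- I) i).+1 => // k /= Ik.
rewrite -(big_mkord xpredT (fun i => if i \in I then q i else 1)%R) -big_mkcond /=.
rewrite -big_filter; apply: perm_big; apply: uniq_perm => //.
  by rewrite filter_uniq// iota_uniq.
move=> i; rewrite mem_filter mem_index_iota /=; case: (boolP (i \in I)) => //= iI.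
by apply: leq_trans Ik; rewrite ltnS; apply: leq_bigmax_seq.
Qed.

End enumerations.

Section integral_count.
Context (R : realType) (dS : measure_display) (S : measurableCompleteMetricType dS R).
Hypothesis S_Borel : (measurable : set (set S)) = <<s [set A : set S | open A] >>.

(** [count_measure] is the sum of the Dirac masses along the enumeration. *)
Lemma integral_count_measure (c : config S) (x : nat -> S) (J : nat -> bool)
    (f : S -> \bar R) : set_inj [set i | J i] x -> points c = x @` [set i | J i] ->
  measurable_fun setT f -> (forall y, 0 <= f y) ->
  \int[count_measure S_Borel c]_y f y = \sum_(i <oo) (if J i then f (x i) else 0).
Proof.
move=> inj cE mf f0.
pose m_ i : {measure set S -> \bar R} :=
    if J i then (\d_(x i) : {measure set S -> \bar R}) else (mzero : {measure set S -> \bar R}).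
rewrite (@eq_measure_integral _ _ _ _ (mseries m_ 0)); last first.
  move=> A mA _; rewrite count_measureE /count cE counting_image_series//.
  apply: eq_eseriesr => i _; rewrite /m_ indicE in_enum.
  by case: (J i) => //=; rewrite /dirac indicE.
rewrite ge0_integral_measure_series//; apply: eq_eseriesr => i _; rewrite /m_.
case: (J i); last by rewrite integral_measure_zero.
by rewrite integral_dirac// diracT mul1e.
Qed.

Lemma measurable_integral_count (f : S -> \bar R) :
  measurable_fun setT f -> (forall y, 0 <= f y) ->
  measurable_fun setT (fun c : config S => \int[count_measure S_Borel c]_y f y).
Proof.
move=> mf f0; apply: measurable_fun_integral_kernel => // U mU.
by under eq_fun do rewrite count_measureE; exact: measurable_count.
Qed.

End integral_count.

Lemma base_union_nil (R : realType) (dS : measure_display)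
    (S : measurableCompleteMetricType dS R) (B : nat -> set S) :
  base_union B [::] = set0.
Proof. by rewrite /base_union set_nil bigcup_set0. Qed.

(** * Marks at selected indices against the marks at all the others *)

Section thinning.
Context (R : realType) (dS d : measure_display) (S : measurableCompleteMetricType dS R).
Hypothesis S_Borel : (measurable : set (set S)) = <<s [set A : set S | open A] >>.
Variable B : nat -> set S.
Hypothesis Bopen : forall i, open (B i).
Hypothesis Bbase : forall (U : set S) x, open U -> U x -> exists i, B i x /\ B i `<=` U.
Context (T : measurableType d) (P : probability T R).
Variables (p : S -> R) (X : T -> config S).
Variables (x_ : nat -> T -> S) (m : nat -> T -> bool).
Hypothesis mX : measurable_fun setT X.
Hypothesis mp : measurable_fun setT p.
Hypothesis p01 : forall u, (0 < p u < 1)%R.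

Notation TX := (g_sigma_algebra_preimageType X).
Notation in_range := (in_range X).

Hypothesis mx : forall i, measurable_fun [set: TX] (x_ i).
Hypothesis mm : forall i, measurable_fun setT (m i).
Hypothesis x_inj : forall w, set_inj [set i | in_range i w] (x_ ^~ w).
Hypothesis X_x : forall w, points (X w) = x_ ^~ w @` [set i | in_range i w].
Hypothesis marks_condexp : forall k (e : k.-tuple bool),
  is_condexp P X
    (fun w => if (k%:R%:E <= (counting (points (X w)) : \bar R)) &&
                 [forall i : 'I_k, m i w == tnth e i]
              then 1 else 0)
    (fun w => if k%:R%:E <= (counting (points (X w)) : \bar R)
              then (\prod_(i < k) (if tnth e i then p (x_ i w)
                                   else 1 - p (x_ i w)))%:E
              else 0).

Lemma subconf_locally_finite (J : nat -> bool) w :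
  locally_finite_set (x_ ^~ w @` [set i | in_range i w && J i]).
Proof.
move=> y r; apply: sub_finite_set (points_locally_finite (X w) y r).
by move=> z [[i /= /andP[iw _] <-] yz]; split => //; rewrite X_x; exists i.
Qed.

Definition subconf (J : nat -> bool) w : config S :=
  Config (@subconf_locally_finite J w).

Lemma subconf_inj (J : nat -> bool) w :
  set_inj [set i | in_range i w && J i] (x_ ^~ w).
Proof.
by move=> i j /[!inE] /= /andP[iw _] /andP[jw _]; apply: x_inj; rewrite inE.
Qed.

(** A function of [X] alone: when [I] lists the indices of a tuple of points, this is the reduced
    configuration of the Georgii-Nguyen-Zessin formula for [X]. *)
Definition unmarked (I : seq nat) w : config S := subconf (fun i => i \notin I) w.

(** With [I] empty this is [Z] for [b = true] and [Y] for [b = false]; a tuple [I] gives the same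
    process deprived of the points at these indices. *)
Definition marked (b : bool) (I : seq nat) w : config S :=
  subconf (fun i => (i \notin I) && (m i w == b)) w.

Let toT d' (T' : measurableType d') (f : T -> T') :
  measurable_fun [set: TX] f -> measurable_fun setT f.
Proof. exact: measurable_fun_preimage. Qed.

Let mir i : measurable_fun [set: TX] (in_range i).
Proof. exact: measurable_in_range. Qed.

Lemma measurable_unmarked I : measurable_fun [set: TX] (unmarked I).
Proof.
apply: (@measurable_enum_config _ _ _ _ TX _ x_ (fun i w => in_range i w && (i \notin I))) => //.
- by move=> i; apply: measurable_and => //; exact: mir.
- by move=> w; exact: subconf_inj.
Qed.

Let mmb b i : measurable_fun setT (fun w => m i w == b).
Proof.
rewrite (_ : (fun w => _) = (fun w => if m i w then b else ~~ b)).
  exact: measurable_fun_ifT.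
by apply/funext => w; case: (m i w); case: b.
Qed.

Lemma measurable_marked b I : measurable_fun setT (marked b I).
Proof.
apply: (@measurable_enum_config _ _ _ _ T _ x_
  (fun i w => in_range i w && ((i \notin I) && (m i w == b)))) => //.
- by move=> i; exact: toT.
- move=> i; apply: measurable_and; first exact: (toT (mir i)).
  by apply: measurable_and => //; exact: mmb.
- by move=> w; exact: subconf_inj.
Qed.

Definition mark_prob (b : bool) i w : R := if b then p (x_ i w) else (1 - p (x_ i w))%R.

Let hit b' (D : set S) (c : bool) i w : bool :=
  in_range i w && (x_ i w \in D) && (c == b').

Let pb01 b i w : (0 <= mark_prob b i w <= 1)%R.
Proof.
have /andP[/ltW p0 /ltW p1] := p01 (x_ i w); rewrite /mark_prob.
by case: b; [rewrite p0|rewrite subr_ge0 p1 lerBlDr lerDl].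
Qed.

Let mpx i : measurable_fun [set: TX] (fun w => p (x_ i w)).
Proof. by apply: measurableT_comp => //; exact: mx. Qed.

Let mpb b i : measurable_fun [set: TX] (mark_prob b i).
Proof. by rewrite /mark_prob; case: b => //; apply: measurable_funB. Qed.

Let mbool d' (T' : measurableType d') (g : T' -> bool) :
  measurable_fun setT g -> measurable_fun setT (fun w => ((g w)%:R : R)).
Proof.
move=> mg; rewrite (_ : (fun w => _) = (fun w => if g w then 1 else 0)%R).
  exact: measurable_fun_ifT.
by apply/funext => w; case: (g w).
Qed.

Let mhit b' D c i : measurable D -> measurable_fun [set: TX] (hit b' D c i).
Proof.
move=> mD; apply: measurable_and => //; apply: measurable_and; first exact: mir.
by apply: measurable_mem => //; exact: mx.
Qed.

Section rectangle.
Variables (b b' : bool) (I : seq nat) (D : set S).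
Hypotheses (uI : uniq I) (mD : measurable D).

(** The factor at index [i] when the mark there is [c]: at the indices of [I] it demands the mark
    [b], elsewhere that no point of mark [b'] fall in [D]. The implication makes it 1 at indices
    without a point, as [integral_prod_mix] demands. *)
Let sel (c : bool) i w : R :=
  (if i \in I then (in_range i w ==> (c == b))%:R else (~~ hit b' D c i w)%:R)%R.

(** The demand at the indices of [I] is replaced by its conditional probability, which ignores [c];
    the other factors are those of [sel]. *)
Let sel' (c : bool) i w : R :=
  (if i \in I then (if in_range i w then mark_prob b i w else 1)
   else (~~ hit b' D c i w)%:R)%R.

Let U w : R := `[< forall i, if i \in I then in_range i w ==> (m i w == b)
                   else ~~ hit b' D (m i w) i w >]%:R%R.

Let U' w : R := ((\prod_(i <- I) (if in_range i w then mark_prob b i w else 1)) *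
  `[< forall i, (i \in I) || ~~ hit b' D (m i w) i w >]%:R)%R.

Let avg_sel i w : avg p x_ (sel true) (sel false) i w = avg p x_ (sel' true) (sel' false) i w.
Proof.
rewrite /avg /sel /sel'; case: (i \in I) => //; case: (in_range i w) => /=; last first.
  by rewrite !mulr1.
rewrite /mark_prob; case: b => /=; rewrite !(mulr1, mulr0, addr0, add0r).
  by rewrite -mulrDl subrKC mul1r.
by rewrite -mulrDl subrKC mul1r.
Qed.

Let cvgU w : (\prod_(i < k) mix m (sel true) (sel false) i w)%R @[k --> \oo] --> U w.
Proof.
rewrite (_ : (fun k => _) = (fun k => (\prod_(i < k)
  (if (i : nat) \in I then in_range i w ==> (m i w == b)
   else ~~ hit b' D (m i w) i w)%:R)%R)).
  exact: (@cvg_prod_bool R (fun i => if i \in I then in_range i w ==> (m i w == b)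
                   else ~~ hit b' D (m i w) i w)).
apply/funext => k; apply: eq_bigr => i _.
by rewrite /mix /sel; case: (m i w); case: (_ \in I).
Qed.

Let cvgU' w : (\prod_(i < k) mix m (sel' true) (sel' false) i w)%R @[k --> \oo] --> U' w.
Proof.
rewrite (_ : (fun k => _) = (fun k =>
    (\prod_(i < k) (if (i : nat) \in I then if in_range i w then mark_prob b i w else 1 else 1)) *
    (\prod_(i < k) (((i : nat) \in I) || ~~ hit b' D (m i w) i w)%:R))%R).
  apply: cvgM.
    exact: (@cvg_prod_seq R I (fun i => if in_range i w then mark_prob b i w else 1)%R uI).
  exact: (@cvg_prod_bool R (fun i => (i \in I) || ~~ hit b' D (m i w) i w)).
apply/funext => k; rewrite -big_split /=; apply: eq_bigr => i _.
rewrite /mix /sel' /=; case: (_ \in I) => /=; first by rewrite mulr1 if_same.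
by rewrite mul1r; case: (m i w).
Qed.

(** By [avg_sel] the factors [sel] and [sel'] have the same averages, so [U] and [U'] have a common
    conditional expectation given [X]. *)
Lemma integral_mark_rectangle (G : T -> \bar R) :
  measurable_fun [set: TX] G -> (forall w, 0 <= G w) ->
  \int[P]_w (G w * (U w)%:E) = \int[P]_w (G w * (U' w)%:E).
Proof.
move=> mG G0.
have msel c i : measurable_fun [set: TX] (sel c i).
  rewrite /sel; case: (i \in I); apply: mbool.
    rewrite (_ : (fun w => _) = (fun w => if in_range i w then c == b else true)).
      by apply: measurable_fun_ifT.
    by apply/funext => w; case: (in_range i w).
  by apply: measurable_neg; exact: mhit.
have msel' c i : measurable_fun [set: TX] (sel' c i).
  rewrite /sel'; case: (i \in I).
    by apply: measurable_fun_ifT.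
  by apply: mbool; apply: measurable_neg; exact: mhit.
have sel01 c i w : (0 <= sel c i w <= 1)%R.
  by rewrite /sel; case: (i \in I); rewrite ler0n lern1 leq_b1.
have sel'01 c i w : (0 <= sel' c i w <= 1)%R.
  rewrite /sel'; case: (i \in I); last by rewrite ler0n lern1 leq_b1.
  by case: (in_range i w); [exact: pb01|rewrite ler01 lexx].
have seln c i w : ~~ in_range i w -> sel c i w = 1%R.
  by move=> /negbTE iw; rewrite /sel /hit iw; case: (i \in I).
have sel'n c i w : ~~ in_range i w -> sel' c i w = 1%R.
  by move=> /negbTE iw; rewrite /sel' /hit iw; case: (i \in I).
have avgE : (fun w => (limn (fun k => \prod_(i < k) avg p x_ (sel' true) (sel' false) i w)%R)%:E : \bar R) =
    (fun w => (limn (fun k => \prod_(i < k) avg p x_ (sel true) (sel false) i w)%R)%:E).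
  apply/funext => w; congr ((limn _)%:E); apply/funext => k.
  by apply: eq_bigr => i _; rewrite avg_sel.
have c1 : is_condexp P X (EFin \o U)
    (fun w => (limn (fun k => \prod_(i < k) avg p x_ (sel true) (sel false) i w)%R)%:E).
  apply: (@prod_mix_condexp _ _ _ _ _ P p X x_ m) => //;
    try by move=> i w; have /andP[] := sel01 true i w.
  - by move=> i w; have /andP[] := sel01 false i w.
  - by move=> i w iw; rewrite !seln.
  - by move=> i w; have /andP[] := sel01 false i w.
have c2 : is_condexp P X (EFin \o U')
    (fun w => (limn (fun k => \prod_(i < k) avg p x_ (sel true) (sel false) i w)%R)%:E).
  rewrite -avgE.
  apply: (@prod_mix_condexp _ _ _ _ _ P p X x_ m) => //;
    try by move=> i w; have /andP[] := sel'01 true i w.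
  - by move=> i w; have /andP[] := sel'01 false i w.
  - by move=> i w iw; rewrite !sel'n.
  - by move=> i w; have /andP[] := sel'01 false i w.
have L0 w : 0 <= (limn (fun k => \prod_(i < k) avg p x_ (sel true) (sel false) i w)%R)%:E.
  rewrite lee_fin; apply: limr_ge.
    apply: (prod_avg_cvg p01); by move=> i v; have /andP[] := sel01 true i v;
      have /andP[] := sel01 false i v.
  apply: nearW => k; apply: prodr_ge0 => i _; apply: avg_ge0 => // j v.
    by have /andP[] := sel01 true j v.
  by have /andP[] := sel01 false j v.
have mU : measurable_fun setT U.
  apply: (@measurable_fun_cvg _ _ _ _ (fun k w => (\prod_(i < k) mix m (sel true) (sel false) i w)%R)).
    by move=> k; apply: (measurable_prod_mix mX mm).
  by move=> w _; exact: cvgU.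
have mU' : measurable_fun setT U'.
  apply: (@measurable_fun_cvg _ _ _ _ (fun k w => (\prod_(i < k) mix m (sel' true) (sel' false) i w)%R)).
    by move=> k; apply: (measurable_prod_mix mX mm).
  by move=> w _; exact: cvgU'.
rewrite (is_condexp_mul mX c1)//; last 2 first.
- exact/measurable_EFinP.
- by move=> w; rewrite lee_fin.
rewrite -(is_condexp_mul mX c2)//.
- exact/measurable_EFinP.
- move=> w; rewrite lee_fin mulr_ge0// prodr_ge0// => i _.
  by case: ifP => // _; have /andP[] := pb01 b i w.
Qed.

Lemma integral_mark_void (A : set TX) : measurable A ->
  \int[P]_w ((all (in_range ^~ w) I && all (fun i => m i w == b) I)%:R%:E *
             (\1_(A `*` void D) (w, marked b' I w))%:E) =
  \int[P]_w (((all (in_range ^~ w) I)%:R * \prod_(i <- I) mark_prob b i w)%R%:E *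
             (\1_(A `*` void D) (w, marked b' I w))%:E).
Proof.
move=> mA.
have vE w : \1_(A `*` void D) (w, marked b' I w) = ((w \in A)%:R *
   `[< forall i, (i \in I) || ~~ hit b' D (m i w) i w >]%:R)%R :> R.
  rewrite indicE -natrM mulnb; congr (_%:R); congr (nat_of_bool _).
  apply/idP/andP => [/set_mem[Aw /= Dw]|[/set_mem Aw /asboolP Dw]].
    split; first exact: mem_set.
    apply/asboolP => i; have := (void_indicE D erefl).1 Dw i.
    by rewrite /hit; case: (i \in I); rewrite //= ?andbT; rewrite andbAC.
  apply/mem_set; split => //=; apply/(void_indicE D erefl) => i.
  by have := Dw i; rewrite /hit; case: (i \in I); rewrite //= ?andbF// andbAC.
(* The event [A] and the existence of points at the indices of [I] are determined by [X], so they
   form the test function. *)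
pose G w : \bar R := ((all (in_range ^~ w) I)%:R * (w \in A)%:R)%R%:E.
have mG : measurable_fun [set: TX] G.
  apply/measurable_EFinP; apply: measurable_funM; apply: mbool.
    by apply: measurable_all; exact: mir.
  apply: (measurable_fun_bool true); rewrite setTI.
  rewrite (_ : _ @^-1` _ = A)//.
  by apply/seteqP; split => w /=; [move/set_mem|move/mem_set].
have G0 w : 0 <= G w by rewrite lee_fin mulr_ge0.
transitivity (\int[P]_w (G w * (U w)%:E)).
  apply: eq_integral => w _; rewrite -!EFinM vE /G /U; congr EFin.
  case: (boolP (all (in_range ^~ w) I)) => [/allP Iw|_]; last by rewrite /= !mul0r.
  rewrite mul1r mulrCA; congr (_ * _)%R; rewrite -natrM mulnb; congr (_%:R); congr (nat_of_bool _).
  apply/andP/asboolP => [[/allP mI /asboolP nh] i|H].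
    have := nh i; case: (boolP (i \in I)) => //= iI _; rewrite Iw//=; exact: mI.
  split; first by apply/allP => i iI; have := H i; rewrite iI Iw.
  by apply/asboolP => i; have := H i; case: (i \in I).
rewrite integral_mark_rectangle//; apply: eq_integral => w _.
rewrite -!EFinM vE /G /U'; congr EFin.
case: (boolP (all (in_range ^~ w) I)) => [/allP Iw|_]; last by rewrite /= !mul0r.
rewrite !mul1r [RHS]mulrCA; congr (_ * _)%R; congr (_ * _)%R.
by rewrite big_seq [RHS]big_seq; apply: eq_bigr => i iI; rewrite Iw.
Qed.

End rectangle.

Lemma measurable_prod_configE d1 (T1 : measurableType d1) :
  (measurable : set (set (T1 * config S))) =
  <<s [set A `*` V | A in measurable & V in [set void (base_union B s) | s in setT]] >>.
Proof.
apply: measurable_setX_generated; first exact: measurable_configE.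
by exists [::] => //; rewrite base_union_nil void0.
Qed.

Lemma setI_closed_prod_config d1 (T1 : measurableType d1) :
  setI_closed [set A `*` V | A in (measurable : set (set T1)) &
                             V in [set void (base_union B s) | s in setT]].
Proof.
move=> _ _ [A mA [_ [s _ <-] <-]] [A' mA' [_ [t _ <-] <-]].
exists (A `&` A'); first exact: measurableI.
exists (void (base_union B (s ++ t))); first by exists (s ++ t).
by rewrite base_union_cat voidU setXI.
Qed.

Lemma setT_prod_config d1 (T1 : measurableType d1) :
  [set A `*` V | A in (measurable : set (set T1)) &
                 V in [set void (base_union B s) | s in setT]] setT.
Proof.
exists setT => //; exists setT; last by rewrite setXTT.
by exists [::] => //; rewrite base_union_nil void0.
Qed.

(** The first coordinate is the outcome itself, seen in the coarser space [TX]: a function of the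
    pair may then use everything that [X] determines, in particular the points of the
    enumeration. *)
Lemma measurable_TX_pair (c : T -> config S) : measurable_fun setT c ->
  measurable_fun [set: T] (fun w : T => ((w : TX), c w)).
Proof.
move=> mc; apply/measurable_fun_pairP; split => [|//].
by move=> _ A mA; rewrite setTI; exact: (measurable_preimage mX mA).
Qed.

Lemma integral_mark_set (b b' : bool) (I : seq nat) : uniq I ->
  forall C : set (TX * config S), measurable C ->
  \int[P]_w ((all (in_range ^~ w) I && all (fun i => m i w == b) I)%:R%:E *
             (\1_C ((w : TX), marked b' I w))%:E) =
  \int[P]_w (((all (in_range ^~ w) I)%:R * \prod_(i <- I) mark_prob b i w)%R%:E *
             (\1_C ((w : TX), marked b' I w))%:E).
Proof.
move=> uI.
have mall : measurable_fun setT (fun w => all (in_range ^~ w) I).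
  by apply: measurable_all => i; exact: (toT (mir i)).
apply: (@dynkin_integral _ _ T (TX * config S)%type R P
  (fun w : T => ((w : TX), marked b' I w)) _
  [set A `*` V | A in measurable & V in [set void (base_union B s) | s in setT]]
  (fun w => (all (in_range ^~ w) I && all (fun i => m i w == b) I)%:R%R)
  (fun w => ((all (in_range ^~ w) I)%:R * \prod_(i <- I) mark_prob b i w)%R)).
- by apply: measurable_TX_pair; exact: measurable_marked.
- exact: measurable_prod_configE.
- exact: setI_closed_prod_config.
- exact: setT_prod_config.
- apply: mbool; apply: measurable_and => //; apply: measurable_all => i; exact: mmb.
- apply: measurable_funM; first exact: mbool.
  by apply: measurable_prod => i _; exact: (toT (mpb b i)).
- by move=> w; exact: ler0n.
- move=> w; rewrite mulr_ge0//; apply: prodr_ge0 => i _.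
  by have /andP[] := pb01 b i w.
- apply: (@le_lt_trans _ _ (\int[P]_w (cst 1 w))).
    apply: ge0_le_integral => //.
    + apply/measurable_EFinP/mbool; apply: measurable_and => //.
      by apply: measurable_all => i; exact: mmb.
    + by move=> w _; rewrite lee_fin lern1 leq_b1.
  rewrite integral_cst// mul1e.
  exact: (le_lt_trans (probability_le1 P measurableT) (ltry 1)).
- move=> _ [A mA [_ [s _ <-] <-]]; apply: integral_mark_void => //.
  exact: measurable_base_union.
Qed.

(* Given [X], the marks at the indices in [I] are independent of the other ones. *)
Lemma integral_mark (b b' : bool) (I : seq nat) (F : TX * config S -> \bar R) :
  uniq I -> measurable_fun setT F -> (forall v, 0 <= F v) ->
  \int[P]_w ((all (in_range ^~ w) I && all (fun i => m i w == b) I)%:R%:E *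
             F ((w : TX), marked b' I w)) =
  \int[P]_w (((all (in_range ^~ w) I)%:R * \prod_(i <- I) mark_prob b i w)%R%:E *
             F ((w : TX), marked b' I w)).
Proof.
move=> uI mF F0.
pose K1 w : R := (all (in_range ^~ w) I && all (fun i => m i w == b) I)%:R%R.
pose K2 w : R := ((all (in_range ^~ w) I)%:R * \prod_(i <- I) mark_prob b i w)%R.
have mall : measurable_fun setT (fun w => all (in_range ^~ w) I).
  by apply: measurable_all => i; exact: (toT (mir i)).
have mK1 : measurable_fun setT K1.
  apply: mbool; apply: measurable_and => //; apply: measurable_all => i; exact: mmb.
have mK2 : measurable_fun setT K2.
  apply: measurable_funM; first exact: mbool.
  by apply: measurable_prod => i _; exact: (toT (mpb b i)).
have K10 w : (0 <= K1 w)%R by exact: ler0n.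
have K20 w : (0 <= K2 w)%R.
  by rewrite mulr_ge0//; apply: prodr_ge0 => i _; have /andP[] := pb01 b i w.
pose Phi (w : T) := ((w : TX), marked b' I w).
have mPhi : measurable_fun [set: T] Phi by apply: measurable_TX_pair; exact: measurable_marked.
suff : \int[P]_w ((K1 w)%:E * F (Phi w)) = \int[P]_w ((K2 w)%:E * F (Phi w)) by [].
have mKF (K : T -> R) (F1 : TX * config S -> \bar R) : measurable_fun setT K ->
    measurable_fun setT F1 -> measurable_fun setT (fun w => (K w)%:E * F1 (Phi w)).
  move=> mK mF'; apply: emeasurable_funM; first exact/measurable_EFinP.
  exact: (measurableT_comp mF' mPhi).
have KF0 (K : T -> R) (F1 : TX * config S -> \bar R) w : (forall w, 0 <= K w)%R ->
    (forall v, 0 <= F1 v) -> 0 <= (K w)%:E * F1 (Phi w).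
  by move=> K0 F0'; rewrite mule_ge0// lee_fin.
move: F mF F0; apply: ge0_measurable_ind.
- by move=> A mA; exact: integral_mark_set.
- move=> k F k0 mF F0 IH.
  have E (K : T -> R) : measurable_fun setT K -> (forall w, 0 <= K w)%R ->
      \int[P]_w ((K w)%:E * (k%:E * F (Phi w))) = k%:E * \int[P]_w ((K w)%:E * F (Phi w)).
    move=> mK K0; rewrite -ge0_integralZl//; last 2 first.
      exact: mKF.
      by move=> w _; exact: KF0.
    by apply: eq_integral => w _; rewrite muleCA.
  by rewrite (E K1 mK1 K10) (E K2 mK2 K20) IH.
- move=> F F' mF mF' F0 F0' IH IH'.
  have E (K : T -> R) : measurable_fun setT K -> (forall w, 0 <= K w)%R ->
      \int[P]_w ((K w)%:E * (F (Phi w) + F' (Phi w))) =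
      \int[P]_w ((K w)%:E * F (Phi w)) + \int[P]_w ((K w)%:E * F' (Phi w)).
    move=> mK K0; rewrite -ge0_integralD//; last 4 first.
    + by move=> w _; exact: KF0.
    + exact: mKF.
    + by move=> w _; exact: KF0.
    + exact: mKF.
    by apply: eq_integral => w _; rewrite ge0_muleDr.
  by rewrite (E K1 mK1 K10) (E K2 mK2 K20) IH IH'.
- move=> F mF F0 ndF IH.
  have E (K : T -> R) : measurable_fun setT K -> (forall w, 0 <= K w)%R ->
      \int[P]_w ((K w)%:E * limn (F^~ (Phi w))) =
      limn (fun n => \int[P]_w ((K w)%:E * F n (Phi w))).
    move=> mK K0; rewrite -monotone_convergence//.
    + apply: eq_integral => w _; apply/esym/cvg_lim => //.
      by apply: cvgeZl => //; exact: ereal_nondecreasing_is_cvgn.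
    + by move=> n; exact: mKF.
    + by move=> n w _; exact: KF0.
    + by move=> w _ i j ij; rewrite lee_wpmul2l// ?lee_fin//; exact: ndF.
  rewrite (E K1 mK1 K10) (E K2 mK2 K20).
  by congr (limn _); apply/funext => n; exact: IH.
Qed.

(** * The thinning kernel *)

Section thinning_kernel.

Let phi (D : set S) (y : S) : R := (- ln (1 - p y * (y \in D)%:R))%R.

Let arg_pos (D : set S) y : (0 < 1 - p y * (y \in D)%:R)%R.
Proof.
have /andP[p0 p1] := p01 y.
by case: (y \in D); rewrite ?mulr1 ?mulr0 ?subr0 ?subr_gt0.
Qed.

Let phi_ge0 D y : (0 <= phi D y)%R.
Proof.
rewrite /phi oppr_ge0 ln_le0// lerBlDr lerDl mulr_ge0//.
by have /andP[/ltW] := p01 y.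
Qed.

Let mphi D : measurable D -> measurable_fun setT (phi D).
Proof.
move=> mD; apply: measurable_funN; apply: measurableT_comp; first exact: measurable_ln.
apply: measurable_funB => //; apply: measurable_funM => //; apply: mbool.
exact: measurable_mem.
Qed.

(* The product of [1 - p y] over the points [y] of [c] in [D]. Its measurability
   in [c] comes from the logarithm being an integral against the counting
   measure of [c]. *)
Let void_prob (D : set S) (c : config S) : R :=
  let s := \int[count_measure S_Borel c]_y (phi D y)%:E in
  if s == +oo then 0%R else expR (- fine s).

Let void_prob01 D c : (0 <= void_prob D c <= 1)%R.
Proof.
rewrite /void_prob; case: ifP => _; first by rewrite lexx ler01.
rewrite expR_ge0/= -expR0 ler_expR oppr_le0 fine_ge0//; apply: integral_ge0 => y _.
by rewrite lee_fin.
Qed.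

Let mvoid_prob D : measurable D -> measurable_fun setT (void_prob D).
Proof.
move=> mD; have mI : measurable_fun setT
    (fun c : config S => \int[count_measure S_Borel c]_y (phi D y)%:E).
  apply: measurable_integral_count => [|y]; last by rewrite lee_fin.
  by apply/measurable_EFinP; exact: mphi.
apply: measurable_fun_ifT => //.
  by apply: measurable_fun_eqe => //; exact: measurable_cst.
apply: measurableT_comp; first exact: measurable_expR.
by apply: measurable_funN; apply: measurableT_comp => //; exact: fine_measurable.
Qed.

(** Ties the product along the enumeration to the enumeration-free [void_prob]. The partial products
    are exponentials of minus partial sums of [phi]: they tend to 0 when the series diverges, and to
    the exponential of minus its sum otherwise. *)
Let cvg_void_prob I D w : measurable D ->
  (\prod_(i < k) (if ((i : nat) \notin I) && in_range i w
    then 1 - p (x_ i w) * (x_ i w \in D)%:R else 1))%R @[k --> \oo] -->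
  void_prob D (unmarked I w).
Proof.
move=> mD.
pose t i : R := if in_range i w && (i \notin I) then phi D (x_ i w) else 0%R.
have t0 i : (0 <= t i)%R by rewrite /t; case: ifP.
have prodE k : (\prod_(i < k) (if ((i : nat) \notin I) && in_range i w
    then 1 - p (x_ i w) * (x_ i w \in D)%:R else 1))%R = expR (- \sum_(i < k) t i).
  rewrite -sumrN expR_sum; apply: eq_bigr => i _; rewrite /t andbC.
  case: ifP => _; last by rewrite oppr0 expR0.
  by rewrite /phi opprK lnK// posrE.
under eq_fun do rewrite prodE.
have sE : \int[count_measure S_Borel (unmarked I w)]_y (phi D y)%:E =
    \sum_(i <oo) (t i)%:E.
  rewrite (@integral_count_measure _ _ _ S_Borel _ (x_ ^~ w)
    (fun i => in_range i w && (i \notin I)))//; last 3 first.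
  - exact: subconf_inj.
  - by apply/measurable_EFinP; exact: mphi.
  - by move=> y; rewrite lee_fin.
  by apply: eq_eseriesr => i _; rewrite /t; case: ifP.
have cs : (\sum_(i < k) t i)%R%:E @[k --> \oo] --> \sum_(i <oo) (t i)%:E.
  rewrite (_ : (fun k => _) = (fun k => \sum_(0 <= i < k) (t i)%:E)).
    by apply: is_cvg_nneseries => i _ _; rewrite lee_fin.
  by apply/funext => k; rewrite big_mkord sumEFin.
rewrite /void_prob sE; have s0 : 0 <= \sum_(i <oo) (t i)%:E.
  by apply: nneseries_ge0 => i _ _; rewrite lee_fin.
case: ifPn => [/eqP soo|sfin].
  rewrite soo in cs.
  have {}cs : (\sum_(i < k) t i)%R @[k --> \oo] --> +oo%R by apply/cvgeryP.
  exact: (cvg_comp _ _ cs (@cvgr_expR R)).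
have fs : \sum_(i <oo) (t i)%:E \is a fin_num by rewrite ge0_fin_numE// ltey.
have {}cs : (\sum_(i < k) t i)%R @[k --> \oo] --> fine (\sum_(i <oo) (t i)%:E).
  by apply: (fine_cvg (f := fun k => (\sum_(i < k) t i)%R%:E)); rewrite fineK.
apply: continuous_cvg; first exact: continuous_expR.
exact: cvgN.
Qed.

(** A point of [D] must not be retained, which has conditional probability [1 - p]; a point outside
    [D], or with index in [I], contributes the factor 1. *)
Lemma is_condexp_void (I : seq nat) (D : set S) : measurable D ->
  is_condexp P X (fun w => (\1_(void D) (marked true I w))%:E)
    (fun w => (void_prob D (unmarked I w))%:E).
Proof.
move=> mD.
pose sel (c : bool) i w : R := (if i \in I then 1 else (~~ hit true D c i w)%:R)%R.
have msel c i : measurable_fun [set: TX] (sel c i).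
  rewrite /sel; case: (i \in I) => //.
  by apply: mbool; apply: measurable_neg; exact: mhit.
have sel01 c i w : (0 <= sel c i w <= 1)%R.
  by rewrite /sel; case: (i \in I); rewrite ?ler01 ?lexx// ler0n lern1 leq_b1.
have seln c i w : ~~ in_range i w -> sel c i w = 1%R.
  by move=> /negbTE iw; rewrite /sel /hit iw; case: (i \in I).
have cU w : (\prod_(i < k) mix m (sel true) (sel false) i w)%R @[k --> \oo] -->
    (\1_(void D) (marked true I w) : R).
  rewrite (_ : (fun k => _) = (fun k => (\prod_(i < k)
      (((i : nat) \in I) || ~~ hit true D (m i w) i w)%:R)%R)); last first.
    apply/funext => k; apply: eq_bigr => i _; rewrite /mix /sel.
    by case: (m i w); case: (_ \in I).
  have := @cvg_prod_bool R (fun i => (i \in I) || ~~ hit true D (m i w) i w).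
  rewrite indicE; set b1 := asbool _; set b2 := (_ \in void D).
  suff -> : b1 = b2 by [].
  apply/asboolP/idP => [H|/set_mem H].
    apply/mem_set; apply/(void_indicE D erefl) => i; have := H i.
    by rewrite /hit; case: (i \in I); rewrite //= ?andbF// andbAC.
  move=> i; have := (void_indicE D erefl).1 H i.
  by rewrite /hit; case: (i \in I); rewrite //= ?andbT; rewrite andbAC.
have := (@prod_mix_condexp _ _ _ _ _ P p X x_ m mX mp p01 mx mm marks_condexp
  (sel true) (sel false)) .
move=> /(_ (msel true) (msel false)).
move=> /(_ (fun i w => (andP (sel01 true i w)).1) (fun i w => (andP (sel01 false i w)).1)).
move=> /(_ (fun i w iw => etrans (seln true i w iw) (esym (seln false i w iw)))).
move=> /(_ (fun i w => (andP (sel01 true i w)).2) (fun i w => (andP (sel01 false i w)).2)).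
move=> /(_ (fun w => \1_(void D) (marked true I w)) cU).
congr (is_condexp P X _ _); apply/funext => w; congr (_%:E).
apply/cvg_lim => //; rewrite (_ : (fun k => _) = (fun k =>
  (\prod_(i < k) (if ((i : nat) \notin I) && in_range i w
    then 1 - p (x_ i w) * (x_ i w \in D)%:R else 1))%R)).
  exact: cvg_void_prob.
apply/funext => k; apply: eq_bigr => i _; rewrite /avg /sel /hit.
case: ((i : nat) \in I) => /=; first by rewrite !mulr1 subrKC.
case: (in_range i w) => /=; last by rewrite !mulr1 subrKC.
by case: (_ \in D); rewrite /= ?mulr1 ?mulr0 ?add0r ?subr0// subrKC.
Qed.

(* The same [h] serves all [I] and [U]: it is a function of the configuration
   alone, so that the Georgii-Nguyen-Zessin formula for [X] applies to it. *)
Lemma thinning_kernel d1 (T1 : measurableType d1) (C : set (T1 * config S)) :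
  measurable C -> exists h : T1 * config S -> R,
  [/\ measurable_fun setT h, forall v, (0 <= h v <= 1)%R &
    forall (I : seq nat) (U : T -> T1), measurable_fun [set: TX] U ->
    is_condexp P X (fun w => (\1_C (U w, marked true I w))%:E)
                   (fun w => (h (U w, unmarked I w))%:E)].
Proof.
pose Q (C : set (T1 * config S)) := exists h : T1 * config S -> R,
  [/\ measurable_fun setT h, forall v, (0 <= h v <= 1)%R &
    forall (I : seq nat) (U : T -> T1), measurable_fun [set: TX] U ->
    is_condexp P X (fun w => (\1_C (U w, marked true I w))%:E)
                   (fun w => (h (U w, unmarked I w))%:E)].
have mUn I (U : T -> T1) (h : T1 * config S -> R) : measurable_fun setT h ->
    measurable_fun [set: TX] U ->
    measurable_fun [set: TX] (fun w => (h (U w, unmarked I w))%:E).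
  move=> mh mU; apply/measurable_EFinP; apply: (measurableT_comp mh).
  by apply/measurable_fun_pairP; split => //; exact: measurable_unmarked.
have mUm I (U : T -> T1) (A : set (T1 * config S)) : measurable A ->
    measurable_fun [set: TX] U ->
    measurable_fun [set: T] (fun w => (\1_A (U w, marked true I w) : R)).
  move=> mA mU; apply: (measurableT_comp (f := \1_A : _ -> R)); first exact: measurable_indic.
  by apply/measurable_fun_pairP; split; [exact: toT|exact: measurable_marked].
move=> mC; apply: (@dynkin_induction _ (T1 * config S)%type
  [set A `*` V | A in measurable & V in [set void (base_union B s) | s in setT]] Q) => //.
- exact: measurable_prod_configE.
- exact: setI_closed_prod_config.
- exists (cst 1%R); split => //; first by move=> v; rewrite ler01 lexx.
  move=> I U mU; split; first exact: (mUn I U (cst 1%R)).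
  by move=> E mE; apply: eq_integral => w _; rewrite indicE in_setT.
- move=> _ [A mA [_ [s _ <-] <-]]; set D := base_union B s.
  have mD : measurable D by exact: measurable_base_union.
  exists (fun v => (\1_A v.1 * void_prob D v.2)%R); split.
  + apply: measurable_funM; first by apply: measurableT_comp => //; exact: measurable_indic.
    by apply: measurableT_comp => //; exact: mvoid_prob.
  + move=> v; have /andP[v0 v1] := void_prob01 D v.2.
    by rewrite mulr_ge0//= mulr_ile1// indicE lern1 leq_b1.
  + move=> I U mU.
    have mV : measurable_fun setT (fun w => (\1_(void D) (marked true I w))%:E : \bar R).
      apply/measurable_EFinP; apply: measurableT_comp (measurable_marked true I).
      by apply: measurable_indic; exact: measurable_void.
    have mA' : measurable_fun [set: TX] (fun w => (\1_A (U w))%:E : \bar R).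
      apply/measurable_EFinP.
      have mA1 : measurable_fun setT (\1_A : T1 -> R) by exact: measurable_indic.
      exact: (measurableT_comp mA1 mU).
    have H1 w : 0 <= (\1_(void D) (marked true I w))%:E :> \bar R by rewrite lee_fin.
    have H2 w : 0 <= (void_prob D (unmarked I w))%:E.
      by rewrite lee_fin; have /andP[] := void_prob01 D (unmarked I w).
    have H3 w : 0 <= (\1_A (U w))%:E :> \bar R by rewrite lee_fin.
    have := is_condexp_mull mX (is_condexp_void I mD) mV H1 H2 mA' H3.
    congr (is_condexp P X _ _); apply/funext => w; rewrite -EFinM// !indicE -natrM mulnb.
    congr ((_%:R)%:E); congr nat_of_bool.
    by apply/andP/idP => [[/set_mem ? /set_mem ?]|/set_mem[? ?]];
      [apply/mem_set|split; apply/mem_set].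
- move=> A mA [h [mh h01 hA]]; exists (fun v => 1 - h v)%R; split.
  + exact: measurable_funB.
  + by move=> v; have /andP[h0 h1] := h01 v; rewrite subr_ge0 h1 lerBlDr lerDl.
  + move=> I U mU; have [mhU hU] := hA I U mU; split.
      by apply: (mUn _ _ (fun v => 1 - h v)%R) => //; exact: measurable_funB.
    move=> E mE.
    have mYE : measurable (X @^-1` E) by rewrite -[X in measurable X]setTI; exact: mX.
    have bnd (f : T -> R) : measurable_fun setT f -> (forall w, (0 <= f w <= 1)%R) ->
        \int[P]_(w in X @^-1` E) (1 - f w)%R%:E =
        \int[P]_(w in X @^-1` E) (cst 1 w) - \int[P]_(w in X @^-1` E) (f w)%:E.
      move=> mf f01.
      have i1 : P.-integrable (X @^-1` E) (EFin \o cst 1%R).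
        apply: (integrableS measurableT) => //; exact: finite_measure_integrable_cst.
      rewrite -integralB_EFin//; apply: (le_integrable mYE _ _ i1).
        by apply/measurable_EFinP; exact: measurable_funTS.
      by move=> w _ /=; rewrite lee_fin normr1; have /andP[f0 f1] := f01 w; rewrite ger0_norm.
    rewrite bnd; last 2 first.
      by move/measurable_EFinP : (mUn I U h mh mU); exact: toT.
      by move=> w; exact: h01.
    rewrite hU// -bnd; last 2 first.
      exact: mUm.
      by move=> w; rewrite indicE ler0n lern1 leq_b1.
    apply: eq_integral => w _; rewrite !indicE in_setC.
    by case: (_ \in A); rewrite ?subrr ?subr0.
- move=> F mF tF QF.
  have /choice[h hP] := QF.
  pose g v : \bar R := \sum_(k <oo) (h k v)%:E.
  have g0 v : 0 <= g v.
    by apply: nneseries_ge0 => k _ _; rewrite lee_fin; have [_ /(_ v)/andP[]] := hP k.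
  have mg : measurable_fun setT g.
    apply: (@ge0_emeasurable_sum _ _ _ setT (fun k v => (h k v)%:E) xpredT).
      by move=> k v _ _; rewrite lee_fin; have [_ /(_ v)/andP[]] := hP k.
    by move=> k _; apply/measurable_EFinP; have [] := hP k.
  (* The series is at most 1 only almost surely, hence the truncation. *)
  exists (fun v => fine (Order.min (g v) 1)); split.
  + apply: measurableT_comp; first exact: fine_measurable.
    by apply: measurable_mine => //; exact: measurable_cst.
  + move=> v; rewrite -!lee_fin fineK.
      by rewrite le_min g0 lee01 ge_min lexx orbT.
    rewrite ge0_fin_numE ?le_min ?g0 ?lee01//.
    by rewrite (@le_lt_trans _ _ 1)// ?ltry// ge_min lexx orbT.
  + move=> I U mU.
    have gc : is_condexp P X (fun w => (\1_(\bigcup_k F k) (U w, marked true I w))%:E)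
        (fun w => g (U w, unmarked I w)).
      split.
        apply: (measurableT_comp mg).
        by apply/measurable_fun_pairP; split => //; exact: measurable_unmarked.
      move=> E mE.
      have mYE : measurable (X @^-1` E) by rewrite -[X in measurable X]setTI; exact: mX.
      rewrite [RHS](eq_integral
        (fun w => \sum_(k <oo) (\1_(F k) (U w, marked true I w))%:E)); last first.
        by move=> w _; rewrite indic_bigcup.
      rewrite integral_nneseries//; last 2 first.
      * move=> k; apply: measurable_funTS; apply: toT; apply: mUn => //.
        by have [] := hP k.
      * by move=> k w _; rewrite lee_fin; have [_ /(_ (U w, unmarked I w))/andP[]] := hP k.
      rewrite integral_nneseries//; last first.
        by move=> k; apply: measurable_funTS; apply/measurable_EFinP; exact: mUm.
      by apply: eq_eseriesr => k _; have [_ _ /(_ I U mU)[_]] := hP k; exact.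
    have mF' : measurable (\bigcup_k F k) by exact: bigcup_measurable.
    apply: (is_condexp_ae mX gc).
      apply: (mUn I U (fun v => fine (Order.min (g v) 1))) => //.
      apply: measurableT_comp; first exact: fine_measurable.
      by apply: measurable_mine => //; exact: measurable_cst.
    (* [1 - g] is a version of the conditional expectation of one minus an indicator, hence almost
       surely nonnegative; so the truncation at 1 only changes the version. *)
    have g1 : {ae P, forall w, g (U w, unmarked I w) <= 1}.
      have c1 : is_condexp P X
          (fun w => 1 - (\1_(\bigcup_k F k) (U w, marked true I w))%:E)
          (fun w => 1 - g (U w, unmarked I w)).
        split; first by apply: emeasurable_funB => //; exact: gc.1.
        move=> E mE.
        have mYE : measurable (X @^-1` E) by rewrite -[X in measurable X]setTI; exact: mX.
        have i1 : P.-integrable (X @^-1` E) (cst 1).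
          by apply: (integrableS measurableT) => //; exact: finite_measure_integrable_cst.
        have m1 : measurable_fun (X @^-1` E)
            (fun w => (\1_(\bigcup_k F k) (U w, marked true I w))%:E : \bar R).
          by apply: measurable_funTS; apply/measurable_EFinP; exact: mUm.
        have i2 : P.-integrable (X @^-1` E)
            (fun w => (\1_(\bigcup_k F k) (U w, marked true I w))%:E).
          apply: (le_integrable mYE _ _ i1) => // w _ /=.
          by rewrite lee_fin normr1 ger0_norm// indicE lern1 leq_b1.
        have i3 : P.-integrable (X @^-1` E) (fun w => g (U w, unmarked I w)).
          apply/integrableP; split; first by apply: measurable_funTS; exact: (toT gc.1).
          rewrite (eq_integral (fun w => g (U w, unmarked I w))); last first.
            by move=> w _; rewrite gee0_abs.
          rewrite (gc.2 _ mE); have /integrableP[_] := i2.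
          rewrite (eq_integral (fun w => (\1_(\bigcup_k F k) (U w, marked true I w))%:E))//.
          by move=> w _; rewrite gee0_abs// lee_fin.
        rewrite (integralB mYE i1 i3) [RHS](integralB mYE i1 i2).
        by rewrite (gc.2 _ mE).
      have := is_condexp_ge0 mX c1.
      have H0 w : 0 <= 1 - (\1_(\bigcup_k F k) (U w, marked true I w))%:E :> \bar R.
        by rewrite -EFinB lee_fin subr_ge0 indicE lern1 leq_b1.
      move=> /(_ H0); apply: filterS => w.
      case: (g (U w, unmarked I w)) => [r| |]; last by rewrite leNye.
        by rewrite -[1 - _]/((1 - r)%:E) !lee_fin subr_ge0.
      by rewrite addeNy leeNy_eq.
    apply: filterS g1 => w g1.
    have : Order.min (g (U w, unmarked I w)) 1 = g (U w, unmarked I w) by apply/min_idPl.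
    move=> ->; rewrite fineK// ge0_fin_numE//; exact: le_lt_trans g1 (ltry _).
- by rewrite -measurable_prod_configE.
Qed.

End thinning_kernel.

End thinning.

(** * From identities integrated over [u] to identities for almost every [u] *)

Section exchange.
Context (R : realType) (dS d dU : measure_display) (S : measurableCompleteMetricType dS R).
Hypothesis S_Borel : (measurable : set (set S)) = <<s [set A : set S | open A] >>.
Variable B : nat -> set S.
Hypothesis Bopen : forall i, open (B i).
Hypothesis Bbase : forall (U : set S) x, open U -> U x -> exists i, B i x /\ B i `<=` U.
Context (T : measurableType d) (P : probability T R) (U : measurableType dU).
Variables (mu : {sigma_finite_measure set U -> \bar R}) (W : T -> config S).
Variables (f : U * config S -> R) (g : U * T -> R).
Hypotheses (mW : measurable_fun setT W) (mf : measurable_fun setT f)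
  (mg : measurable_fun setT g).
Hypotheses (f0 : forall v, (0 <= f v)%R) (g0 : forall v, (0 <= g v)%R).
Hypothesis fg : forall C : set (U * config S), measurable C ->
  \int[mu]_u \int[P]_w (\1_C (u, W w) * f (u, W w))%:E =
  \int[mu]_u \int[P]_w (\1_C (u, W w) * g (u, w))%:E.

(* Below the level [k] both measures compared by a Dynkin argument are finite. *)
Let lev (k : nat) : set (U * config S) := [set v | (f v <= k%:R)%R].

Let mlev k : measurable (lev k).
Proof.
rewrite (_ : lev k = [set: U * config S] `&` [set v | (f v)%:E <= k%:R%:E]).
  by apply: measurable_lee => //; exact/measurable_EFinP.
by rewrite setTI; apply/seteqP; split => v; rewrite /lev /= lee_fin.
Qed.

Let mUW : measurable_fun [set: U * T] (fun v => (v.1, W v.2)).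
Proof.
apply/measurable_fun_pairP; split; first exact: measurable_fst.
exact: (measurableT_comp mW measurable_snd).
Qed.

Let mfW : measurable_fun [set: U * T] (fun v => f (v.1, W v.2)).
Proof. exact: (measurableT_comp mf mUW). Qed.

Let mind C : measurable C -> measurable_fun [set: U * T] (fun v => \1_C (v.1, W v.2) : R).
Proof.
move=> mC; have m1 : measurable_fun setT (\1_C : U * config S -> R) by exact: measurable_indic.
exact: (measurableT_comp m1 mUW).
Qed.

Let cell (s : seq nat) k : set (U * config S) :=
  (setT `*` void (base_union B s)) `&` lev k.

Let mcell s k : measurable (cell s k).
Proof.
apply: measurableI; last exact: mlev.
apply: measurableX; first exact: measurableT.
by apply: measurable_void; exact: measurable_base_union.
Qed.

(** Both sides are measurable functions of [u]; their integrals over a measurable [A] agree by [fg]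
    applied to the part of the cell lying above [A]. *)
Let cell_ae s k : {ae mu, forall u,
  \int[P]_w (\1_(cell s k) (u, W w) * f (u, W w))%:E =
  \int[P]_w (\1_(cell s k) (u, W w) * g (u, w))%:E}.
Proof.
pose F (h : U * T -> R) := fun u => \int[P]_w (\1_(cell s k) (u, W w) * h (u, w))%:E.
have mF (h : U * T -> R) : measurable_fun setT h -> (forall v, (0 <= h v)%R) ->
    measurable_fun setT (F h).
  move=> mh h0; apply: (@measurable_fun_fubini_tonelli_F _ _ U T R P
    (fun v => (\1_(cell s k) (v.1, W v.2) * h v)%R%:E)).
    by apply/measurable_EFinP; apply: measurable_funM => //; exact: mind.
  by move=> v; rewrite lee_fin mulr_ge0.
have F0 (h : U * T -> R) u : (forall v, (0 <= h v)%R) -> 0 <= F h u.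
  by move=> h0; apply: integral_ge0 => w _; rewrite lee_fin mulr_ge0.
have FA (h : U * T -> R) A : measurable A -> \int[mu]_(u in A) F h u =
    \int[mu]_u \int[P]_w (\1_((A `*` setT) `&` cell s k) (u, W w) * h (u, w))%:E.
  move=> mA; rewrite integral_mkcond; apply: eq_integral => u _; rewrite patchE.
  case: ifPn => uA.
    apply: eq_integral => w _; congr ((_ * _)%:E); rewrite !indicE; congr (_%:R).
    congr nat_of_bool; apply/idP/idP => /set_mem H; apply/mem_set; last by case: H.
    by split => //; split => //=; exact: set_mem.
  rewrite integral0_eq// => w _; rewrite indicE memNset ?mul0r//.
  by move=> [[/= Au _] _]; rewrite mem_set in uA.
have := @sigma_finite_ae_eq _ _ _ mu (F (fun v => f (v.1, W v.2))) (F g).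
apply.
- exact: mF.
- exact: mF.
- by move=> u; exact: F0.
- by move=> u; exact: F0.
- move=> A mA; rewrite !FA//; apply: fg; apply: measurableI => //.
  exact: measurableX.
Qed.

(** The cells are countably many, so one null set of [u] serves them all. Off it, Dynkin's argument
    passes from void events to all [A] at each level of [f], and the levels then increase. Since [f]
    sees the outcome only through [W], the conclusion makes [f (u, W)] a conditional expectation of
    [g (u, .)] given [W]. *)
Lemma integral_exchange_ae : {ae mu, forall u, forall A, measurable A ->
  \int[P]_(w in W @^-1` A) (f (u, W w))%:E = \int[P]_(w in W @^-1` A) (g (u, w))%:E}.
Proof.
have : {ae mu, forall u, forall n, forall k,
    \int[P]_w (\1_(cell (odflt [::] (@unpickle (seq nat) n)) k) (u, W w) * f (u, W w))%:E =
    \int[P]_w (\1_(cell (odflt [::] (@unpickle (seq nat) n)) k) (u, W w) * g (u, w))%:E}.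
  by apply: ae_foralln => n; apply: ae_foralln => k; exact: cell_ae.
apply: filterS => u Hu A mA.
have {}Hu s k : \int[P]_w (\1_(cell s k) (u, W w) * f (u, W w))%:E =
    \int[P]_w (\1_(cell s k) (u, W w) * g (u, w))%:E.
  by have := Hu (pickle s) k; rewrite pickleK.
have mpu : measurable_fun setT (fun w => (u, W w)).
  by apply/measurable_fun_pairP; split; [exact: measurable_cst|exact: mW].
have mfu : measurable_fun setT (fun w => f (u, W w)) by exact: (measurableT_comp mf mpu).
have mgu : measurable_fun setT (fun w => g (u, w)) by exact: measurable_fun_pair2.
pose lv k w : R := \1_(lev k) (u, W w).
have mlv k : measurable_fun setT (lv k).
  have m1 : measurable_fun setT (\1_(lev k) : U * config S -> R) by exact: measurable_indic.
  exact: (measurableT_comp m1 mpu).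
have E1 k : \int[P]_w ((lv k w * f (u, W w))%R%:E * (\1_A (W w))%:E) =
    \int[P]_w ((lv k w * g (u, w))%R%:E * (\1_A (W w))%:E).
  apply: (@dynkin_integral _ _ T (config S) R P W mW
    [set void (base_union B s) | s in setT] (fun w => lv k w * f (u, W w))%R
    (fun w => lv k w * g (u, w))%R) => //.
  - exact: measurable_configE.
  - exact: setI_closed_void.
  - by exists [::] => //; rewrite base_union_nil void0.
  - exact: measurable_funM.
  - exact: measurable_funM.
  - by move=> w; rewrite mulr_ge0.
  - by move=> w; rewrite mulr_ge0.
  - apply: (@le_lt_trans _ _ (\int[P]_w (cst k%:R%:E w))).
      apply: ge0_le_integral => //.
      + by move=> w _; rewrite lee_fin mulr_ge0.
      + by apply/measurable_EFinP; exact: measurable_funM.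
      + move=> w _; rewrite lee_fin /lv indicE.
        by case: (boolP (_ \in _)) => [/set_mem|]; rewrite ?mul1r// mul0r.
    rewrite integral_cst//.
    apply: (@le_lt_trans _ _ (k%:R%:E * 1)); last by rewrite mule1 ltry.
    by rewrite lee_wpmul2l ?lee_fin//; exact: (probability_le1 P measurableT).
  - move=> _ [s _ <-]; have E0 (h : T -> R) :
        \int[P]_w ((lv k w * h w)%R%:E * (\1_(void (base_union B s)) (W w))%:E) =
        \int[P]_w (\1_(cell s k) (u, W w) * h w)%:E.
      apply: eq_integral => w _; rewrite -EFinM; congr EFin.
      rewrite mulrAC; congr (_ * _)%R; rewrite /lv !indicE -natrM mulnb; congr (_%:R).
      congr nat_of_bool; apply/andP/idP => [[/set_mem ? /set_mem ?]|/set_mem[[_ ?] ?]].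
        by apply/mem_set; split.
      by split; apply/mem_set.
    by rewrite !E0; exact: Hu.
have mWA : measurable (W @^-1` A) by rewrite -[X in measurable X]setTI; exact: mW.
pose F k := (W @^-1` A) `&` [set w | lev k (u, W w)].
have mFk k : measurable (F k).
  apply: measurableI => //; rewrite -[X in measurable X]setTI.
  exact: (mpu measurableT _ (mlev k)).
have E2 (h : T -> R) k : \int[P]_(w in F k) (h w)%:E =
    \int[P]_w ((lv k w * h w)%R%:E * (\1_A (W w))%:E).
  rewrite integral_mkcond epatch_indic; apply: eq_integral => w _ /=.
  rewrite -!EFinM; congr EFin; rewrite mulrC -mulrA [X in (_ = _ * X)%R]mulrC mulrA.
  congr (_ * _)%R; rewrite /lv !indicE -natrM mulnb; congr (_%:R); congr nat_of_bool.
  apply/idP/andP => [/set_mem[? ?]|[/set_mem ? /set_mem ?]]; last by apply/mem_set; split.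
  by split; apply/mem_set.
have ndF : nondecreasing_seq F.
  move=> i j ij; apply/subsetPset => w [Aw /= fi]; split => //=.
  by apply: le_trans fi _; rewrite ler_nat.
have FU : \bigcup_k F k = W @^-1` A.
  apply/seteqP; split => [w [k _ []]//|w Aw].
  (* The levels exhaust the event because [f] takes real values. *)
  exists (Num.truncn (f (u, W w))).+1 => //; split => //=.
  by rewrite /lev /= ltW// truncnS_gt.
have cv (h : T -> R) : measurable_fun setT h -> (forall w, (0 <= h w)%R) ->
    \int[P]_(w in F k) (h w)%:E @[k --> \oo] --> \int[P]_(w in W @^-1` A) (h w)%:E.
  move=> mh h0; rewrite -FU; apply: ge0_nondecreasing_set_cvg_integral => //.
  - by move=> k; apply/measurable_EFinP; exact: measurable_funTS.
  - by move=> k w _; rewrite lee_fin.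
have c1 := cv _ mfu (fun w => f0 _); have c2 := cv _ mgu (fun w => g0 _).
rewrite -(cvg_lim _ c1)// -(cvg_lim _ c2)//; congr (limn _); apply/funext => k.
by rewrite !E2.
Qed.

End exchange.

(** * Integration over tuples, with and without marks *)

Lemma measurable_map_tuple d1 d2 (T1 : measurableType d1) (T2 : measurableType d2) n
    (f : T1 -> T2) : measurable_fun setT f ->
  measurable_fun setT (map_tuple f : n.-tuple T1 -> n.-tuple T2).
Proof.
move=> mf; apply/measurable_fun_tnthP => i.
rewrite (_ : _ \o _ = f \o (@tnth n T1)^~ i).
  by apply: measurableT_comp => //; exact: measurable_tnth.
by apply/funext => t; rewrite /= tnth_map.
Qed.

Lemma integral_mprod d1 d2 (T1 : measurableType d1) (T2 : measurableType d2)
    (R : realType) (m1 : {sigma_finite_measure set T1 -> \bar R})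
    (m2 : {sigma_finite_measure set T2 -> \bar R}) (f : T1 * T2 -> \bar R) :
  measurable_fun setT f -> (forall z, 0 <= f z) ->
  \int[mprod m1 m2]_z f z = \int[m1]_x \int[m2]_y f (x, y).
Proof.
move=> mf f0; rewrite (eq_measure_integral (m1 \x m2 : {measure set _ -> \bar R}))//.
exact: fubini_tonelli1.
Qed.

Lemma measurable_tcons d (T : measurableType d) n : measurable_fun setT (@tcons _ T n).
Proof. exact: measurable_cons. Qed.

Lemma integral_power_step d (T : measurableType d) (R : realType) n
    (mu : {sigma_finite_measure set T -> \bar R})
    (nu : {sigma_finite_measure set (n.-tuple T) -> \bar R})
    (f : n.+1.-tuple T -> \bar R) :
  measurable_fun setT f -> (forall v, 0 <= f v) ->
  \int[power_step mu nu]_v f v = \int[mu]_x \int[nu]_t f (tcons (x, t)).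
Proof.
move=> mf f0.
transitivity (\int[mprod mu nu]_z f (tcons z)).
  have := @ge0_integral_pushforward _ _ _ _ R _ (@measurable_tcons _ T n)
    (mprod mu nu) setT f measurableT mf (fun v _ => f0 v).
  by rewrite preimage_setT.
rewrite (@integral_mprod _ _ _ _ R mu nu (fun z => f (tcons z)))//.
exact: (measurableT_comp mf (@measurable_tcons _ T n)).
Qed.

Section mpower_marks.
Context dS (S : measurableType dS) (R : realType).
Variable mu : {sigma_finite_measure set S -> \bar R}.

Definition all_true n (t : n.-tuple (S * bool)) : bool := all (fun z => z.2) t.

Lemma measurable_all_true n : measurable_fun setT (@all_true n).
Proof.
rewrite (_ : @all_true n = (fun t => all (fun i => (tnth t i).2) (enum 'I_n))).
  apply: measurable_all => i.
  by apply: measurableT_comp; [exact: measurable_snd|exact: measurable_tnth].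
apply/funext => t; apply/allP/allP => [H i _|H z /tnthP[i ->]].
  by apply: H; exact: mem_tnth.
by apply: H; rewrite mem_enum.
Qed.

Let integral_mark (a : bool -> \bar R) : (forall b, 0 <= a b) ->
  \int[mark_counting R]_b ((b%:R)%:E * a b) = a true.
Proof.
move=> a0; rewrite (eq_integral (a \_ [set true])); last first.
  move=> b _; rewrite patchE; case: b; first by rewrite mem_set// mul1e.
  by rewrite memNset// mul0e.
rewrite -integral_mkcond (eq_integral (cst (a true))); last first.
  by move=> b /set_mem ->.
rewrite integral_cst// -[X in _ * X]/(counting [set true]) counting_finite//.
by rewrite fset_set1 finmap.cardfs1 mule1.
Qed.

(** In each coordinate the mark [true] has counting mass 1, so the tuples with all marks [true]
    carry a copy of [mpower mu n]. Induction on [n], peeling off the first coordinate by Tonelli. *)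
Lemma integral_mpower_true n (F : n.-tuple (S * bool) -> \bar R) :
  measurable_fun setT F -> (forall v, 0 <= F v) ->
  \int[mpower (mprod mu (mark_counting R)) n]_v ((all_true v)%:R%:E * F v) =
  \int[mpower mu n]_u F (map_tuple (fun s => (s, true)) u).
Proof.
have mall k : measurable_fun setT (fun v : k.-tuple (S * bool) => (all_true v)%:R%:E : \bar R).
  rewrite (_ : (fun v => _) = (fun v => if all_true v then 1 else 0)).
    by apply: measurable_fun_ifT => //; exact: measurable_all_true.
  by apply/funext => v; case: (all_true v).
have mmap k : measurable_fun setT (map_tuple (fun s : S => (s, true)) : k.-tuple S -> _).
  by apply: measurable_map_tuple; exact: pair2_measurable.
elim: n F => [|n IH] F mF F0.
  rewrite /mpower integral_dirac//; last by apply: emeasurable_funM => //; exact: mall.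
  rewrite integral_dirac//; last exact: (measurableT_comp mF (mmap 0%N)).
  by rewrite !diracT !mul1e /all_true /=; congr F; exact/val_inj.
pose f (v : n.+1.-tuple (S * bool)) : \bar R := (all_true v)%:R%:E * F v.
have mf : measurable_fun setT f by apply: emeasurable_funM => //; exact: mall.
have f0 v : 0 <= f v by rewrite mule_ge0// lee_fin.
rewrite [LHS](integral_power_step _ _ mf f0).
rewrite [RHS](@integral_power_step _ _ R n mu (mpower mu n)
  (fun u => F (map_tuple (fun s => (s, true)) u))); last 2 first.
  exact: (measurableT_comp mF (mmap _)).
  by move=> u.
pose h z := \int[mpower (mprod mu (mark_counting R)) n]_t f (tcons (z, t)).
have mh : measurable_fun setT h.
  apply: (@measurable_fun_fubini_tonelli_F _ _ _ _ R
    (mpower (mprod mu (mark_counting R)) n) (fun v => f (tcons v))) => //.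
  exact: (measurableT_comp mf (@measurable_tcons _ _ n)).
have h0 z : 0 <= h z by apply: integral_ge0.
rewrite (@integral_mprod _ _ _ _ R mu (mark_counting R) h)//.
apply: eq_integral => x _.
pose a b := \int[mpower mu n]_u F (tcons ((x, b), map_tuple (fun s => (s, true)) u)).
have a0 b : 0 <= a b by apply: integral_ge0.
transitivity (\int[mark_counting R]_b ((b%:R)%:E * a b)); last first.
  rewrite integral_mark// /a; apply: eq_integral => u _.
  by congr F; exact/val_inj.
apply: eq_integral => b _; rewrite /a /h /f.
have mFb : measurable_fun setT (fun t : n.-tuple (S * bool) => F (tcons ((x, b), t))).
  apply: (measurableT_comp mF); apply: (measurableT_comp (@measurable_tcons _ _ _)).
  exact: pair1_measurable.
rewrite -(IH (fun t => F (tcons ((x, b), t))))// -ge0_integralZl//; last 2 first.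
  by apply: emeasurable_funM => //; exact: mall.
  by move=> t _; rewrite mule_ge0// lee_fin.
by apply: eq_integral => t _; rewrite /all_true /= muleA -EFinM -natrM mulnb.
Qed.

End mpower_marks.

(** * Sums over points rewritten as sums over tuples of indices *)

Section sum_distinct_lemmas.
Context dE (R : realType) (E : measurablePseudoMetricType dE R).

Lemma config_eq (c c' : config E) : points c = points c' -> c = c'.
Proof.
case: c => A lA; case: c' => A' lA' /= AA'; move: lA lA'; rewrite AA' => lA lA'.
by congr Config; exact: Prop_irrelevance.
Qed.

Lemma sum_distinct_ge0 n (c : set E) (f : n.-tuple E -> \bar R) :
  (forall t, 0 <= f t) -> sum_distinct c f = esum (distinct_tuples c) f.
Proof.
move=> f0; rewrite /sum_distinct [X in _ - X]esum1 ?sube0.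
  by apply: eq_esum => t _; rewrite funeposE; exact/max_idPl.
by move=> t _; rewrite funenegE; apply/max_idPr; rewrite leeNl oppe0.
Qed.

(** The constraint moves from the index set into the summand: with [J] random, the sum then runs
    over a fixed countable type, as [integral_esum] requires. *)
Lemma esum_enum n (x : nat -> E) (J : nat -> bool) (f : n.-tuple E -> \bar R) :
  set_inj [set i | J i] x ->
  esum (distinct_tuples (x @` [set i | J i])) f =
  \esum_(t in [set: n.-tuple nat])
    (if uniq t && all J t then f (map_tuple x t) else 0).
Proof.
move=> inj; rewrite esum_distinct_tuples// [LHS]esum_mkcond; apply: eq_esum => t _.
congr (if _ then _ else _); apply/idP/andP => [/set_mem[ut tJ]|[ut /allP tJ]].
  by split => //; apply/allP.
by apply/mem_set; split.
Qed.

End sum_distinct_lemmas.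

Section sums.
Context (R : realType) (dS d : measure_display) (S : measurableCompleteMetricType dS R).
Hypothesis S_Borel : (measurable : set (set S)) = <<s [set A : set S | open A] >>.
Variable B : nat -> set S.
Hypothesis Bopen : forall i, open (B i).
Hypothesis Bbase : forall (U : set S) x, open U -> U x -> exists i, B i x /\ B i `<=` U.
Context (T : measurableType d) (P : probability T R).
Variables (p : S -> R) (X : T -> config S).
Variables (x_ : nat -> T -> S) (m : nat -> T -> bool).
Hypothesis mX : measurable_fun setT X.
Hypothesis mp : measurable_fun setT p.
Hypothesis p01 : forall u, (0 < p u < 1)%R.

Notation TX := (g_sigma_algebra_preimageType X).
Notation in_range := (in_range X).

Hypothesis mx : forall i, measurable_fun [set: TX] (x_ i).
Hypothesis mm : forall i, measurable_fun setT (m i).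
Hypothesis x_inj : forall w, set_inj [set i | in_range i w] (x_ ^~ w).
Hypothesis X_x : forall w, points (X w) = x_ ^~ w @` [set i | in_range i w].
Hypothesis marks_condexp : forall k (e : k.-tuple bool),
  is_condexp P X
    (fun w => if (k%:R%:E <= (counting (points (X w)) : \bar R)) &&
                 [forall i : 'I_k, m i w == tnth e i]
              then 1 else 0)
    (fun w => if k%:R%:E <= (counting (points (X w)) : \bar R)
              then (\prod_(i < k) (if tnth e i then p (x_ i w)
                                   else 1 - p (x_ i w)))%:E
              else 0).

Notation subconf := (subconf X_x).
Notation unmarked := (unmarked X_x).
Notation marked := (marked m X_x).

Definition pts n (t : n.-tuple nat) w : n.-tuple S := map_tuple (x_ ^~ w) t.

Definition valid n (t : n.-tuple nat) w : bool := all (in_range ^~ w) t.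

Definition prob (b : bool) (s : S) : R := if b then p s else (1 - p s)%R.

Lemma prob_gt0 b s : (0 < prob b s)%R.
Proof. by have /andP[? ?] := p01 s; rewrite /prob; case: b => //; rewrite subr_gt0. Qed.

Definition prob_tuple n b (u : n.-tuple S) : R := (\prod_(i < n) prob b (tnth u i))%R.

Lemma prob_tuple_gt0 n b (u : n.-tuple S) : (0 < prob_tuple b u)%R.
Proof. by apply: prodr_gt0 => i _; exact: prob_gt0. Qed.

Lemma measurable_prob_tuple n b : measurable_fun setT (@prob_tuple n b).
Proof.
apply: measurable_prod => i _.
have mq : measurable_fun setT (prob b).
  by rewrite /prob; case: b => //; exact: measurable_funB.
exact: (measurableT_comp mq (measurable_tnth i)).
Qed.

Lemma measurable_pts n (t : n.-tuple nat) : measurable_fun [set: TX] (pts t).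
Proof.
apply/measurable_fun_tnthP => i; rewrite (_ : _ \o _ = x_ (tnth t i)); first exact: mx.
by apply/funext => w; rewrite /= tnth_map.
Qed.

Lemma measurable_valid n (t : n.-tuple nat) : measurable_fun [set: TX] (valid t).
Proof. by apply: measurable_all => i; exact: measurable_in_range. Qed.

(** Removing points amounts to removing indices because the enumeration is injective on valid
    indices; validity of [t] is what makes its entries comparable with those of the
    configuration. *)
Lemma remove_subconf n (t : n.-tuple nat) J w : valid t w ->
  remove (subconf J w) (pts t w) = subconf (fun i => (i \notin t) && J i) w.
Proof.
move=> /allP tw; apply: config_eq; apply/seteqP; split => y /=.
  move=> [[i /= /andP[iw Ji] <-] /negP nit]; exists i => //=; rewrite iw Ji andbT /=.
  by apply: contra nit => it; apply/mapP; exists i.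
move=> [i /= /and3P[iw it Ji] <-]; split; first by exists i => //=; rewrite iw Ji.
apply/negP; apply: contra it => /mapP[j jt xij].
have -> // : i = j by apply: x_inj xij; rewrite inE//=; exact: tw.
Qed.

Lemma remove_marked n (t : n.-tuple nat) b w : valid t w ->
  remove (marked b [::] w) (pts t w) = marked b t w.
Proof. by move=> tw; rewrite remove_subconf. Qed.

Lemma remove_unmarked n (t : n.-tuple nat) w : valid t w ->
  remove (unmarked [::] w) (pts t w) = unmarked t w.
Proof.
move=> tw; rewrite remove_subconf//; congr subconf.
by apply/funext => i; rewrite andbT.
Qed.

(** Points of mark [b] are not among those of the opposite mark. Thus [Y] beside a tuple of [Z], and
    [Y] minus a tuple of its own points, are both [marked false t], a configuration blind to the
    marks at [t]. *)
Lemma marked_other n (t : n.-tuple nat) b w : all (fun i => m i w == b) t ->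
  marked (~~ b) [::] w = marked (~~ b) t w.
Proof.
move=> /allP tb; congr subconf; apply/funext => i /=.
by case: (boolP (i \in t)) => //= /tb/eqP ->; case: b {tb}.
Qed.

Lemma unmarked_nil w : unmarked [::] w = X w.
Proof.
apply: config_eq; rewrite X_x /=; congr (_ @` _).
by apply/seteqP; split => i /=; rewrite andbT.
Qed.

Lemma sum_marked n b (f : n.-tuple S -> \bar R) w : (forall t, 0 <= f t) ->
  sum_distinct (marked b [::] w) f = \esum_(t in [set: n.-tuple nat])
    (if uniq t && (valid t w && all (fun i => m i w == b) t) then f (pts t w) else 0).
Proof.
move=> f0; rewrite sum_distinct_ge0// esum_enum; last exact: subconf_inj.
apply: eq_esum => t _; congr (if _ && _ then _ else _).
rewrite /valid -all_predI; exact: eq_all.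
Qed.

Lemma sum_unmarked n (f : n.-tuple S -> \bar R) w : (forall t, 0 <= f t) ->
  sum_distinct (X w) f = \esum_(t in [set: n.-tuple nat])
    (if uniq t && valid t w then f (pts t w) else 0).
Proof. by move=> f0; rewrite sum_distinct_ge0// X_x esum_enum. Qed.

Section marked_sums.
Variables (n : nat) (b b' : bool) (c : T -> n.-tuple S -> config S).
Hypothesis cE : forall t w, valid t w -> all (fun i => m i w == b) t ->
  c w (pts t w) = marked b' t w.
Variable h : n.-tuple S * config S -> \bar R.
Hypotheses (mh : measurable_fun setT h) (h0 : forall v, 0 <= h v).

Let g (t : n.-tuple nat) w : \bar R := if uniq t then
  (valid t w && all (fun i => m i w == b) t)%:R%:E * h (pts t w, marked b' t w) else 0.

Let sumE w : sum_distinct (marked b [::] w) (fun x => h (x, c w x)) =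
  \esum_(t in [set: n.-tuple nat]) g t w.
Proof.
rewrite sum_marked//; apply: eq_esum => t _; rewrite /g; case: (uniq t) => //=.
case: ifPn => [tb|_]; last by rewrite mul0e.
by rewrite mul1e; case/andP: tb => ? ?; rewrite cE.
Qed.

Let g0 t w : 0 <= g t w.
Proof. by rewrite /g; case: ifP => // _; rewrite mule_ge0// lee_fin. Qed.

Let mg t : measurable_fun setT (g t).
Proof.
rewrite /g; case: (uniq t) => //; apply: emeasurable_funM.
  rewrite (_ : (fun w => _) = (fun w => if valid t w && all (fun i => m i w == b) t then 1 else 0)).
    apply: measurable_fun_ifT => //; apply: measurable_and.
      exact: (measurable_fun_preimage mX (measurable_valid t)).
    apply: measurable_all => i; rewrite (_ : (fun w => _) = (fun w => if m i w then b else ~~ b)).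
      exact: measurable_fun_ifT.
    by apply/funext => w; case: (m i w); case: b.
  by apply/funext => w; case: (_ && _).
apply: (measurableT_comp mh); apply/measurable_fun_pairP; split.
  exact: (measurable_fun_preimage mX (measurable_pts t)).
exact: measurable_marked.
Qed.

Lemma measurable_sum_marked :
  measurable_fun setT (fun w => sum_distinct (marked b [::] w) (fun x => h (x, c w x))).
Proof. by under eq_fun do rewrite sumE; exact: measurable_esum. Qed.

(** The map [c] lets one statement serve the three sums in use, with second argument [Y] or a
    process minus the tuple. By [cE] that argument avoids the marks at [t], so [integral_mark]
    replaces these marks by their probabilities. *)
Lemma integral_sum_marked :
  \int[P]_w sum_distinct (marked b [::] w) (fun x => h (x, c w x)) =
  \esum_(t in [set: n.-tuple nat]) (if uniq t then
    \int[P]_w (((valid t w)%:R * prob_tuple b (pts t w))%R%:E *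
               h (pts t w, marked b' t w)) else 0).
Proof.
under eq_integral do rewrite sumE.
rewrite integral_esum//; apply: eq_esum => t _; rewrite /g.
case: ifP => ut; last by rewrite integral0.
have mF : measurable_fun setT (fun v : TX * config S => h (pts t v.1, v.2)).
  apply: (measurableT_comp mh); apply/measurable_fun_pairP; split.
    by apply: (measurableT_comp (measurable_pts t)); exact: measurable_fst.
  exact: measurable_snd.
have := integral_mark S_Borel Bopen Bbase mX mp p01 mx mm x_inj X_x marks_condexp
  b b' ut mF (fun v => h0 _).
move=> /= ->; apply: eq_integral => w _; congr (_%:E * _); congr (_ * _)%R.
by rewrite big_tuple; apply: eq_bigr => i _; rewrite tnth_map.
Qed.

End marked_sums.

Lemma integral_sum_unmarked n (h : n.-tuple S * config S -> \bar R) :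
  measurable_fun setT h -> (forall v, 0 <= h v) ->
  \int[P]_w sum_distinct (X w) (fun x => h (x, remove (X w) x)) =
  \esum_(t in [set: n.-tuple nat]) (if uniq t then
    \int[P]_w ((valid t w)%:R%:E * h (pts t w, unmarked t w)) else 0).
Proof.
move=> mh h0.
pose g (t : n.-tuple nat) w : \bar R := if uniq t then
  (valid t w)%:R%:E * h (pts t w, unmarked t w) else 0.
have g0 t w : 0 <= g t w by rewrite /g; case: ifP => // _; rewrite mule_ge0// lee_fin.
have mg t : measurable_fun setT (g t).
  rewrite /g; case: (uniq t) => //; apply: emeasurable_funM.
    rewrite (_ : (fun w => _) = (fun w => if valid t w then 1 else 0)).
      apply: measurable_fun_ifT => //.
      exact: (measurable_fun_preimage mX (measurable_valid t)).
    by apply/funext => w; case: (valid t w).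
  apply: (measurableT_comp mh); apply/measurable_fun_pairP; split.
    exact: (measurable_fun_preimage mX (measurable_pts t)).
  by apply: (measurable_fun_preimage mX); exact: measurable_unmarked.
rewrite (eq_integral (fun w => \esum_(t in [set: n.-tuple nat]) g t w)); last first.
  move=> w _; rewrite sum_unmarked//; apply: eq_esum => t _; rewrite /g.
  case: (uniq t) => //=; case: ifPn => [tw|_]; last by rewrite mul0e.
  by rewrite mul1e -remove_unmarked// unmarked_nil.
rewrite integral_esum//; apply: eq_esum => t _; rewrite /g.
by case: ifP => // _; rewrite integral0.
Qed.

End sums.

Lemma papangelou_gnz dE d (R : realType) (E : measurablePseudoMetricType dE R)
    (T : measurableType d) (mu : {sigma_finite_measure set E -> \bar R})
    (P : probability T R) (X : T -> config E) n lam (h : n.-tuple E * config E -> R) :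
  is_papangelou mu P X lam -> measurable_fun setT h -> (forall v, (0 <= h v)%R) ->
  \int[P]_w sum_distinct (X w) (fun x : n.-tuple E => (h (x, remove (X w) x))%:E) =
  \int[mpower mu n]_u \int[P]_w (h (u, X w) * lam (u, X w))%:E.
Proof. by move=> [_ _ gnz] mh h0; exact: gnz. Qed.

(** * The points of mark [false] of a marked configuration *)

Section ground.
Context (R : realType) (dS : measure_display) (S : measurableCompleteMetricType dS R).

Lemma ground_locally_finite (c : config (S * bool)%type) :
  locally_finite_set [set s : S | points c (s, false)].
Proof.
(* The maximum with 1 makes the radius positive, so that the mark [false] lies in the ball about
   itself; [r] is arbitrary. *)
move=> y r; have lf := points_locally_finite c (y, false) (Num.max r 1)%R.
apply: sub_finite_set (finite_image (fun z => z.1) lf) => s [cs ys].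
exists (s, false) => //; split => //; split => /=.
  by apply: le_ball ys; rewrite le_max lexx.
by apply: ballxx; rewrite lt_max ltr01 orbT.
Qed.

(** Recovers [Y] from the marked process, so that a test function of [Y] becomes a test function for
    the formula of the marked process. *)
Definition ground (c : config (S * bool)%type) : config S :=
  Config (@ground_locally_finite c).

Lemma measurable_ground : measurable_fun setT ground.
Proof.
apply: measurable_fun_config => A mA.
rewrite (_ : (fun c => _) = count (A `*` [set false]) :> (config (S * bool)%type -> \bar R)).
  by apply: measurable_count; exact: measurableX.
apply/funext => c; rewrite /count.
rewrite -(@counting_image R _ _ (fun s : S => (s, false))); last by move=> s t _ _ [].
congr counting; apply/seteqP; split => [_ [s [cs As] <-]//|[s b] [cs /= [As bf]]].
by rewrite bf in cs *; exists s.
Qed.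

End ground.

(** * The identities for the thinned process and its complement *)

Section thinned_process.
Context (R : realType) (dS d : measure_display) (S : measurableCompleteMetricType dS R).
Hypothesis S_Borel : (measurable : set (set S)) = <<s [set A : set S | open A] >>.
Variable B : nat -> set S.
Hypothesis Bopen : forall i, open (B i).
Hypothesis Bbase : forall (U : set S) x, open U -> U x -> exists i, B i x /\ B i `<=` U.
Context (T : measurableType d) (P : probability T R).
Variables (p : S -> R) (X : T -> config S).
Variables (x_ : nat -> T -> S) (m : nat -> T -> bool).
Hypothesis mX : measurable_fun setT X.
Hypothesis mp : measurable_fun setT p.
Hypothesis p01 : forall u, (0 < p u < 1)%R.

Notation TX := (g_sigma_algebra_preimageType X).
Notation in_range := (in_range X).

Hypothesis mx : forall i, measurable_fun [set: TX] (x_ i).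
Hypothesis mm : forall i, measurable_fun setT (m i).
Hypothesis x_inj : forall w, set_inj [set i | in_range i w] (x_ ^~ w).
Hypothesis X_x : forall w, points (X w) = x_ ^~ w @` [set i | in_range i w].
Hypothesis marks_condexp : forall k (e : k.-tuple bool),
  is_condexp P X
    (fun w => if (k%:R%:E <= (counting (points (X w)) : \bar R)) &&
                 [forall i : 'I_k, m i w == tnth e i]
              then 1 else 0)
    (fun w => if k%:R%:E <= (counting (points (X w)) : \bar R)
              then (\prod_(i < k) (if tnth e i then p (x_ i w)
                                   else 1 - p (x_ i w)))%:E
              else 0).

Notation subconf := (subconf X_x).
Notation unmarked := (unmarked X_x).
Notation marked := (marked m X_x).

Notation prob := (prob p).
Notation prob_tuple := (prob_tuple p).

Variables (Z Y : T -> config S).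
Hypothesis ZE : forall w, Z w = marked true [::] w.
Hypothesis YE : forall w, Y w = marked false [::] w.

Let mZ : measurable_fun setT Z.
Proof. by rewrite (funext ZE); exact: measurable_marked. Qed.

Let mY : measurable_fun setT Y.
Proof. by rewrite (funext YE); exact: measurable_marked. Qed.

Let mEFinM n (h : n.-tuple S * config S -> R) (q : n.-tuple S -> R) :
  measurable_fun setT h -> measurable_fun setT q ->
  measurable_fun setT (fun v => (h v * q v.1)%R%:E : \bar R).
Proof.
move=> mh mq; apply/measurable_EFinP; apply: measurable_funM => //.
by apply: measurableT_comp.
Qed.

Let Y_other n (t : n.-tuple nat) w : valid X t w -> all (fun i => m i w == true) t ->
  Y w = marked false t w.
Proof. by move=> _ tb; rewrite YE; exact: (marked_other X_x tb). Qed.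

Let Y_remove n (t : n.-tuple nat) w : valid X t w -> all (fun i => m i w == false) t ->
  remove (Y w) (pts x_ t w) = marked false t w.
Proof. by move=> tw _; rewrite YE remove_marked. Qed.

Let Z_remove n (t : n.-tuple nat) w : valid X t w -> all (fun i => m i w == true) t ->
  remove (Z w) (pts x_ t w) = marked true t w.
Proof. by move=> tw _; rewrite ZE remove_marked. Qed.

Let integral_sum_ZY n (h : n.-tuple S * config S -> \bar R) :
  measurable_fun setT h -> (forall v, 0 <= h v) ->
  \int[P]_w sum_distinct (Z w) (fun x => h (x, Y w)) =
  \esum_(t in [set: n.-tuple nat]) (if uniq t then
    \int[P]_w (((valid X t w)%:R * prob_tuple true (pts x_ t w))%R%:E *
               h (pts x_ t w, marked false t w)) else 0).
Proof.
move=> mh h0.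
rewrite (eq_integral (fun w => sum_distinct (marked true [::] w) (fun x => h (x, Y w)))).
  exact: (integral_sum_marked S_Borel Bopen Bbase mX mp p01 mx mm x_inj marks_condexp
    (c := fun w x => Y w) (fun t w => @Y_other n t w) mh h0).
by move=> w _; rewrite -ZE.
Qed.

Let integral_sum_YY n (h : n.-tuple S * config S -> \bar R) :
  measurable_fun setT h -> (forall v, 0 <= h v) ->
  \int[P]_w sum_distinct (Y w) (fun x => h (x, remove (Y w) x)) =
  \esum_(t in [set: n.-tuple nat]) (if uniq t then
    \int[P]_w (((valid X t w)%:R * prob_tuple false (pts x_ t w))%R%:E *
               h (pts x_ t w, marked false t w)) else 0).
Proof.
move=> mh h0.
rewrite (eq_integral
  (fun w => sum_distinct (marked false [::] w) (fun x => h (x, remove (Y w) x)))).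
  exact: (integral_sum_marked S_Borel Bopen Bbase mX mp p01 mx mm x_inj marks_condexp
    (c := fun w x => remove (Y w) x) (fun t w => @Y_remove n t w) mh h0).
by move=> w _; rewrite -YE.
Qed.

Let integral_sum_ZZ n (h : n.-tuple S * config S -> \bar R) :
  measurable_fun setT h -> (forall v, 0 <= h v) ->
  \int[P]_w sum_distinct (Z w) (fun x => h (x, remove (Z w) x)) =
  \esum_(t in [set: n.-tuple nat]) (if uniq t then
    \int[P]_w (((valid X t w)%:R * prob_tuple true (pts x_ t w))%R%:E *
               h (pts x_ t w, marked true t w)) else 0).
Proof.
move=> mh h0.
rewrite (eq_integral
  (fun w => sum_distinct (marked true [::] w) (fun x => h (x, remove (Z w) x)))).
  exact: (integral_sum_marked S_Borel Bopen Bbase mX mp p01 mx mm x_inj marks_condexp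
    (c := fun w x => remove (Z w) x) (fun t w => @Z_remove n t w) mh h0).
by move=> w _; rewrite -ZE.
Qed.

Lemma thinning_swap_ge0 n (h : n.-tuple S * config S -> R) :
  measurable_fun setT h -> (forall v, (0 <= h v)%R) ->
  \int[P]_w sum_distinct (Z w) (fun x => (h (x, Y w) * prob_tuple false x)%R%:E) =
  \int[P]_w sum_distinct (Y w) (fun x => (h (x, remove (Y w) x) * prob_tuple true x)%R%:E).
Proof.
move=> mh h0.
have pt0 b (u : n.-tuple S) : (0 <= prob_tuple b u)%R by rewrite ltW ?prob_tuple_gt0.
rewrite (@integral_sum_ZY n (fun v => (h v * prob_tuple false v.1)%R%:E)); last 2 first.
- by apply: mEFinM => //; exact: measurable_prob_tuple.
- by move=> v; rewrite lee_fin mulr_ge0.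
rewrite (@integral_sum_YY n (fun v => (h v * prob_tuple true v.1)%R%:E)); last 2 first.
- by apply: mEFinM => //; exact: measurable_prob_tuple.
- by move=> v; rewrite lee_fin mulr_ge0.
apply: eq_esum => t _; case: ifP => // _; apply: eq_integral => w _ /=.
rewrite -!EFinM; congr EFin; rewrite -!mulrA; congr (_ * _)%R.
by rewrite mulrCA [RHS]mulrCA [X in (_ * X)%R]mulrC.
Qed.

Section signed.
Variables (n : nat) (b b' : bool) (c : T -> n.-tuple S -> config S).
Hypothesis cE : forall t w, valid X t w -> all (fun i => m i w == b) t ->
  c w (pts x_ t w) = marked b' t w.
Variable q : n.-tuple S -> R.
Hypotheses (mq : measurable_fun setT q) (q0 : forall x, (0 <= q x)%R).

Let sg (h : n.-tuple S * config S -> R) w : \bar R :=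
  sum_distinct (marked b [::] w) (fun x => (h (x, c w x) * q x)%R%:E).

Let sg_ge0 (h : n.-tuple S * config S -> R) w : (forall v, (0 <= h v)%R) -> 0 <= sg h w.
Proof.
move=> h0; rewrite /sg sum_distinct_ge0 => [|t]; last by rewrite lee_fin mulr_ge0.
by apply: esum_ge0 => t _; rewrite lee_fin mulr_ge0.
Qed.

Let msg (h : n.-tuple S * config S -> R) : measurable_fun setT h ->
  (forall v, (0 <= h v)%R) -> measurable_fun setT (sg h).
Proof.
move=> mh h0.
apply: (measurable_sum_marked mX mx mm x_inj cE (h := fun v => (h v * q v.1)%R%:E)).
  exact: mEFinM.
by move=> v; rewrite lee_fin mulr_ge0.
Qed.

(** As [q] is nonnegative, the positive and negative parts of a summand are [q] times those of [h].
    Both parts have integrable sums, being dominated by [|h|], so the integral of the difference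
    splits. *)
Lemma integral_signed (h : n.-tuple S * config S -> R) : measurable_fun setT h ->
  \int[P]_w sg (fun v => `|h v|%R) w < +oo ->
  \int[P]_w sg h w = \int[P]_w sg (fun v => Num.max (h v) 0)%R w -
                     \int[P]_w sg (fun v => Num.max (- h v) 0)%R w.
Proof.
move=> mh hoo.
have m1 : measurable_fun setT (fun v => Num.max (h v) 0)%R.
  by apply: measurable_maxr => //; exact: measurable_cst.
have m2 : measurable_fun setT (fun v => Num.max (- h v) 0)%R.
  by apply: measurable_maxr; [exact: measurable_funN|exact: measurable_cst].
have ma : measurable_fun setT (fun v => `|h v|)%R by exact: measurableT_comp.
have p1 v : (0 <= Num.max (h v) 0)%R by rewrite le_max lexx orbT.
have p2 v : (0 <= Num.max (- h v) 0)%R by rewrite le_max lexx orbT.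
have intg (k : n.-tuple S * config S -> R) : measurable_fun setT k ->
    (forall v, (0 <= k v <= `|h v|)%R) -> P.-integrable setT (sg k).
  move=> mk kh; have k0 v : (0 <= k v)%R by have /andP[] := kh v.
  apply/integrableP; split; first exact: msg.
  apply: le_lt_trans hoo; apply: ge0_le_integral => //.
  - by apply: measurableT_comp => //; exact: msg.
  - exact: msg.
  - move=> w _; rewrite gee0_abs; last exact: sg_ge0.
    rewrite /sg !sum_distinct_ge0.
    + apply: le_esum => t _; rewrite lee_fin ler_wpM2r//.
      by have /andP[] := kh (t, c w t).
    + by move=> t; rewrite lee_fin mulr_ge0.
    + by move=> t; rewrite lee_fin mulr_ge0.
rewrite -integralB//; last 2 first.
- apply: intg => // v; rewrite p1 ge_max normr_ge0 ler_norm//.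
- apply: intg => // v; rewrite p2 ge_max normr_ge0 -normrN ler_norm//.
apply: eq_integral => w _.
have sgE (k : n.-tuple S * config S -> R) : (forall v, (0 <= k v)%R) ->
    sg k w = \esum_(t in distinct_tuples (marked b [::] w)) (k (t, c w t) * q t)%R%:E.
  by move=> k0; rewrite /sg sum_distinct_ge0// => t; rewrite lee_fin mulr_ge0.
rewrite (sgE _ p1) (sgE _ p2) /sg /sum_distinct; congr (_ - _); apply: eq_esum => t _.
  rewrite funeposE -EFin_max; congr EFin.
  by rewrite -[in LHS](mul0r (q t)) maxr_pMl.
rewrite funenegE -EFinN -EFin_max; congr EFin.
by rewrite -mulNr -[in LHS](mul0r (q t)) maxr_pMl.
Qed.

End signed.

Lemma thinning_swap n (h : n.-tuple S * config S -> R) : measurable_fun setT h ->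
  \int[P]_w sum_distinct (Z w) (fun x => (`|h (x, Y w)| * prob_tuple false x)%R%:E) < +oo ->
  \int[P]_w sum_distinct (Y w)
    (fun x => (`|h (x, remove (Y w) x)| * prob_tuple true x)%R%:E) < +oo ->
  \int[P]_w sum_distinct (Z w) (fun x => (h (x, Y w) * prob_tuple false x)%R%:E) =
  \int[P]_w sum_distinct (Y w) (fun x => (h (x, remove (Y w) x) * prob_tuple true x)%R%:E).
Proof.
move=> mh hZ hY.
have pt0 b (u : n.-tuple S) : (0 <= prob_tuple b u)%R by rewrite ltW ?prob_tuple_gt0.
have EZ (k : n.-tuple S * config S -> R) :
    \int[P]_w sum_distinct (Z w) (fun x => (k (x, Y w) * prob_tuple false x)%R%:E) =
    \int[P]_w sum_distinct (marked true [::] w)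
      (fun x => (k (x, Y w) * prob_tuple false x)%R%:E).
  by apply: eq_integral => w _; rewrite -ZE.
have EY (k : n.-tuple S * config S -> R) :
    \int[P]_w sum_distinct (Y w) (fun x => (k (x, remove (Y w) x) * prob_tuple true x)%R%:E) =
    \int[P]_w sum_distinct (marked false [::] w)
      (fun x => (k (x, remove (Y w) x) * prob_tuple true x)%R%:E).
  by apply: eq_integral => w _; rewrite -YE.
have mpt b : measurable_fun setT (prob_tuple b : n.-tuple S -> R).
  exact: measurable_prob_tuple.
have mmax (k : n.-tuple S * config S -> R) : measurable_fun setT k ->
    measurable_fun setT (fun v => Num.max (k v) 0)%R.
  by move=> mk; apply: measurable_maxr => //; exact: measurable_cst.
have max0 (k : n.-tuple S * config S -> R) v : (0 <= Num.max (k v) 0)%R.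
  by rewrite le_max lexx orbT.
rewrite EZ (integral_signed (c := fun w _ => Y w) (fun t w => @Y_other n t w) (mpt false)
  (pt0 false) mh); last by rewrite -(EZ (fun v => `|h v|%R)).
rewrite EY (integral_signed (c := fun w x => remove (Y w) x) (fun t w => @Y_remove n t w)
  (mpt true) (pt0 true) mh); last by rewrite -(EY (fun v => `|h v|%R)).
congr (_ - _).
  rewrite -(EZ (fun v => Num.max (h v) 0)%R) -(EY (fun v => Num.max (h v) 0)%R).
  exact: (@thinning_swap_ge0 n (fun v => Num.max (h v) 0)%R (mmax _ mh) (max0 _)).
rewrite -(EZ (fun v => Num.max (- h v) 0)%R) -(EY (fun v => Num.max (- h v) 0)%R).
exact: (@thinning_swap_ge0 n (fun v => Num.max (- h v) 0)%R
  (mmax _ (measurable_funN mh)) (max0 (fun v => - h v)%R)).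
Qed.

(** By positivity the inverse is the exponential of minus the logarithm, both measurable. *)
Let measurable_probV n b : measurable_fun setT (fun u : n.-tuple S => (prob_tuple b u)^-1)%R.
Proof.
rewrite (_ : (fun u => _) = (fun u => expR (- ln (prob_tuple b u)))).
  apply: measurableT_comp; first exact: measurable_expR.
  apply: measurable_funN; apply: measurableT_comp; first exact: measurable_ln.
  exact: measurable_prob_tuple.
by apply/funext => u; rewrite expRN lnK// posrE prob_tuple_gt0.
Qed.

Lemma papangelou_transfer n (mu : {sigma_finite_measure set S -> \bar R})
    (lamX : n.-tuple S * config S -> R) (C : set (n.-tuple S * config S)) :
  is_papangelou mu P X lamX -> measurable C ->
  \int[P]_w sum_distinct (Z w)
    (fun x => (\1_C (x, remove (Z w) x) / prob_tuple true x)%R%:E) =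
  \int[mpower mu n]_u \int[P]_w (\1_C (u, Z w) * lamX (u, X w))%:E.
Proof.
move=> HX mC; have [mlam lam0 gnz] := HX.
have m1C : measurable_fun setT (\1_C : n.-tuple S * config S -> R) by exact: measurable_indic.
have mq := @measurable_probV n true.
have q0 (u : n.-tuple S) : (0 < (prob_tuple true u)^-1)%R by rewrite invr_gt0 prob_tuple_gt0.
rewrite (@integral_sum_ZZ n (fun v => (\1_C v / prob_tuple true v.1)%R%:E)); last 2 first.
- exact: (mEFinM m1C mq).
- by move=> v; rewrite lee_fin mulr_ge0// ltW.
have [h [mh h01 hC]] := thinning_kernel S_Borel Bopen Bbase mX mp p01 mx mm x_inj X_x
  marks_condexp mC.
have h0 v : (0 <= h v)%R by have /andP[] := h01 v.
have meC (k : n.-tuple S * config S -> R) (U : T -> n.-tuple S) (W : T -> config S) :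
    measurable_fun setT k -> measurable_fun setT U -> measurable_fun setT W ->
    measurable_fun setT (fun w => (k (U w, W w))%:E : \bar R).
  move=> mk mU mW; apply/measurable_EFinP; apply: (measurableT_comp mk).
  exact/measurable_fun_pairP.
(* The division by [prob_tuple true] cancels the probability of the marks at [t]. What remains is
   averaged given [X] with the kernel at [I = t]; since [h] is the same for all [t], the result is a
   sum over tuples of [X]. *)
transitivity (\esum_(t in [set: n.-tuple nat]) (if uniq t then
    \int[P]_w ((valid X t w)%:R%:E * (h (pts x_ t w, unmarked t w))%:E) else 0)).
  apply: eq_esum => t _; case: ifP => // _.
  have mpts := measurable_pts mx t.
  have mf : measurable_fun setT (fun w => (\1_C (pts x_ t w, marked true t w))%:E : \bar R).
    apply: meC => //; first exact: (measurable_fun_preimage mX mpts).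
    exact: measurable_marked.
  have mG : measurable_fun [set: TX] (fun w => (valid X t w)%:R%:E : \bar R).
    rewrite (_ : (fun w => _) = (fun w => if valid X t w then 1 else 0)).
      by apply: measurable_fun_ifT => //; exact: measurable_valid.
    by apply/funext => w; case: (valid X t w).
  rewrite -(is_condexp_mul mX (hC t (pts x_ t) mpts) mf _ _ mG)//.
  - apply: eq_integral => w _; rewrite -!EFinM; congr EFin.
    rewrite -mulrA; congr (_ * _)%R; rewrite mulrCA mulfV ?mulr1//.
    by rewrite gt_eqF// prob_tuple_gt0.
  - by move=> w; rewrite lee_fin.
have meh : measurable_fun setT (fun v => (h v)%:E : \bar R) by exact/measurable_EFinP.
rewrite -(integral_sum_unmarked P mX mx x_inj X_x meh); last by move=> v; rewrite lee_fin.
rewrite (papangelou_gnz HX mh h0); apply: eq_integral => u _.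
have mf : measurable_fun setT (fun w => (\1_C (u, marked true [::] w))%:E : \bar R).
  apply: (meC _ (cst u)) => //; exact: measurable_marked.
have mG : measurable_fun [set: TX] (fun w => (lamX (u, X w))%:E : \bar R).
  apply: (measurable_preimage_comp (f := fun c => (lamX (u, c))%:E : \bar R)).
  by apply/measurable_EFinP; exact: measurable_fun_pair2.
(* After the formula for [X], the kernel is used backwards, with no index removed and the tuple
   frozen at [u]: it turns [h (u, X)] back into the indicator at [(u, Z)], with [lamX (u, X)] as the
   [X]-measurable test function. *)
have := is_condexp_mul mX (hC [::] (cst u) (measurable_cst u)) mf _ _ mG.
have H1 w : 0 <= (\1_C (u, marked true [::] w))%:E :> \bar R by rewrite lee_fin.
have H2 w : 0 <= (h (u, unmarked [::] w))%:E :> \bar R by rewrite lee_fin.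
have H3 w : 0 <= (lamX (u, X w))%:E by rewrite lee_fin.
move=> /(_ H1 H2 H3) E0.
transitivity (\int[P]_w ((lamX (u, X w))%:E * (h (u, unmarked [::] w))%:E)).
  by apply: eq_integral => w _; rewrite -EFinM mulrC unmarked_nil.
by rewrite -E0; apply: eq_integral => w _; rewrite -EFinM mulrC ZE.
Qed.

Lemma papangelou_thinned_ae n (mu : {sigma_finite_measure set S -> \bar R})
    (lamX lamZ : n.-tuple S * config S -> R) :
  is_papangelou mu P X lamX -> is_papangelou mu P Z lamZ ->
  {ae mpower mu n, forall u : n.-tuple S, {ae P, forall w,
    (lamZ (u, Z w))%:E = (prob_tuple true u)%:E *
      condexp P Z (fun w' => (lamX (u, X w'))%:E) w}}.
Proof.
move=> HX HZ; have [mlX lX0 _] := HX; have [mlZ lZ0 _] := HZ.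
have pt0 (u : n.-tuple S) : (0 < prob_tuple true u)%R by exact: prob_tuple_gt0.
(* [f (u, Z)] is the candidate for the conditional expectation of [lamX (u, X)] given [Z]. *)
pose f (v : n.-tuple S * config S) : R := (lamZ v / prob_tuple true v.1)%R.
have mq1 : measurable_fun setT (fun v : n.-tuple S * config S => (prob_tuple true v.1)^-1)%R.
  by apply: (measurableT_comp (@measurable_probV n true)); exact: measurable_fst.
have mf : measurable_fun setT f by exact: measurable_funM.
have f0 v : (0 <= f v)%R by rewrite mulr_ge0// invr_ge0 ltW.
pose g (v : n.-tuple S * T) : R := lamX (v.1, X v.2).
have mg : measurable_fun setT g.
  apply: (measurableT_comp mlX); apply/measurable_fun_pairP; split.
    exact: measurable_fst.
  by apply: (measurableT_comp mX); exact: measurable_snd.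
have g0 v : (0 <= g v)%R by exact: lX0.
have fg C : measurable C ->
    \int[mpower mu n]_u \int[P]_w (\1_C (u, Z w) * f (u, Z w))%:E =
    \int[mpower mu n]_u \int[P]_w (\1_C (u, Z w) * g (u, w))%:E.
  move=> mC; rewrite -(papangelou_transfer HX mC).
  have mh : measurable_fun setT (fun v : n.-tuple S * config S => \1_C v / prob_tuple true v.1)%R.
    by apply: measurable_funM => //; exact: measurable_indic.
  have h0 v : (0 <= \1_C v / prob_tuple true v.1 :> R)%R by rewrite mulr_ge0// invr_ge0 ltW.
  rewrite (papangelou_gnz HZ mh h0); apply: eq_integral => u _.
  by apply: eq_integral => w _; congr EFin; rewrite /f /= mulrA mulrAC.
have := integral_exchange_ae S_Borel Bopen Bbase mZ mf mg f0 g0 fg.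
apply: filterS => u Hu.
have c : is_condexp P Z (fun w => (lamX (u, X w))%:E) (fun w => (f (u, Z w))%:E).
  split; last by move=> A mA; exact: Hu.
  apply: (measurable_preimage_comp (f := fun c => (f (u, c))%:E : \bar R)).
  by apply/measurable_EFinP; exact: measurable_fun_pair2.
have := condexp_ae_eq mZ c; have fe0 w : 0 <= (f (u, Z w))%:E by rewrite lee_fin.
move=> /(_ fe0); apply: filterS => w ->.
by rewrite -EFinM /f /= mulrC divfK// gt_eqF.
Qed.

(** Test functions depend on the points of the tuple only, so the sum over [Z] is at once the sum
    over [X] weighted by [prob_tuple true]. *)
Lemma density_thinned_ae n (mu : {sigma_finite_measure set S -> \bar R})
    (rhoX rhoZ : n.-tuple S -> R) :
  is_product_density mu P X rhoX -> is_product_density mu P Z rhoZ ->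
  {ae mpower mu n, forall u : n.-tuple S, rhoZ u = (prob_tuple true u * rhoX u)%R}.
Proof.
move=> [mrX rX0 dX] [mrZ rZ0 dZ].
have pt0 (u : n.-tuple S) : (0 <= prob_tuple true u)%R by rewrite ltW ?prob_tuple_gt0.
have mpt : measurable_fun setT (prob_tuple true : n.-tuple S -> R).
  exact: measurable_prob_tuple.
have key (h : n.-tuple S -> R) : measurable_fun setT h -> (forall u, (0 <= h u)%R) ->
    \int[mpower mu n]_u (h u * rhoZ u)%:E =
    \int[mpower mu n]_u (h u * prob_tuple true u * rhoX u)%:E.
  move=> mh h0; rewrite -(dZ h mh h0) -(dX (fun u => h u * prob_tuple true u)%R); last 2 first.
  - exact: measurable_funM.
  - by move=> u; rewrite mulr_ge0.
  have me (k : n.-tuple S -> R) : measurable_fun setT k ->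
      measurable_fun setT (fun v : n.-tuple S * config S => (k v.1)%:E : \bar R).
    by move=> mk; apply/measurable_EFinP; apply: (measurableT_comp mk); exact: measurable_fst.
  have e0 (k : n.-tuple S -> R) : (forall u, (0 <= k u)%R) ->
    forall v : n.-tuple S * config S, 0 <= (k v.1)%:E by move=> k0 v; rewrite lee_fin.
  rewrite (integral_sum_ZZ (me _ mh) (e0 _ h0)).
  rewrite (integral_sum_unmarked P mX mx x_inj X_x
    (me _ (measurable_funM mh mpt)) (e0 _ (fun u => mulr_ge0 (h0 u) (pt0 u)))).
  apply: eq_esum => t _; case: ifP => // _; apply: eq_integral => w _ /=.
  by rewrite -!EFinM; congr EFin; rewrite -mulrA; congr (_ * _)%R; rewrite mulrC.
have : {ae mpower mu n, forall u, (rhoZ u)%:E = (prob_tuple true u * rhoX u)%:E}.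
  apply: sigma_finite_ae_eq.
  - exact/measurable_EFinP.
  - by apply/measurable_EFinP; exact: measurable_funM.
  - by move=> u; rewrite lee_fin.
  - by move=> u; rewrite lee_fin mulr_ge0.
  - move=> A mA; rewrite [LHS]integral_mkcond [RHS]integral_mkcond !epatch_indic.
    have h0 u : (0 <= \1_A u :> R)%R by rewrite indicE.
    transitivity (\int[mpower mu n]_u (\1_A u * rhoZ u)%:E).
      by apply: eq_integral => u _; rewrite /= -EFinM mulrC.
    rewrite (key (\1_A : n.-tuple S -> R) (measurable_indic mA) h0).
    by apply: eq_integral => u _; rewrite /= -EFinM -mulrA mulrC.
by apply: filterS => u [].
Qed.

(** * The marked process and its conditional intensity given [Y] *)

Section marked_process.
Variable Xb : T -> config (S * bool)%type.
Hypothesis mXb : measurable_fun setT Xb.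
Hypothesis XbE : forall w, points (Xb w) =
  (fun i => (x_ i w, m i w)) @` [set i | in_range i w].

(** Removing a tuple of marks [true] leaves the points of mark [false] untouched, so the ground
    configuration is still [Y]. *)
Let sum_ground n (C : set (n.-tuple S * config S)) w :
  sum_distinct (Xb w) (fun t : n.-tuple (S * bool) => ((all_true t)%:R *
    \1_C (map_tuple (fun z => z.1) t, ground (remove (Xb w) t)))%R%:E) =
  sum_distinct (Z w) (fun x : n.-tuple S => (\1_C (x, Y w))%:E) :> \bar R.
Proof.
rewrite sum_distinct_ge0; last by move=> t; rewrite lee_fin mulr_ge0.
rewrite {1}XbE esum_enum; last first.
  move=> i j iw jw [xij _]; exact: (x_inj iw jw xij).
rewrite ZE (sum_marked m x_inj X_x true)//.
apply: eq_esum => t _; rewrite /valid; case: (uniq t) => //=.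
case: (all _ t) => //=.
set tt := map_tuple _ t.
have allE : all_true tt = all (fun i => m i w == true) t.
  rewrite /all_true /= all_map; apply: eq_all => i /=.
  by case: (m i w).
rewrite allE; case: ifPn => [tm|_]; last by rewrite mul0r.
rewrite mul1r; congr ((\1_C (_, _))%:E).
  by apply: eq_from_tnth => i; rewrite !tnth_map.
rewrite YE; apply: config_eq; apply/seteqP; split => s /=.
  move=> [+ _]; rewrite XbE => -[i /= iw [<- mi]].
  by exists i => //=; rewrite iw mi.
move=> [i /= /andP[iw /eqP mi] <-]; split; first by rewrite XbE; exists i; rewrite ?mi.
move=> /mapP[j jt [_ mj]]; have /allP/(_ _ jt) := tm.
by rewrite -mj.
Qed.

(** The formula for the marked process is tested on the factor [all_true] times the indicator of [C]
    at the projected tuple and the ground configuration; [integral_mpower_true] then leaves an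
    integral over unmarked tuples. *)
Lemma marked_transfer n (mu : {sigma_finite_measure set S -> \bar R}) lamXb
    (C : set (n.-tuple S * config S)) :
  is_papangelou (mprod mu (mark_counting R)) P Xb lamXb -> measurable C ->
  \int[P]_w sum_distinct (Z w) (fun x : n.-tuple S => (\1_C (x, Y w))%:E) =
  \int[mpower mu n]_u \int[P]_w
    (\1_C (u, Y w) * lamXb (map_tuple (fun s => (s, true)) u, Xb w))%:E.
Proof.
move=> HXb mC; have [ml l0 _] := HXb.
have m1C : measurable_fun setT (\1_C : n.-tuple S * config S -> R) by exact: measurable_indic.
pose k (v : n.-tuple (S * bool) * config (S * bool)%type) : R :=
  \1_C (map_tuple (fun z => z.1) v.1, ground v.2).
have mk : measurable_fun setT k.
  apply: (measurableT_comp m1C); apply/measurable_fun_pairP; split.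
    have mfst : measurable_fun setT
        (map_tuple (fun z => z.1) : n.-tuple (S * bool) -> n.-tuple S).
      by apply: measurable_map_tuple; exact: measurable_fst.
    exact: (measurableT_comp mfst measurable_fst).
  by apply: (measurableT_comp (@measurable_ground _ _ _)); exact: measurable_snd.
have mh : measurable_fun setT
    (fun v : n.-tuple (S * bool) * config (S * bool)%type => (all_true v.1)%:R * k v)%R.
  apply: measurable_funM => //.
  rewrite (_ : (fun v => _) = (fun v => if all_true v.1 then 1 else 0)%R).
    apply: measurable_fun_ifT => //.
    by apply: (measurableT_comp (@measurable_all_true _ _ _)); exact: measurable_fst.
  by apply/funext => v; case: (all_true _).
have h0 v : (0 <= (all_true v.1)%:R * k v)%R by rewrite mulr_ge0.
have := papangelou_gnz HXb mh h0.
rewrite (eq_integral (fun w => sum_distinct (Z w) (fun x : n.-tuple S => (\1_C (x, Y w))%:E)));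
  last by move=> w _; rewrite -sum_ground.
move=> ->.
pose F v : \bar R := \int[P]_w (k (v, Xb w) * lamXb (v, Xb w))%:E.
have mkl : measurable_fun setT
    (fun v : n.-tuple (S * bool) * T => (k (v.1, Xb v.2) * lamXb (v.1, Xb v.2))%:E : \bar R).
  have mv : measurable_fun setT (fun v : n.-tuple (S * bool) * T => (v.1, Xb v.2)).
    apply/measurable_fun_pairP; split; first exact: measurable_fst.
    exact: (measurableT_comp mXb measurable_snd).
  apply/measurable_EFinP; apply: measurable_funM.
    exact: (measurableT_comp mk mv).
  exact: (measurableT_comp ml mv).
have mF : measurable_fun setT F.
  apply: (@measurable_fun_fubini_tonelli_F _ _ _ T R P _ mkl) => v.
  by rewrite lee_fin mulr_ge0.
have F0 v : 0 <= F v by apply: integral_ge0 => w _; rewrite lee_fin mulr_ge0.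
transitivity (\int[mpower (mprod mu (mark_counting R)) n]_v ((all_true v)%:R%:E * F v)).
  apply: eq_integral => v _; rewrite /F -ge0_integralZl//; last 2 first.
  - exact: (measurableT_comp mkl (pair1_measurable v)).
  - by move=> w _; rewrite lee_fin mulr_ge0.
  by apply: eq_integral => w _; rewrite -EFinM mulrA.
rewrite (integral_mpower_true mu mF F0); apply: eq_integral => u _; apply: eq_integral => w _.
congr EFin; congr (_ * _)%R; rewrite /k /=; congr (\1_C (_, _)).
  by apply: eq_from_tnth => i; rewrite !tnth_map.
rewrite YE; apply: config_eq; apply/seteqP; split => s /=.
  by rewrite XbE => -[i /= iw [<- mi]]; exists i => //=; rewrite iw mi.
by move=> [i /= /andP[iw /eqP mi] <-]; rewrite XbE; exists i; rewrite ?mi.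
Qed.

Lemma papangelou_marked_ae n (mu : {sigma_finite_measure set S -> \bar R}) lamXb
    (lamY : n.-tuple S * config S -> R) :
  is_papangelou (mprod mu (mark_counting R)) P Xb lamXb -> is_papangelou mu P Y lamY ->
  {ae mpower mu n, forall u : n.-tuple S, {ae P, forall w,
    condexp P Y (fun w' => (lamXb (map_tuple (fun s => (s, true)) u, Xb w'))%:E) w =
    (prob_tuple true u / prob_tuple false u * lamY (u, Y w))%:E}}.
Proof.
move=> HXb HY; have [ml l0 _] := HXb; have [mlY lY0 _] := HY.
have pt0 b (u : n.-tuple S) : (0 < prob_tuple b u)%R by exact: prob_tuple_gt0.
pose r (u : n.-tuple S) : R := (prob_tuple true u / prob_tuple false u)%R.
have mr : measurable_fun setT r.
  by apply: measurable_funM; [exact: measurable_prob_tuple|exact: measurable_probV].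
have r0 u : (0 <= r u)%R by rewrite mulr_ge0 ?invr_ge0 ?ltW.
have mr1 : measurable_fun setT (fun v : n.-tuple S * config S => r v.1).
  by apply: (measurableT_comp mr); exact: measurable_fst.
pose f (v : n.-tuple S * config S) : R := (r v.1 * lamY v)%R.
have mf : measurable_fun setT f by exact: measurable_funM.
have f0 v : (0 <= f v)%R by rewrite mulr_ge0.
pose g (v : n.-tuple S * T) : R := lamXb (map_tuple (fun s => (s, true)) v.1, Xb v.2).
have mg : measurable_fun setT g.
  apply: (measurableT_comp ml); apply/measurable_fun_pairP; split.
    have mtrue : measurable_fun setT
        (map_tuple (fun s => (s, true)) : n.-tuple S -> n.-tuple (S * bool)).
      by apply: measurable_map_tuple; exact: pair2_measurable.
    exact: (measurableT_comp mtrue measurable_fst).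
  by apply: (measurableT_comp mXb); exact: measurable_snd.
have g0 v : (0 <= g v)%R by exact: l0.
have fg C : measurable C ->
    \int[mpower mu n]_u \int[P]_w (\1_C (u, Y w) * f (u, Y w))%:E =
    \int[mpower mu n]_u \int[P]_w (\1_C (u, Y w) * g (u, w))%:E.
  move=> mC; rewrite -(marked_transfer HXb mC).
  have m1C : measurable_fun setT (\1_C : n.-tuple S * config S -> R) by exact: measurable_indic.
  have mq1 : measurable_fun setT (fun v : n.-tuple S * config S => (prob_tuple false v.1)^-1)%R.
    by apply: (measurableT_comp (@measurable_probV n false)); exact: measurable_fst.
  (* With this test function the weight [prob_tuple false] cancels on the [Z] side, while the [Y]
     side acquires the ratio [r]. *)
  have := @thinning_swap_ge0 n (fun v => \1_C v / prob_tuple false v.1)%R.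
  move=> /(_ (measurable_funM m1C mq1)) swap.
  transitivity (\int[P]_w sum_distinct (Y w) (fun x : n.-tuple S =>
      (\1_C (x, remove (Y w) x) / prob_tuple false x * prob_tuple true x)%R%:E)).
    have mh : measurable_fun setT (fun v : n.-tuple S * config S => \1_C v * r v.1)%R.
      exact: measurable_funM.
    have h0 v : (0 <= \1_C v * r v.1)%R by rewrite mulr_ge0.
    have := papangelou_gnz HY mh h0.
    under eq_integral do under [X in sum_distinct _ X]eq_fun do
      rewrite /r /= mulrA mulrAC.
    move=> ->; apply: eq_integral => u _; apply: eq_integral => w _.
    by rewrite /f /= mulrA.
  rewrite -swap; last by move=> v; rewrite mulr_ge0// invr_ge0 ltW.
  apply: eq_integral => w _; congr sum_distinct; apply/funext => x; congr EFin.
  by rewrite divfK// gt_eqF.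
have := integral_exchange_ae S_Borel Bopen Bbase mY mf mg f0 g0 fg.
apply: filterS => u Hu.
have c : is_condexp P Y
    (fun w' => (lamXb (map_tuple (fun s => (s, true)) u, Xb w'))%:E)
    (fun w => (f (u, Y w))%:E).
  split; last by move=> A mA; exact: Hu.
  apply: (measurable_preimage_comp (f := fun c => (f (u, c))%:E : \bar R)).
  by apply/measurable_EFinP; exact: measurable_fun_pair2.
have fe0 w : 0 <= (f (u, Y w))%:E by rewrite lee_fin.
exact: (condexp_ae_eq mY c fe0).
Qed.

End marked_process.

End thinned_process.

Theorem theorem1 (R : realType) (dS d : measure_display)
  (S : measurableCompleteMetricType dS R)
  (S_separable : separable S)
  (S_Borel : (measurable : set (set S)) = <<s [set A : set S | open A] >>)
  (mu : {sigma_finite_measure set S -> \bar R})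
  (mu_locally_finite : forall (x : S) (r : R), mu (ball x r) < +oo)
  (T : measurableType d) (P : probability T R)
  (X Z Y : {RV P >-> config S}) (Xb : {RV P >-> config (S * bool)%type})
  (p : S -> R) (p_measurable : measurable_fun setT p)
  (p_in01 : forall u : S, (0 < p u < 1)%R)
  (Xb_marking : independent_marking P p X Xb)
  (Z_thinning : forall w : T, points (Z w) = [set x : S | points (Xb w) (x, true)])
  (Y_complement : forall w : T, points (Y w) = points (X w) `\` points (Z w))
  (n : nat) (n_ge1 : (1 <= n)%N) :
  [/\ (* (1) *)
      forall h : n.-tuple S * config S -> R, measurable_fun setT h ->
        let lhs (g : n.-tuple S * config S -> R) :=
          \int[P]_w sum_distinct (Z w) (fun x : n.-tuple S =>
            (g (x, Y w) * \prod_(i < n) (1 - p (tnth x i)))%:E) in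
        let rhs (g : n.-tuple S * config S -> R) :=
          \int[P]_w sum_distinct (Y w) (fun x : n.-tuple S =>
            (g (x, remove (Y w) x) * \prod_(i < n) p (tnth x i))%:E) in
        (forall v, (0 <= h v)%R) \/
          (lhs (fun v => `|h v|%R) < +oo /\ rhs (fun v => `|h v|%R) < +oo) ->
        lhs h = rhs h,
      (* (2), conditional intensities *)
      forall lamX lamZ : n.-tuple S * config S -> R,
        is_papangelou mu P X lamX -> is_papangelou mu P Z lamZ ->
        {ae mpower mu n, forall u : n.-tuple S, {ae P, forall w,
          (lamZ (u, Z w))%:E = (\prod_(i < n) p (tnth u i))%:E *
            condexp P Z (fun w' => (lamX (u, X w'))%:E) w}},
      (* (2), product densities *)
      forall rhoX rhoZ : n.-tuple S -> R,
        is_product_density mu P X rhoX -> is_product_density mu P Z rhoZ ->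
        {ae mpower mu n, forall u : n.-tuple S,
          rhoZ u = (\prod_(i < n) p (tnth u i) * rhoX u)%R} &
      (* (3) *)
      forall (lamXb : n.-tuple (S * bool) * config (S * bool)%type -> R)
             (lamY : n.-tuple S * config S -> R),
        is_papangelou (mprod mu (mark_counting R)) P Xb lamXb ->
        is_papangelou mu P Y lamY ->
        {ae mpower mu n, forall u : n.-tuple S, {ae P, forall w,
          condexp P Y
            (fun w' => (lamXb (map_tuple (fun s => (s, true)) u, Xb w'))%:E) w =
          ((\prod_(i < n) p (tnth u i)) / (\prod_(i < n) (1 - p (tnth u i)))
            * lamY (u, Y w))%:E}}].
Proof.
have [B [Bopen Bbase]] := open_countable_base S_separable.
have [x_ [m [mx mm xinj XbE mc]]] := Xb_marking.
have x_inj w : set_inj [set i | in_range X i w] (x_ ^~ w) by have [] := xinj w.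
have X_x w : points (X w) = x_ ^~ w @` [set i | in_range X i w] by have [] := xinj w.
have mX : measurable_fun setT X by exact: measurable_funPT.
have mXb : measurable_fun setT Xb by exact: measurable_funPT.
have ZE w : Z w = marked m X_x true [::] w.
  apply: config_eq; rewrite Z_thinning XbE; apply/seteqP; split => s /=.
    by move=> [i iw [<- mi]]; exists i => //=; rewrite mi andbT.
  by move=> [i /= /andP[iw /eqP mi] <-]; exists i => //; rewrite mi.
have YE w : Y w = marked m X_x false [::] w.
  apply: config_eq; rewrite Y_complement ZE X_x; apply/seteqP; split => s /=.
    move=> [[i /= iw <-] nZ]; exists i => //=; rewrite iw /=.
    case mi : (m i w) => //=; exfalso; apply: nZ.
    by exists i => //=; rewrite iw mi.
  move=> [i /= /andP[iw /eqP mi] <-]; split; first by exists i.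
  move=> [j /= /andP[jw /eqP mj] xij].
  (* A point has a single index, hence a single mark: it cannot be both retained and deleted. *)
  by have ij : j = i; [apply: (x_inj w) xij; rewrite inE|rewrite ij mi in mj].
split.
- move=> h mh lhs rhs [h0|[hl hr]].
    exact: (thinning_swap_ge0 S_Borel Bopen Bbase mX p_measurable p_in01
      mx mm x_inj mc ZE YE mh h0).
  exact: (thinning_swap S_Borel Bopen Bbase mX p_measurable p_in01 mx mm x_inj mc ZE YE mh hl hr).
- move=> lamX lamZ HX HZ.
  exact: (papangelou_thinned_ae S_Borel Bopen Bbase mX p_measurable p_in01 mx mm x_inj mc ZE HX HZ).
- move=> rhoX rhoZ HX HZ.
  exact: (density_thinned_ae S_Borel Bopen Bbase mX p_measurable p_in01 mx mm x_inj mc ZE HX HZ).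
- move=> lamXb lamY HXb HY.
  exact: (papangelou_marked_ae S_Borel Bopen Bbase mX p_measurable p_in01 mx mm
    x_inj mc ZE YE mXb XbE HXb HY).
Qed.
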